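(* Let $\beta\in\{1,2,w_1,w_2\}$ and let $X_N^{(\beta)}$ be the random matrix defined in the context. Assume the Laplace hypothesis, the concentration hypothesis and, if $\beta\in\{w_1,w_2\}$, that there exist $\alpha>1$ and $\kappa>0$ such that $|\frac ML-\alpha|\le N^{-\kappa}$ for $N$ large enough. For $\theta\ge0$ let $$F_N(\theta,\beta)=\frac1N\ln\mathbb E_{X_N^{(\beta)}}\mathbb E_e\left[e^{\theta N\langle e,X_N^{(\beta)}e\rangle}\right],$$ where $e$ is uniformly distributed on the unit sphere and independent of $X_N^{(\beta)}$. Then for every $\theta\ge0$, $\lim_{N\to\infty}F_N(\theta,\beta)=F(\theta,\beta)$, where $F(\theta,\beta)=\theta^2/\beta$ if $\beta=1,2$, and for $\beta=w_i$, $i=1,2$, $$F(\theta,w_i)=\sup_{x\in[0,1]}\left\{\frac{2\theta^2}i x(1-x)+\frac{i}{2(1+\alpha)}\ln(1-x)+\frac{i\alpha}{2(1+\alpha)}\ln x\right\}-iC_\alpha,$$ with $C_\alpha=\frac1{2(1+\alpha)}\ln\left(\frac1{1+\alpha}\right)+\frac\alpha{2(1+\alpha)}\ln\frac\alpha{1+\alpha}$.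
   Context: The unit sphere is that of $\mathbb R^N$ for $\beta=1,w_1$ and of $\mathbb C^N$ for $\beta=2,w_2$. Models. $\beta=1$: $X_N^{(1)}$ is the $N\times N$ real symmetric matrix with $X_N^{(1)}(i,j)=a_{i,j}/\sqrt N$ for $i\le j$, where $(a_{i,j})_{1\le i\le j\le N}$ are independent real, centered, with $\mathbb E[a_{i,j}^2]=1$ for $i<j$ and $\mathbb E[a_{i,i}^2]=2$. $\beta=2$: $X_N^{(2)}$ is the $N\times N$ Hermitian matrix with $X_N^{(2)}(i,j)=a_{i,j}/\sqrt N$ for $i\le j$, where $(a_{i,j})_{1\le i\le j\le N}$ are independent, centered, complex for $i<j$ with $\mathbb E[(\Re a_{i,j})^2]=\mathbb E[(\Im a_{i,j})^2]=\frac12$, $\mathbb E[\Re a_{i,j}\Im a_{i,j}]=0$, and real for $i=j$ with $\mathbb E[a_{i,i}^2]=1$. $\beta=w_i$, $i=1,2$: $N=L+M$ with integers $L=L_N\le M=M_N$, and $X_N^{(w_i)}=\begin{pmatrix}0&\frac1{\sqrt N}G\\ \frac1{\sqrt N}G^*&0\end{pmatrix}$, where $G$ is $L\times M$ with independent centered entries, real with variance 1 if $i=1$, complex with the same moments up to order two as the off-diagonal entries of the case $\beta=2$ if $i=2$. The laws of the entries ($a_{i,j}$, $i\le j$, or entries of $G$) are denoted $\mu^N_{i,j}$ and may depend on $N$. Laplace transform: $T_\mu(t)=\int e^{tx}d\mu(x)$, $t\in\mathbb R$, for $\mu$ on $\mathbb R$; $T_\mu(t)=\int\exp\{\Re(a\bar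 t)\}d\mu(a)$, $t\in\mathbb C$, for $\mu$ on $\mathbb C$. Laplace hypothesis: set $q(t)=\frac{t^2}2\int x^2d\mu(x)$, $t\in\mathbb R$, for real entries with law $\mu$, and $q(t)=|t|^2/4$, $t\in\mathbb C$, for complex entries. Then (1) $T_{\mu^N_{i,j}}(t)\le e^{q(t)}$ for all $t,i,j,N$; (2) for every $\delta>0$ there is $\varepsilon(\delta)>0$ with $T_{\mu^N_{i,j}}(t)\ge e^{(1-\delta)q(t)}$ for all $|t|\le\varepsilon(\delta)$ and all $i,j,N$; (3) for $\epsilon>0$ small enough the third order derivatives of $\ln T_{\mu^N_{i,j}}$ are bounded on $\{|t|\le\epsilon\}$ uniformly in $i,j,N$. Concentration hypothesis: either the supports of all $\mu^N_{i,j}$ lie in a common compact set, or all $\mu^N_{i,j}$ satisfy the log-Sobolev inequality $\int f^2\ln\frac{f^2}{\mu^N_{i,j}(f^2)}d\mu^N_{i,j}\le c\,\mu^N_{i,j}(\|\nabla f\|_2^2)$ for all smooth $f$ with the same constant $c$. *)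

(* Defs.v *)
From HB Require Import structures.
From mathcomp Require Import all_boot all_order all_algebra.
From mathcomp Require Import all_classical all_reals all_analysis.
From mathcomp Require Import complex.

Set Implicit Arguments.
Unset Strict Implicit.
Unset Printing Implicit Defensive.

Import Order.TTheory GRing.Theory Num.Theory.
Import numFieldNormedType.Exports.

Local Open Scope classical_set_scope.
Local Open Scope ring_scope.
Local Open Scope complex_scope.
Local Open Scope sesquilinear_scope.

(* A complex random variable is encoded by the pair of its real and imaginary
   parts, i.e., the measurable space C is R * R; linear algebra over C is done
   in R[i]. *)
Definition toC (R : realType) (z : R * R) : R[i] := z.1 +i* z.2.

HB.instance Definition _ d1 d2 (T1 : measurableType d1)
    (T2 : measurableType d2) :=
  isMeasurableFun.Build _ _ (T1 * T2)%type T1 (@fst T1 T2) measurable_fst.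

Definition mutually_independent d d' (T : measurableType d)
    (T' : measurableType d') (R : realType) (P : probability T R)
    (I : finType) (D : {set I}) (X : I -> T -> T') : Prop :=
  forall (J : {set I}) (B : I -> set T'), J \subset D ->
    (forall i, i \in J -> measurable (B i)) ->
    P (\bigcap_(i in [set` J]) X i @^-1` B i) =
      (\prod_(i in J) P (X i @^-1` B i))%E.

Section laws.
Context {R : realType}.
Local Notation law := (probability R R).
Local Notation claw := (probability (R * R)%type R).

Definition laplaceR (mu : law) (t : R) : \bar R :=
  (\int[mu]_x (expR (t * x))%:E)%E.

(* Re (a * conj t) = a.1 * t.1 + a.2 * t.2 *)
Definition laplaceC (mu : claw) (t : R * R) : \bar R :=
  (\int[mu]_a (expR (a.1 * t.1 + a.2 * t.2))%:E)%E.

Definition qR (mu : law) (t : R) : R :=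
  t ^+ 2 / 2 * fine (\int[mu]_x (x ^+ 2)%:E)%E.

Definition modC (t : R * R) : R := Num.sqrt (t.1 ^+ 2 + t.2 ^+ 2).

Definition qC (t : R * R) : R := modC t ^+ 2 / 4.

Definition basisC : seq (R * R) := [:: (1, 0); (0, 1)].

(* LR and LC are the sets of the laws of the real and of the complex entries,
   for all sizes N together. *)
Definition laplace_hypothesis (LR : set law) (LC : set claw) : Prop :=
  [/\ (forall mu, LR mu -> forall t, (laplaceR mu t <= (expR (qR mu t))%:E)%E) /\
      (forall mu, LC mu -> forall t, (laplaceC mu t <= (expR (qC t))%:E)%E),
      forall delta : R, 0 < delta -> exists2 eps : R, 0 < eps &
        (forall mu, LR mu -> forall t, `|t| <= eps ->
          ((expR ((1 - delta) * qR mu t))%:E <= laplaceR mu t)%E) /\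
        (forall mu, LC mu -> forall t, modC t <= eps ->
          ((expR ((1 - delta) * qC t))%:E <= laplaceC mu t)%E) &
      exists2 eps : R, 0 < eps & exists C : R,
        (forall mu, LR mu -> forall t, `|t| <= eps ->
          `|derive1n 3 (fun s => ln (fine (laplaceR mu s))) t| <= C) /\
        (forall mu, LC mu -> forall t, modC t <= eps ->
          forall u v w, u \in basisC -> v \in basisC -> w \in basisC ->
          `|'D_u ('D_v ('D_w (fun s => ln (fine (laplaceC mu s))))) t| <= C)].

(* The topological support. *)
Definition msupport (T : topologicalType) (mu : set T -> \bar R) : set T :=
  [set x | forall U, open U -> U x -> (0 < mu U)%E].

Definition smooth (V : normedModType R) (f : V -> R) : Prop :=
  forall (s : seq V) (x : V), differentiable (foldr (fun v g => 'D_v g) f s) x.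

Definition entropy d (T : measurableType d) (mu : probability T R) (f : T -> R)
    : \bar R :=
  let m := fine (\int[mu]_x (f x ^+ 2)%:E)%E in
  (\int[mu]_x (f x ^+ 2 * ln (f x ^+ 2 / m))%:E)%E.

Definition log_sobolevR (c : R) (mu : law) : Prop :=
  forall f : R -> R, smooth f -> (\int[mu]_x (f x ^+ 2)%:E < +oo)%E ->
  (entropy mu f <= c%:E * \int[mu]_x (derive1 f x ^+ 2)%:E)%E.

Definition log_sobolevC (c : R) (mu : claw) : Prop :=
  forall f : R * R -> R, smooth f -> (\int[mu]_z (f z ^+ 2)%:E < +oo)%E ->
  (entropy mu f <=
     c%:E * \int[mu]_z (\sum_(v <- basisC) ('D_v f z) ^+ 2)%:E)%E.

Definition concentration_hypothesis (LR : set law) (LC : set claw) : Prop :=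
  (exists (KR : set R) (KC : set (R * R)), [/\ compact KR, compact KC,
     forall mu, LR mu -> msupport mu `<=` KR &
     forall mu, LC mu -> msupport mu `<=` KC]) \/
  (exists2 c : R, 0 < c & (forall mu, LR mu -> log_sobolevR c mu) /\
     (forall mu, LC mu -> log_sobolevC c mu)).

End laws.

Section sphere.
Context {R : realType} {n : nat}.

Definition vecR (t : n.-tuple R) : 'cV[R]_n := \col_i tnth t i.
Definition tupR (v : 'cV[R]_n) : n.-tuple R := [tuple v i 0 | i < n].

Definition vecC (t : n.-tuple (R * R)) : 'cV[R[i]]_n := \col_i toC (tnth t i).
Definition tupC (v : 'cV[R[i]]_n) : n.-tuple (R * R) :=
  [tuple (complex.Re (v i 0), complex.Im (v i 0)) | i < n].

(* The uniform law on the unit sphere is the probability measure carried by the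
   sphere that is invariant under all orthogonal (resp. unitary) maps. There is
   none for n = 0, the sphere being empty. *)
Definition uniform_sphereR (sigma : probability (n.-tuple R) R) : Prop :=
  sigma [set t | (vecR t)^T *m vecR t = 1%:M] = 1%E /\
  forall (U : 'M[R]_n) (A : set (n.-tuple R)), U *m U^T = 1%:M ->
    measurable A -> sigma ((fun t => tupR (U *m vecR t)) @^-1` A) = sigma A.

Definition uniform_sphereC (sigma : probability (n.-tuple (R * R)) R) : Prop :=
  sigma [set t | (vecC t)^t* *m vecC t = 1%:M] = 1%E /\
  forall (U : 'M[R[i]]_n) (A : set (n.-tuple (R * R))), U \is unitarymx ->
    measurable A -> sigma ((fun t => tupC (U *m vecC t)) @^-1` A) = sigma A.

Definition qformR (X : 'M[R]_n) (t : n.-tuple R) : R :=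
  ((vecR t)^T *m X *m vecR t) 0 0.

(* For Hermitian X the quadratic form is real. *)
Definition qformC (X : 'M[R[i]]_n) (t : n.-tuple (R * R)) : R :=
  complex.Re (((vecC t)^t* *m X *m vecC t) 0 0).

End sphere.

Section matrices.
Context {R : realType}.

Definition wigner1_mx N (a : 'I_N -> 'I_N -> R) : 'M[R]_N :=
  \matrix_(i, j) ((if (i <= j)%N then a i j else a j i) / Num.sqrt N%:R).

Definition wigner2_mx N (a : 'I_N -> 'I_N -> R * R) : 'M[R[i]]_N :=
  \matrix_(i, j) ((if (i <= j)%N then toC (a i j) else (toC (a j i))^*)
                  / (Num.sqrt N%:R)%:C).

Definition wishart1_mx L M (g : 'I_L -> 'I_M -> R) : 'M[R]_(L + M) :=
  let G := (Num.sqrt (L + M)%:R)^-1 *: \matrix_(i, j) g i j in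
  block_mx 0 G (G^T) 0.

Definition wishart2_mx L M (g : 'I_L -> 'I_M -> R * R) : 'M[R[i]]_(L + M) :=
  let G := ((Num.sqrt (L + M)%:R)^-1)%:C *: \matrix_(i, j) toC (g i j) in
  block_mx 0 G (G^t*) 0.

End matrices.

Section entries.
Context {R : realType} {d : measure_display} {T : measurableType d}.
Variable P : probability T R.

Definition real_entry (v : R) (a : T -> R) : Prop :=
  ('E_P[a] = 0)%E /\ ('E_P[fun w => (a w ^+ 2)%R] = v%:E)%E.

Definition complex_entry (a : T -> R * R) : Prop :=
  [/\ ('E_P[fun w => (a w).1] = 0)%E, ('E_P[fun w => (a w).2] = 0)%E,
      ('E_P[fun w => ((a w).1 ^+ 2)%R] = (2^-1)%:E)%E,
      ('E_P[fun w => ((a w).2 ^+ 2)%R] = (2^-1)%:E)%E &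
      ('E_P[fun w => ((a w).1 * (a w).2)%R] = 0)%E].

Definition upper N : {set 'I_N * 'I_N} :=
  [set p : 'I_N * 'I_N | (p.1 <= p.2)%N]%SET.

(* In the two Wigner models only the entries a i j with i <= j are used. *)
Definition wigner1_entries N (a : 'I_N -> 'I_N -> {RV P >-> R}) : Prop :=
  [/\ mutually_independent P (upper N) (fun p => a p.1 p.2),
      forall i j : 'I_N, (i < j)%N -> real_entry 1 (a i j) &
      forall i, real_entry 2 (a i i)].

Definition wigner2_entries N (a : 'I_N -> 'I_N -> {RV P >-> (R * R)%type}) : Prop :=
  [/\ mutually_independent P (upper N) (fun p => a p.1 p.2),
      forall i j : 'I_N, (i < j)%N -> complex_entry (a i j),
      forall i w, (a i i w).2 = 0 &
      forall i, real_entry 1 (fun w => (a i i w).1)].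

Definition wishart1_entries L M (g : 'I_L -> 'I_M -> {RV P >-> R}) : Prop :=
  mutually_independent P [set: 'I_L * 'I_M]%SET (fun p => g p.1 p.2) /\
  forall i j, real_entry 1 (g i j).

Definition wishart2_entries L M (g : 'I_L -> 'I_M -> {RV P >-> (R * R)%type}) : Prop :=
  mutually_independent P [set: 'I_L * 'I_M]%SET (fun p => g p.1 p.2) /\
  forall i j, complex_entry (g i j).

End entries.

Section sets_of_laws.
Context {R : realType} {d : nat -> measure_display}.
Context {T : forall N, measurableType (d N)}.
Variable P : forall N, probability (T N) R.

Definition wigner1_laws (a : forall N, 'I_N -> 'I_N -> {RV (P N) >-> R})
    : set (probability R R) :=
  [set mu | exists N (i j : 'I_N),
     (i <= j)%N /\ mu = distribution (P N) (a N i j)].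

Definition wigner2_diag_laws
    (a : forall N, 'I_N -> 'I_N -> {RV (P N) >-> (R * R)%type})
    : set (probability R R) :=
  [set mu | exists N (i : 'I_N), mu = distribution (P N) (fst \o a N i i)].

Definition wigner2_offdiag_laws
    (a : forall N, 'I_N -> 'I_N -> {RV (P N) >-> (R * R)%type})
    : set (probability (R * R)%type R) :=
  [set mu | exists N (i j : 'I_N),
     (i < j)%N /\ mu = distribution (P N) (a N i j)].

Definition wishart_laws d' (V : measurableType d') (L M : nat -> nat)
    (g : forall N, 'I_(L N) -> 'I_(M N) -> {RV (P N) >-> V})
    : set (probability V R) :=
  [set mu | exists N (i : 'I_(L N)) (j : 'I_(M N)),
     mu = distribution (P N) (g N i j)].

End sets_of_laws.

(* Q w e stands for <e, X e>; the matrix X and the vector e are independent,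
   with laws determined by P and sigma. *)
Definition annealed_F (R : realType) d d' (T : measurableType d) (S : measurableType d')
    (P : probability T R) (sigma : probability S R) (N : nat) (theta : R)
    (Q : T -> S -> R) : \bar R :=
  ((N%:R^-1)%:E *
     lne (\int[P]_w \int[sigma]_e (expR (theta * N%:R * Q w e))%:E))%E.

Definition C_alpha (R : realType) (alpha : R) : R :=
  (2 * (1 + alpha))^-1 * ln ((1 + alpha)^-1) +
  alpha / (2 * (1 + alpha)) * ln (alpha / (1 + alpha)).

(* Extended logarithms: the function is -oo at x = 0 and x = 1. *)
Definition F_wishart (R : realType) (i : nat) (alpha theta : R) : \bar R :=
  (ereal_sup [set (2 * theta ^+ 2 / i%:R * x * (1 - x))%:E
                  + (i%:R / (2 * (1 + alpha)))%:E * lne (1 - x)%:E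
                  + (i%:R * alpha / (2 * (1 + alpha)))%:E * lne x%:E
             | x in `[0%R, 1%R]]
   - (i%:R * C_alpha alpha)%:E)%E.

(* Main.v *)
Require Import Defs.
From mathcomp Require Import all_boot all_order all_algebra.
From mathcomp Require Import all_classical all_reals all_analysis.
From mathcomp Require Import complex.
From mathcomp Require Import measurable_realfun.
From mathcomp Require Import ring lra.

Set Implicit Arguments.
Unset Strict Implicit.
Unset Printing Implicit Defensive.

Import Order.TTheory GRing.Theory Num.Theory.
Import numFieldNormedType.Exports.

Local Open Scope classical_set_scope.
Local Open Scope ring_scope.

(** Conditionally on e, the expectation over the entries is a product of Laplace
    transforms. By (1) it is at most exp (N B(e)), where B = theta^2 / beta in the
    Wigner case and B = (2 theta^2 / beta) x (1 - x), x the mass of the second block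
    of e, in the Wishart case; by (2) it is at least exp ((1 - delta) N B(e)) as soon
    as all the |e_i|^2 are at most kappa / sqrt N. It remains to estimate the mean of
    exp (N B(e)) on the event where e is delocalized.

    Invariance under plane rotations gives an integration by parts formula for the
    |e_i|^2, from which everything needed on the uniform law follows: fourth moments
    of |e_i|^2, and the mass of, and the concentration of x under, the tilted laws of
    density (1 + r x) ^ (- beta N / 2). As x |-> (2 theta^2 / beta) x (1 - x) and the
    logarithms in F are concave, for a suitable r (given by the maximizer x0 of F) the
    function N B + (beta N / 2) ln (1 + r x) is maximal at x0: this gives the upper
    bound, and the lower bound since the tilted law concentrates at x0 on delocalized
    vectors. The Wigner case is the case r = 0. *)

(** The law of e is given only through its invariance, so neither a density nor a Gaussian
    representation is at hand: every moment comes from a mean that stays constant along a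
    one-parameter group of rotations. The threshold kappa / sqrt N is dictated by (2): the Laplace
    transforms are taken at arguments of size theta sqrt N |e_i| |e_j|, which must stay in a fixed
    small ball. As |e_i|^2 is of order 1 / N, Markov at order k with a union bound over i leaves an
    error of order N ^ (1 - k / 2): second moments do not suffice, fourth ones give 1 / N. The
    exponent beta N / 2 of the tilt is the one for which y = (1 + r) x / (1 + r x) has mean |V| / N
    under the tilted law, V being the block that carries the mass x. Asking that x0 be sent to the
    limit of |V| / N determines r. The slope at x0 of (beta / 2) ln (1 + r x) is then that of the
    logarithmic terms of F, so both bounds have the same exponent. *)

(** * Integrals of functions that are bounded on an event *)

Section bounded_measurable.
Context {R : realType} d {S : measurableType d} (mu : probability S R).
Variable D : set S.
Hypothesis mD : measurable D.

(** Measurability is global but the bound is asked on [D] only: the squared moduli of the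
    coordinates, and the weights built on them, are controlled only on the event that they sum to
    1. *)
Definition bounded_mfun (f : S -> R) :=
  measurable_fun setT f /\ exists C, forall x, D x -> `|f x| <= C.

Lemma eq_bounded_mfun f g : g =1 f -> bounded_mfun f -> bounded_mfun g.
Proof. by move/funext->. Qed.

Lemma bounded_mfun_cst c : bounded_mfun (fun=> c).
Proof. by split; [exact: measurable_cst|exists `|c|]. Qed.

Lemma bounded_mfunD f g :
  bounded_mfun f -> bounded_mfun g -> bounded_mfun (fun x => f x + g x).
Proof.
move=> [mf [A fA]] [mg [B gB]]; split; first exact: measurable_funD.
by exists (A + B) => x Dx; rewrite (le_trans (ler_normD _ _))// lerD ?fA ?gB.
Qed.

Lemma bounded_mfunM f g :
  bounded_mfun f -> bounded_mfun g -> bounded_mfun (fun x => f x * g x).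
Proof.
move=> [mf [A fA]] [mg [B gB]]; split; first exact: measurable_funM.
by exists (A * B) => x Dx; rewrite normrM ler_pM ?fA ?gB.
Qed.

Lemma bounded_mfunN f : bounded_mfun f -> bounded_mfun (fun x => - f x).
Proof.
move=> [mf [A fA]]; split; first exact: measurableT_comp.
by exists A => x Dx; rewrite normrN fA.
Qed.

Lemma bounded_mfunB f g :
  bounded_mfun f -> bounded_mfun g -> bounded_mfun (fun x => f x - g x).
Proof. by move=> nf ng; apply: bounded_mfunD => //; exact: bounded_mfunN. Qed.

Lemma bounded_mfunX f n :
  bounded_mfun f -> bounded_mfun (fun x => f x ^+ n).
Proof.
move=> nf; elim: n => [|n ih]; first exact: bounded_mfun_cst.
by apply: (eq_bounded_mfun _ (bounded_mfunM nf ih)) => x; rewrite exprS.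
Qed.

Lemma bounded_mfun_sum (I : Type) (r : seq I) (Q : pred I) (f : I -> S -> R) :
  (forall i, Q i -> bounded_mfun (f i)) ->
  bounded_mfun (fun x => \sum_(i <- r | Q i) f i x).
Proof.
move=> nf; elim: r => [|i r ih].
  by apply: (eq_bounded_mfun _ (bounded_mfun_cst 0)) => x; rewrite big_nil.
apply: (@eq_bounded_mfun
    (fun x => (if Q i then f i x else 0) + \sum_(j <- r | Q j) f j x)).
  by move=> x; rewrite big_cons; case: ifPn => // _; rewrite add0r.
apply: bounded_mfunD => //.
by case: (boolP (Q i)) => [Qi|_]; [exact: nf|exact: bounded_mfun_cst].
Qed.

Lemma bounded_mfun_integrable f :
  bounded_mfun f -> mu.-integrable D (EFin \o f).
Proof.
move=> [mf [C fC]]; apply: (@le_integrable _ _ _ _ _ _ _ (EFin \o cst C)) => //.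
- by apply/measurable_EFinP; exact: measurable_funTS.
- by move=> x Dx /=; rewrite lee_fin (le_trans (fC _ Dx))// ler_norm.
- by apply/finite_measure_integrable_cst.
Qed.

Local Notation E f := (\int[mu]_(x in D) f x)%R.

Lemma expectD f g : bounded_mfun f -> bounded_mfun g ->
  E (fun x => f x + g x) = E f + E g.
Proof. by move=> nf ng; rewrite RintegralD//; exact: bounded_mfun_integrable. Qed.

Lemma expectB f g : bounded_mfun f -> bounded_mfun g ->
  E (fun x => f x - g x) = E f - E g.
Proof. by move=> nf ng; rewrite RintegralB//; exact: bounded_mfun_integrable. Qed.

Lemma expectZ c f : bounded_mfun f -> E (fun x => c * f x) = c * E f.
Proof. by move=> nf; rewrite RintegralZl//; exact: bounded_mfun_integrable. Qed.

Lemma expect_le f g : bounded_mfun f -> bounded_mfun g ->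
  (forall x, D x -> f x <= g x) -> E f <= E g.
Proof. by move=> nf ng fg; apply: le_Rintegral => //; exact: bounded_mfun_integrable. Qed.

Lemma expect_eq f g : (forall x, D x -> f x = g x) -> E f = E g.
Proof. by move=> fg; apply: eq_Rintegral => x /[!inE]; exact: fg. Qed.

Lemma expect_sum (I : Type) (r : seq I) (Q : pred I) (f : I -> S -> R) :
  (forall i, Q i -> bounded_mfun (f i)) ->
  E (fun x => \sum_(i <- r | Q i) f i x) = \sum_(i <- r | Q i) E (f i).
Proof.
move=> nf; elim: r => [|i r ih].
  rewrite big_nil (@expect_eq _ (cst 0)); last by move=> x _; rewrite big_nil.
  by rewrite Rintegral_cst// mul0r.
rewrite big_cons; case: ifPn => Qi; last first.
  by rewrite -ih; apply: expect_eq => x _; rewrite big_cons (negbTE Qi).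
rewrite -ih -expectD//; [|exact: nf|exact: bounded_mfun_sum].
by apply: expect_eq => x _; rewrite big_cons Qi.
Qed.

End bounded_measurable.

(* How the plane rotation (e_i, e_j) |-> (cos t e_i - sin t w e_j,
   sin t conj(w) e_i + cos t e_j), |w| = 1, acts on u = |e_i|^2, v = |e_j|^2 and
   r = Re(e_i conj(w e_j)). *)
Definition trace_rot (R : realType) (t u v r : R) : R * R * R :=
  (cos t ^+ 2 * u + sin t ^+ 2 * v - 2 * (cos t * sin t) * r,
   sin t ^+ 2 * u + cos t ^+ 2 * v + 2 * (cos t * sin t) * r,
   (cos t ^+ 2 - sin t ^+ 2) * r + cos t * sin t * (u - v)).

(* s i stands for |e_i|^2. In the real case (beta = 1) the only r is e_i e_j; in
   the complex case (beta = 2) the two r are the real and imaginary parts of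
   e_i conj(e_j). *)
Definition rot_invariant (R : realType) d (S : measurableType d)
    (sigma : probability S R) (n beta : nat) (s : 'I_n -> S -> R) : Prop :=
  [/\ (forall i, measurable_fun setT (s i)), (forall i x, 0 <= s i x),
      sigma [set x | \sum_i s i x = 1] = 1%E &
      forall i j, i != j -> exists r : 'I_beta -> S -> R,
      [/\ forall b, measurable_fun setT (r b),
          forall x, \sum_b r b x ^+ 2 = s i x * s j x &
          forall b t, exists phi : S -> S,
          [/\ measurable_fun setT phi,
              forall A, measurable A -> sigma (phi @^-1` A) = sigma A,
              forall x, (s i (phi x), s j (phi x), r b (phi x)) =
                trace_rot t (s i x) (s j x) (r b x) &
              forall x l, l != i -> l != j -> s l (phi x) = s l x]]].

(** * The full-measure event where the masses sum to 1, and its invariance *)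

Section simplex_domain.
Context {R : realType} d {S : measurableType d} (sigma : probability S R).
Variables (n beta : nat) (s : 'I_n -> S -> R).
Hypothesis inv : rot_invariant sigma beta s.

Let ms i : measurable_fun setT (s i). Proof. by case: inv. Qed.
Let s_ge0 i x : 0 <= s i x. Proof. by case: inv. Qed.

Definition simplex_dom : set S := [set x | \sum_i s i x = 1].
Local Notation D := simplex_dom.

Lemma measurable_simplex_dom : measurable D.
Proof.
have mf : measurable_fun setT (fun x => \sum_i s i x) by exact: measurable_sum.
rewrite -[X in measurable X]setTI.
exact: (mf measurableT [set 1] (measurable_set1 1)).
Qed.
Let mD := measurable_simplex_dom.

Lemma simplex_dom_full : sigma D = 1%E. Proof. by case: inv. Qed.

Lemma s_le1 i x : D x -> s i x <= 1.
Proof.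
move=> <-; rewrite (bigD1 i)//= lerDl; apply: sumr_ge0 => j _; exact: s_ge0.
Qed.

Lemma bounded_mfun_s i : bounded_mfun D (s i).
Proof. by split=> //; exists 1 => x Dx; rewrite ger0_norm// s_le1. Qed.

Lemma s_sum_le1 (V : {set 'I_n}) x : D x -> \sum_(i in V) s i x <= 1.
Proof.
move=> <-; rewrite [leRHS](bigID (mem V))/= lerDl.
by apply: sumr_ge0 => j _; exact: s_ge0.
Qed.

Lemma s_sum_itv (V : {set 'I_n}) x : D x -> 0 <= \sum_(i in V) s i x <= 1.
Proof. by move=> Dx; rewrite s_sum_le1 ?sumr_ge0. Qed.

Local Notation E f := (\int[sigma]_(x in D) f x)%R.

Lemma expect_phi (phi : S -> S) (F : S -> R) :
  measurable_fun setT phi ->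
  (forall A, measurable A -> sigma (phi @^-1` A) = sigma A) ->
  (forall x, D (phi x) <-> D x) ->
  bounded_mfun D F -> E (F \o phi) = E F.
Proof.
move=> mphi pphi Dphi bF; rewrite /Rintegral; congr fine.
have pD : phi @^-1` D = D by apply/seteqP; split=> x /Dphi.
have [mF [C FC]] := bF.
transitivity (\int[pushforward sigma phi]_(y in D) (F y)%:E)%E; last first.
  apply: eq_measure_integral => A mA _; exact: pphi.
rewrite (@integral_pushforward _ _ _ _ _ phi mphi sigma D (EFin \o F))//=.
- by rewrite pD.
- exact/measurable_EFinP.
- rewrite pD; apply: (@bounded_mfun_integrable _ _ _ _ _ mD (F \o phi)).
  split; first exact: measurableT_comp.
  by exists C => x Dx /=; apply: FC; apply/Dphi.
Qed.

End simplex_domain.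

Section trace_rot.
Context {R : realType}.
Variables u v r : R.
Let a t := (trace_rot t u v r).1.1.
Let b t := (trace_rot t u v r).1.2.
Let q t := (trace_rot t u v r).2.

(** The flow closes on these three quantities, so the time derivative of any function of them is
    again a function of them. *)
Lemma is_derive_trace_rot (t : R) :
  [/\ is_derive t 1 a (- 2 * q t), is_derive t 1 b (2 * q t) &
      is_derive t 1 q (a t - b t)].
Proof.
by split; rewrite /a /b /q/=; apply: is_derive_eq; rewrite /GRing.scale/=; ring.
Qed.

End trace_rot.

Lemma is_derive_expect (R : realType) d (S : measurableType d)
    (mu : probability S R) (D : set S) (mD : measurable D)
    (f f' : R -> S -> R) (u v a C : R) :
  u < a < v ->
  (forall t, u < t < v -> bounded_mfun D (f t)) ->
  (forall t x, u < t < v -> D x -> is_derive t 1 (f ^~ x) (f' t x)) ->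
  (forall t x, u < t < v -> D x -> `|f' t x| <= C) ->
  is_derive a 1 (fun t => \int[mu]_(x in D) f t x) (\int[mu]_(x in D) f' a x).
Proof.
move=> uav bf df f'C.
have Ia : `]u, v[%classic a by rewrite /= in_itv.
have int t : `]u, v[%classic t -> mu.-integrable D (EFin \o f t).
  by rewrite /= in_itv => /bf; exact: bounded_mfun_integrable.
have der t x : `]u, v[%classic t -> D x -> derivable (f ^~ x) t 1.
  by rewrite /= in_itv => tuv Dx; case: (df t x tuv Dx).
have d1f t x : u < t < v -> D x -> partial1of2 f t x = f' t x.
  by move=> tuv Dx; rewrite partial1of2E; case: (df t x tuv Dx).
(* If [D] is empty, [C] may be negative, whereas a dominating function has to be nonnegative. *)
have C0 (x : S) : 0 <= Num.max 0 C by rewrite le_max lexx.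
have intC : mu.-integrable D (EFin \o cst (Num.max 0 C)).
  exact/bounded_mfun_integrable/bounded_mfun_cst.
have fC t x : `]u, v[%classic t -> D x ->
    `|partial1of2 f t x| <= cst (Num.max 0 C) x.
  by rewrite /= in_itv => tuv Dx; rewrite d1f// le_max f'C ?orbT.
apply: DeriveDef.
  exact: (derivable_under_integral mD Ia int der C0 intC fC).
rewrite -derive1E (differentiation_under_integral mD Ia int der C0 intC fC).
by apply: expect_eq => x Dx; rewrite d1f.
Qed.

Lemma ler_normM1 (R : realType) (x y C : R) :
  `|x| <= 1 -> `|y| <= C -> `|x * y| <= C.
Proof. by move=> x1 yC; rewrite normrM -[leRHS]mul1r ler_pM. Qed.

(** Serves to dominate the time derivative along the flow, uniformly in time: [J] is a difference of
    two membership indicators, [p] and [p'] are powers of the rotated mass. *)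
Lemma stein_term_bound (R : realType) (a b q J p p' W W' k C : R) :
  0 <= a <= 1 -> 0 <= b <= 1 -> `|q| <= 1 -> `|J| <= 1 -> `|p| <= 1 ->
  `|p'| <= 1 -> `|W| <= C -> `|W'| <= C -> 0 <= k ->
  `|(a - b) * p * W + 2 * q ^+ 2 * (J * p * W' - k * p' * W)| <=
    C + 2 * (C + k * C).
Proof.
move=> /andP[a0 a1] /andP[b0 b1] q1 J1 p1 p'1 WC W'C k0.
rewrite (le_trans (ler_normD _ _))// lerD//.
  rewrite -mulrA; apply: ler_normM1; last exact: ler_normM1.
  by rewrite ler_norml; apply/andP; split; lra.
rewrite -mulrA normrM ger0_norm// ler_pM2l//.
apply: ler_normM1; first by rewrite normrX exprn_ile1.
rewrite (le_trans (ler_normB _ _))// lerD//.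
  by rewrite -mulrA; apply: ler_normM1 => //; exact: ler_normM1.
by rewrite -mulrA normrM ger0_norm// ler_wpM2l//; exact: ler_normM1.
Qed.

(** * Integration by parts along plane rotations *)

Section stein.
Context {R : realType} d {S : measurableType d} (sigma : probability S R).
Variables (n beta : nat) (s : 'I_n -> S -> R).
Hypothesis inv : rot_invariant sigma beta s.

Let ms i : measurable_fun setT (s i). Proof. by case: inv. Qed.
Let s_ge0 i x : 0 <= s i x. Proof. by case: inv. Qed.
Local Notation D := (simplex_dom s).
Let mD : measurable D. Proof. exact: (measurable_simplex_dom inv). Qed.
Local Notation E f := (\int[sigma]_(x in D) f x)%R.

Variables (i j : 'I_n) (V : {set 'I_n}) (k : nat) (w w' : R -> R) (C : R).
Hypothesis ij : i != j.
Hypothesis mw : measurable_fun setT w.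
Hypothesis mw' : measurable_fun setT w'.
Hypothesis dw : forall x : R, 0 <= x <= 1 -> is_derive x 1 w (w' x).
Hypothesis wC : forall x : R, 0 <= x <= 1 -> `|w x| <= C.
Hypothesis w'C : forall x : R, 0 <= x <= 1 -> `|w' x| <= C.

Local Notation X := (fun x => \sum_(l in V) s l x).

Let bX : bounded_mfun D X.
Proof. by apply: (@bounded_mfun_sum _ _ _ _ _ _ (mem V)) => l _; exact: (bounded_mfun_s inv). Qed.

Let mX : measurable_fun setT X. Proof. by case: bX. Qed.

Let bwX : bounded_mfun D (fun x => w (X x)).
Proof.
split; first exact: measurableT_comp.
by exists C => x Dx; apply: wC; exact: (s_sum_itv inv).
Qed.

Let bw'X : bounded_mfun D (fun x => w' (X x)).
Proof.
split; first exact: measurableT_comp.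
by exists C => x Dx; apply: w'C; exact: (s_sum_itv inv).
Qed.

Let bs l : bounded_mfun D (s l). Proof. exact: (bounded_mfun_s inv). Qed.

(** The derivative at time 0 of r (s i)^k w(X) along the flow. The truncated exponent [k.-1] is
    harmless at k = 0, where its coefficient vanishes. *)
Definition stein_term (r : S -> R) x :=
  (s i x - s j x) * s i x ^+ k * w (X x) +
  2 * r x ^+ 2 * (((j \in V)%:R - (i \in V)%:R) * s i x ^+ k * w' (X x) -
                  k%:R * s i x ^+ k.-1 * w (X x)).

Section one_flow.
Variable r : S -> R.
Hypothesis mr : measurable_fun setT r.
Hypothesis r2 : forall x, r x ^+ 2 <= s i x * s j x.
Hypothesis flow : forall t, exists phi : S -> S,
  [/\ measurable_fun setT phi,
      forall A, measurable A -> sigma (phi @^-1` A) = sigma A,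
      forall x, (s i (phi x), s j (phi x), r (phi x)) =
        trace_rot t (s i x) (s j x) (r x) &
      forall x l, l != i -> l != j -> s l (phi x) = s l x].

Let a t x := (trace_rot t (s i x) (s j x) (r x)).1.1.
Let b t x := (trace_rot t (s i x) (s j x) (r x)).1.2.
Let q t x := (trace_rot t (s i x) (s j x) (r x)).2.
Let rest x := \sum_(l in V | (l != i) && (l != j)) s l x.
Let Xt t x := rest x + (i \in V)%:R * a t x + (j \in V)%:R * b t x.

Let XE x : X x = rest x + (i \in V)%:R * s i x + (j \in V)%:R * s j x.
Proof.
rewrite /rest (bigID (fun l => (l != i) && (l != j)))/= -addrA; congr (_ + _).
rewrite (bigID (pred1 i))/=; congr (_ + _).
  have [iV|iV] := boolP (i \in V).
    rewrite (big_pred1 i) ?mul1r// => l /=.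
    by have [->|//] := eqVneq l i; rewrite ?iV ?eqxx// andbF.
  rewrite mul0r big1// => l /andP[/andP[lV _] /eqP li].
  by rewrite -li lV in iV.
have [jV|jV] := boolP (j \in V).
  rewrite (big_pred1 j) ?mul1r// => l /=.
  have [->|li] := eqVneq l i; rewrite ?andbF//=.
    by rewrite (negbTE ij).
  by have [->|_] := eqVneq l j; rewrite ?jV// andbF.
rewrite mul0r big1// => l /andP[/andP[lV]].
by have [->|li] := eqVneq l i; rewrite //= negbK => /eqP lj; rewrite -lj lV in jV.
Qed.

Let sumE x : \sum_l s l x =
  \sum_(l | (l != i) && (l != j)) s l x + s i x + s j x.
Proof.
rewrite (bigD1 i)//= (bigD1 j)/=; last by rewrite eq_sym.
by rewrite addrA addrC addrA.
Qed.

Let flowP t : exists phi : S -> S,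
  [/\ measurable_fun setT phi,
      forall A, measurable A -> sigma (phi @^-1` A) = sigma A,
      forall x, [/\ s i (phi x) = a t x, s j (phi x) = b t x,
        r (phi x) = q t x & X (phi x) = Xt t x] &
      forall x, D (phi x) <-> D x].
Proof.
have [phi [mphi pphi e1 e2]] := flow t; exists phi; split=> // x.
- case: (e1 x) => ea eb eq.
  split => //; rewrite XE /Xt /a /b /= ea eb; congr (_ + _ + _).
  by apply: eq_bigr => l /andP[_ /andP[li lj]]; rewrite e2.
- case: (e1 x) => ea eb eq.
  rewrite /simplex_dom/= !sumE ea eb.
  under eq_bigr => l /andP[li lj] do rewrite e2//.
  rewrite (_ : _ + _ + _ = \sum_(l < n | (l != i) && (l != j)) s l x +
     (cos t ^+ 2 + sin t ^+ 2) * (s i x + s j x)); last by ring.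
  by rewrite cos2Dsin2 mul1r addrA.
Qed.

Let F x := r x * s i x ^+ k * w (X x).
Let f t x := q t x * a t x ^+ k * w (Xt t x).
Let f' t x := (a t x - b t x) * a t x ^+ k * w (Xt t x) +
  2 * q t x ^+ 2 * (((j \in V)%:R - (i \in V)%:R) * a t x ^+ k * w' (Xt t x) -
                  k%:R * a t x ^+ k.-1 * w (Xt t x)).

Let fF t x phi : [/\ s i (phi x) = a t x, s j (phi x) = b t x,
        r (phi x) = q t x & X (phi x) = Xt t x] -> f t x = F (phi x).
Proof. by case=> ea eb er eX; rewrite /F /f eX ea er. Qed.

Let r_le1 x : D x -> `|r x| <= 1.
Proof.
move=> Dx; rewrite -(@expr_le1 _ 2)// real_normK ?num_real//.
by rewrite (le_trans (r2 x))// mulr_ile1 ?(s_le1 inv).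
Qed.

Let br : bounded_mfun D r.
Proof. by split=> //; exists 1 => x; exact: r_le1. Qed.

Let bF : bounded_mfun D F.
Proof. by do !apply: bounded_mfunM => //; exact: bounded_mfunX. Qed.

Let itvt t x : D x -> [/\ 0 <= a t x <= 1, 0 <= b t x <= 1, `|q t x| <= 1
   & 0 <= Xt t x <= 1].
Proof.
have [phi [_ _ /(_ x)[<- <- <- <-] Dphi]] := flowP t.
move=> /Dphi Dx; rewrite !s_ge0 !(s_le1 inv)// r_le1//.
by rewrite (s_sum_itv inv).
Qed.

Let Ef t : E (f t) = E F.
Proof.
have [phi [mphi pphi e Dphi]] := flowP t.
rewrite -(expect_phi inv mphi pphi Dphi bF); apply: expect_eq => x _.
exact: fF.
Qed.

Let is_derive_f (t : R) x : D x -> is_derive t 1 (f ^~ x) (f' t x).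
Proof.
move=> Dx; have [da db dq] := is_derive_trace_rot (s i x) (s j x) (r x) t.
have [_ _ _ X01] := itvt t Dx.
have dX : is_derive t 1 (Xt ^~ x) (2 * ((j \in V)%:R - (i \in V)%:R) * q t x).
  rewrite /Xt; apply: is_derive_eq; rewrite /GRing.scale /q /=; ring.
have dwX : is_derive t 1 (fun t => w (Xt t x))
    ((2 * ((j \in V)%:R - (i \in V)%:R) * q t x) * w' (Xt t x)).
  have dwt := dw X01.
  by rewrite mulrC; exact: (@is_derive1_comp _ w (Xt ^~ x)).
have dak : is_derive t 1 (fun t => a t x ^+ k)
    (k%:R * a t x ^+ k.-1 * (- 2 * q t x)).
  have da' : is_derive t 1 (a ^~ x) (- 2 * q t x) by [].
  by have := is_deriveX k da'; rewrite exprfctE.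
have dq' : is_derive t 1 (q ^~ x) (a t x - b t x) by [].
have := is_deriveM (is_deriveM dq' dak) dwX; rewrite !mulrfctE => /is_derive_eq.
apply; rewrite /GRing.scale /f' /=.
move: (a t x ^+ k) (a t x ^+ k.-1) (a t x) (b t x) (q t x) (w _) (w' _) => ak ak' A B Q W W'.
ring.
Qed.

(** The flow preserves both [sigma] and [D], so the mean of r (s i)^k w(X) is constant in time and
    its derivative at 0 vanishes. A single r only satisfies r^2 <= s i * s j; this is enough for
    domination, and the equality is recovered after summing over the r. *)
Lemma stein_one : E (stein_term r) = 0.
Proof.
have f'0 x : f' 0 x = stein_term r x.
  rewrite /f' /stein_term /Xt XE /a /b /q /= cos0 sin0.
  by rewrite !(expr0n, expr1n) /= !(mul0r, mulr0, mul1r, addr0, subr0, add0r).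
have bf t : bounded_mfun D (f t).
  have [phi [mphi pphi e Dphi]] := flowP t.
  rewrite (_ : f t = F \o phi); last by apply/funext => x; rewrite (fF (e x)).
  have [mF [K FK]] := bF; split; first exact: measurableT_comp.
  by exists K => x Dx; apply: FK; apply/Dphi.
have dE : is_derive (0 : R) 1 (fun t => E (f t)) (E (f' 0)).
  (* Any open interval around 0 would do, as the domination is uniform in time. *)
  apply: (@is_derive_expect _ _ _ sigma D mD f f' (-1) 1 0 (C + 2 * (C + k%:R * C))).
  - by rewrite ltrN10 ltr01.
  - by move=> t _; exact: bf.
  - by move=> t x _ Dx; exact: is_derive_f.
  - move=> t x _ Dx.
    have [/andP[a0 a1] /andP[b0 b1] q1 X01] := itvt t Dx.
    have ak m : `|a t x ^+ m| <= 1 by rewrite normrX exprn_ile1// ger0_norm.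
    apply: stein_term_bound; rewrite ?a0 ?b0 //; [|exact: wC|exact: w'C].
    by case: (j \in V); case: (i \in V);
      rewrite /= ?subrr ?subr0 ?sub0r ?normrN ?normr0 ?normr1.
transitivity (E (f' 0)); first by apply: expect_eq => x Dx; rewrite f'0.
have Ecst : (fun t => E (f t)) = cst (E F) by apply/funext => t; exact: Ef.
by case: dE => _ <-; rewrite Ecst derive_cst.
Qed.

End one_flow.

(* Integration by parts for the Dirichlet law: the mean of
   r (s i)^k w(X) does not change along the rotation flow, so the mean of its
   derivative at time 0 vanishes; then sum over the r. *)
Lemma stein :
  E (fun x => beta%:R * (s i x - s j x) * s i x ^+ k * w (X x) +
     2 * (s i x * s j x) *
       (((j \in V)%:R - (i \in V)%:R) * s i x ^+ k * w' (X x) -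
        k%:R * s i x ^+ k.-1 * w (X x))) = 0.
Proof.
have [_ _ _ /(_ i j ij)[r [mr r2 flow]]] := inv.
have r2b b x : r b x ^+ 2 <= s i x * s j x.
  by rewrite -r2 (bigD1 b)//= lerDl sumr_ge0// => c _; exact: sqr_ge0.
have br b : bounded_mfun D (r b).
  split=> //; exists 1 => x Dx; rewrite -(@expr_le1 _ 2)// real_normK ?num_real//.
  by rewrite (le_trans (r2b b x))// mulr_ile1 ?(s_le1 inv).
transitivity (E (fun x => \sum_b stein_term (r b) x)).
  apply: expect_eq => x _.
  (* The first term does not involve r and is counted [beta] times; the second involves r only
     through r^2, and these squares sum to s i * s j. *)
  rewrite big_split/= sumr_const card_ord -!mulr_suml -mulr_sumr r2; congr (_ + _).
  by rewrite -[RHS]mulr_natl !mulrA.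
have bst b : bounded_mfun D (stein_term (r b)).
  have bsk m l : bounded_mfun D (fun x => s l x ^+ m) by exact: bounded_mfunX.
  have bc c : bounded_mfun D (fun=> c) by exact: bounded_mfun_cst.
  apply: bounded_mfunD; first by do !apply: bounded_mfunM => //; exact: bounded_mfunB.
  apply: bounded_mfunM; first by apply: bounded_mfunM => //; exact: bounded_mfunX.
  by apply: bounded_mfunB; do !apply: bounded_mfunM.
rewrite expect_sum//.
by rewrite big1// => b _; exact: stein_one.
Qed.

End stein.

(** * Law of the mass of a block, and moments of one coordinate *)

Section block_moments.
Context {R : realType} d {S : measurableType d} (sigma : probability S R).
Variables (n beta : nat) (s : 'I_n -> S -> R).
Hypothesis inv : rot_invariant sigma beta s.
Variables (V : {set 'I_n}) (w w' : R -> R) (C : R).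
Hypothesis mw : measurable_fun setT w.
Hypothesis mw' : measurable_fun setT w'.
Hypothesis dw : forall x : R, 0 <= x <= 1 -> is_derive x 1 w (w' x).
Hypothesis wC : forall x : R, 0 <= x <= 1 -> `|w x| <= C.
Hypothesis w'C : forall x : R, 0 <= x <= 1 -> `|w' x| <= C.

Local Notation D := (simplex_dom s).
Local Notation E f := (\int[sigma]_(x in D) f x)%R.
Local Notation X := (fun x => \sum_(l in V) s l x).

Let mD : measurable D. Proof. exact: (measurable_simplex_dom inv). Qed.
Let s_ge0 i x : 0 <= s i x. Proof. by case: inv. Qed.
Let bs l : bounded_mfun D (s l). Proof. exact: (bounded_mfun_s inv). Qed.
Let bc (c : R) : bounded_mfun D (fun=> c). Proof. exact: bounded_mfun_cst. Qed.

Lemma bounded_mfun_block : bounded_mfun D X.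
Proof. by apply: (@bounded_mfun_sum _ _ _ _ _ _ (mem V)) => l _. Qed.

Lemma bounded_mfun_comp_block (h : R -> R) (K : R) : measurable_fun setT h ->
  (forall x, 0 <= x <= 1 -> `|h x| <= K) -> bounded_mfun D (h \o X).
Proof.
move=> mh hK; split; last by exists K => x Dx; apply: hK; exact: (s_sum_itv inv).
by apply: measurableT_comp => //; case: bounded_mfun_block.
Qed.

Let bw : bounded_mfun D (fun x => w (X x)).
Proof. exact: (bounded_mfun_comp_block mw wC). Qed.
Let bw' : bounded_mfun D (fun x => w' (X x)).
Proof. exact: (bounded_mfun_comp_block mw' w'C). Qed.

Lemma sum_block_compl x : D x -> \sum_(i in ~: V) s i x = 1 - X x.
Proof.
move=> <-; rewrite [in RHS](bigID (mem V))/= addrC addrK.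
by apply: eq_bigl => i; rewrite inE.
Qed.

(** This is the Stein identity of the Beta law with parameters beta |V| / 2 and beta |~: V| / 2. It
    is the sum of [stein] with k = 0 over i outside V and j in V, after which everything depends on
    X alone. *)
Lemma stein_block :
  E (fun x => beta%:R * (#|V|%:R * (1 - X x) - #|~: V|%:R * X x) * w (X x) +
              2 * (X x * (1 - X x)) * w' (X x)) = 0.
Proof.
pose F i j x : R := beta%:R * (s i x - s j x) * w (X x) +
  2 * (s i x * s j x) * w' (X x).
have bF i j : bounded_mfun D (F i j).
  apply: bounded_mfunD; apply: bounded_mfunM => //; apply: bounded_mfunM => //.
    exact: bounded_mfunB.
  exact: bounded_mfunM.
transitivity (E (fun x => \sum_(i in ~: V) \sum_(j in V) F i j x)).
  apply: expect_eq => x Dx.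
  have inner i : \sum_(j in V) F i j x =
      s i x * (beta%:R * #|V|%:R * w (X x) + 2 * X x * w' (X x)) -
      beta%:R * X x * w (X x).
    have FE j : F i j x = beta%:R * s i x * w (X x) +
        (2 * s i x * w' (X x) - beta%:R * w (X x)) * s j x by rewrite /F; ring.
    rewrite (eq_bigr _ (fun j _ => FE j)) big_split/= sumr_const -mulr_sumr.
    by rewrite -[_ *+ #|_|]mulr_natr; ring.
  rewrite (eq_bigr _ (fun i _ => inner i)).
  rewrite sumrB -mulr_suml sum_block_compl// sumr_const -[_ *+ #|_|]mulr_natr.
  by ring.
rewrite expect_sum//; last by move=> i _; apply: bounded_mfun_sum.
rewrite big1// => i; rewrite inE => iV; rewrite expect_sum// big1// => j jV.
have ij : i != j by apply: contraNneq iV => ->.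
rewrite -[RHS](stein inv V 0 ij mw mw' dw wC w'C); apply: expect_eq => x Dx.
by rewrite /F jV (negbTE iV) /= expr0; ring.
Qed.

(** Rotating i with some j on the same side of V leaves X unchanged, so [w'] drops out of [stein]
    and beta E[s_i^(k+1) w] = (beta + 2k) E[s_j s_i^k w]. Summing over the j in W other than i, the
    total of the s_j is at most 1. *)
Lemma block_moment_step (W : {set 'I_n}) (i : 'I_n) (k : nat) :
  (forall x, 0 <= x <= 1 -> 0 <= w x) ->
  i \in W -> (forall j, j \in W -> (j \in V) = (i \in V)) ->
  beta%:R * #|W :\ i|%:R * E (fun x => s i x ^+ k.+1 * w (X x)) <=
    (beta + k.*2)%:R * E (fun x => s i x ^+ k * w (X x)).
Proof.
move=> w0 iW WV.
have bk m : bounded_mfun D (fun x => s i x ^+ m * w (X x)).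
  by apply: bounded_mfunM => //; exact: bounded_mfunX.
pose G (j : 'I_n) x : R := (beta + k.*2)%:R * (s j x * (s i x ^+ k * w (X x))).
have bG j : bounded_mfun D (G j).
  by apply: bounded_mfunM => //; exact: bounded_mfunM.
have step j : j \in W :\ i ->
    beta%:R * E (fun x => s i x ^+ k.+1 * w (X x)) = E (G j).
  rewrite !inE => /andP[ji jW]; apply/eqP.
  rewrite -subr_eq0 -expectZ// -expectB//; last exact: bounded_mfunM.
  rewrite eq_sym in ji.
  apply/eqP; rewrite -[RHS](stein inv V k ji mw mw' dw wC w'C).
  apply: expect_eq => x Dx.
  rewrite /G WV// subrr !mul0r sub0r natrD -muln2 natrM.
  case: k {bk G bG} => [|m]; first by rewrite expr0 expr1; ring.
  by rewrite /= !exprS; ring.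
rewrite mulrAC [leLHS]mulr_natr -sumr_const (eq_bigr _ step).
rewrite -expect_sum// -expectZ//.
apply: expect_le => //; first exact: bounded_mfun_sum.
  exact: bounded_mfunM.
move=> x Dx; rewrite -mulr_sumr ler_wpM2l// -mulr_suml.
rewrite -[leRHS]mul1r ler_wpM2r ?(s_sum_le1 inv)//.
by rewrite mulr_ge0 ?exprn_ge0// w0// (s_sum_itv inv).
Qed.

(** Four moment steps; the constant 8 bounds beta + 2k for beta <= 2 and k <= 3. *)
Lemma block_fourth_moment (W : {set 'I_n}) (i : 'I_n) :
  (beta <= 2)%N ->
  (forall x, 0 <= x <= 1 -> 0 <= w x) ->
  i \in W -> (forall j, j \in W -> (j \in V) = (i \in V)) ->
  (beta%:R * #|W :\ i|%:R) ^+ 4 * E (fun x => s i x ^+ 4 * w (X x)) <=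
    8 ^+ 4 * E (fun x => w (X x)).
Proof.
move=> b2 w0 iW WV.
have step k : (k < 4)%N ->
    beta%:R * #|W :\ i|%:R * E (fun x => s i x ^+ k.+1 * w (X x)) <=
      8 * E (fun x => s i x ^+ k * w (X x)).
  move=> k4; apply: le_trans (block_moment_step k w0 iW WV) _.
  apply: ler_wpM2r; last first.
    rewrite ler_nat -muln2.
    by apply: (leq_trans (leq_add b2 (leq_mul (_ : k <= 3)%N (leqnn 2)))).
  apply: Rintegral_ge0 => x Dx; rewrite mulr_ge0 ?exprn_ge0// w0//.
  exact: (s_sum_itv inv).
have bn0 : 0 <= beta%:R * #|W :\ i|%:R :> R by rewrite mulr_ge0.
have iter k : (k <= 4)%N ->
    (beta%:R * #|W :\ i|%:R) ^+ k * E (fun x => s i x ^+ k * w (X x)) <=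
      8 ^+ k * E (fun x => w (X x)).
  elim: k => [_|k ih k4].
    by rewrite !expr0 !mul1r; under eq_Rintegral do rewrite expr0 mul1r.
  rewrite exprSr -mulrA; apply: (@le_trans _ _
    ((beta%:R * #|W :\ i|%:R) ^+ k * (8 * E (fun x => s i x ^+ k * w (X x))))).
    by rewrite ler_wpM2l ?exprn_ge0// step.
  by rewrite mulrCA [8 ^+ _]exprS -mulrA ler_wpM2l// ih// ltnW.
exact: iter.
Qed.

End block_moments.

(** * The tilting weight and its derivatives *)

Section weight.
Context {R : realType}.

(* Up to a constant, with p = beta n / 2, the density w.r.t. the uniform law of the
   direction of a Gaussian vector whose two blocks have variances in the ratio
   1 + r; this tilt moves the concentration point of X. *)
Definition weight (p r x : R) : R := expR (- p * ln (1 + r * x)).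

Lemma weight_gt0 p r x : 0 < weight p r x. Proof. exact: expR_gt0. Qed.

Lemma weight_ge0 p r x : 0 <= weight p r x. Proof. exact: expR_ge0. Qed.

Lemma weight0 p x : weight p 0 x = 1.
Proof. by rewrite /weight mul0r addr0 ln1 mulr0 expR0. Qed.

Lemma measurable_weight p r : measurable_fun setT (weight p r).
Proof.
apply: measurableT_comp => //; apply: measurable_funM => //.
apply: measurableT_comp; first exact: measurable_ln.
by apply: measurable_funD => //; exact: measurable_funM.
Qed.

(** Only r >= 0 occurs in the end, but derivatives in r are taken at r = 0 too, so an open range
    around 0 on which 1 + r x stays away from 0 is needed. *)
Lemma affine_ge_half (r x : R) : - 2^-1 < r -> 0 <= x <= 1 -> 2^-1 <= 1 + r * x.
Proof. by move=> r2 /andP[x0 x1]; nra. Qed.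

Lemma inv_affine_le2 (r x : R) :
  - 2^-1 < r -> 0 <= x <= 1 -> 0 < (1 + r * x)^-1 <= 2.
Proof.
move=> r2 x01; have S2 := affine_ge_half r2 x01.
have S0 : 0 < 1 + r * x by apply: lt_le_trans S2; rewrite invr_gt0.
by rewrite invr_gt0 S0 -[leRHS]invrK lef_pV2 ?posrE ?invr_gt0.
Qed.

(** Lets the inverse of 1 + r x be treated as a weight, so that its measurability and its bound on
    [0, 1] come from those of weights. *)
Lemma weight1E r x : 0 < 1 + r * x -> weight 1 r x = (1 + r * x)^-1.
Proof. by move=> S0; rewrite /weight mulN1r expRN lnK. Qed.

Lemma weight_le p r x : 0 <= p -> - 2^-1 < r -> 0 <= x <= 1 ->
  `|weight p r x| <= expR (p * ln 2).
Proof.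
move=> p0 r2 x01; rewrite gtr0_norm ?weight_gt0// ler_expR.
have /andP[S0 S2] := inv_affine_le2 r2 x01.
have lnS : - ln (1 + r * x) <= ln 2.
  by rewrite -lnV ?posrE -1?invr_gt0// ler_ln ?posrE.
by rewrite mulNr -mulrN ler_wpM2l.
Qed.

Lemma is_derive_weight_x (p r x : R) : 0 < 1 + r * x ->
  is_derive x 1 (weight p r) (- (p * r) / (1 + r * x) * weight p r x).
Proof.
move=> S0; have dln := is_derive1_ln S0.
have dS : is_derive x 1 (fun x : R => 1 + r * x) r.
  by apply: is_derive_eq; rewrite /GRing.scale/=; ring.
have dl : is_derive x 1 (fun x : R => - p * ln (1 + r * x)) (- p * ((1 + r * x)^-1 * r)).
  by apply: is_derive_eq.
have := @is_derive1_comp _ expR (fun x => - p * ln (1 + r * x)) x _ _ (is_derive_expR _) dl.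
by rewrite /weight => /is_derive_eq; apply; ring.
Qed.

Lemma is_derive_weight_r (p r x : R) : 0 < 1 + r * x ->
  is_derive r 1 (fun r => weight p r x) (- (p * x) / (1 + r * x) * weight p r x).
Proof.
have wC q : weight p q x = weight p x q by rewrite /weight (mulrC q).
have -> : (weight p)^~ x = weight p x by apply/funext => q; exact: wC.
by rewrite wC mulrC => S0; exact: is_derive_weight_x.
Qed.

End weight.

(** * Mass and concentration of the tilted law *)

Section weighted_block.
Context {R : realType} d {S : measurableType d} (sigma : probability S R).
Variables (n beta : nat) (s : 'I_n -> S -> R).
Hypothesis inv : rot_invariant sigma beta s.
Variable V : {set 'I_n}.

Local Notation D := (simplex_dom s).
Local Notation E f := (\int[sigma]_(x in D) f x)%R.
Local Notation X := (fun x => \sum_(l in V) s l x).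
Local Notation p := (beta%:R * n%:R / 2 : R).

Let mD : measurable D. Proof. exact: (measurable_simplex_dom inv). Qed.
Let bc (c : R) : bounded_mfun D (fun=> c). Proof. exact: bounded_mfun_cst. Qed.
Let p0 : 0 <= p. Proof. by rewrite divr_ge0 ?mulr_ge0. Qed.
Let X01 x : D x -> 0 <= X x <= 1. Proof. exact: (s_sum_itv inv). Qed.

Let cardV : #|V|%:R + #|~: V|%:R = n%:R :> R.
Proof. by rewrite -natrD cardsC card_ord. Qed.

Lemma bounded_mfun_weight (r : R) : - 2^-1 < r ->
  bounded_mfun D (fun x => weight p r (X x)).
Proof.
move=> r2; apply: (bounded_mfun_comp_block inv V (measurable_weight p r)).
by move=> x; exact: weight_le.
Qed.

(** [stein_block] for h times the weight. With p = beta n / 2 the logarithmic derivative of the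
    weight combines with the drift of the Beta law, so that X enters the term in h only through y =
    (1 + r) X / (1 + r X). *)
Lemma stein_weight (r : R) (h h' : R -> R) (K : R) : - 2^-1 < r ->
  measurable_fun setT h -> measurable_fun setT h' ->
  (forall x : R, 0 <= x <= 1 -> is_derive x 1 h (h' x)) ->
  (forall x : R, 0 <= x <= 1 -> `|h x| <= K) ->
  (forall x : R, 0 <= x <= 1 -> `|h' x| <= K) ->
  E (fun x => (beta%:R * (#|V|%:R - n%:R * ((1 + r) * (X x * weight 1 r (X x)))) *
      h (X x) + 2 * (X x * (1 - X x)) * h' (X x)) * weight p r (X x)) = 0.
Proof.
move=> r2 mh mh' dh hK h'K.
pose w x := h x * weight p r x.
pose w' x := h x * (- (p * r) * weight 1 r x * weight p r x) + h' x * weight p r x.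
have S0 (x : R) : 0 <= x <= 1 -> 0 < 1 + r * x.
  by move=> /(affine_ge_half r2); apply: lt_le_trans; rewrite invr_gt0.
have W0 x : 0 <= x <= 1 -> `|weight p r x| <= expR (p * ln 2) by exact: weight_le.
set B := expR (p * ln 2) in W0.
have K0 : 0 <= K by apply: le_trans (hK 0 _); rewrite ?normr_ge0 ?lexx ?ler01.
have B0 : 0 <= B by exact: expR_ge0.
have mw : measurable_fun setT w.
  by apply: measurable_funM => //; exact: measurable_weight.
have mw' : measurable_fun setT w'.
  apply: measurable_funD; apply: measurable_funM => //.
    apply: measurable_funM; last exact: measurable_weight.
    by apply: measurable_funM => //; exact: measurable_weight.
  exact: measurable_weight.
have dw (x : R) : 0 <= x <= 1 -> is_derive x 1 w (w' x).
  move=> x01; have dhx := dh _ x01; have dwx := is_derive_weight_x p (S0 _ x01).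
  have := is_deriveM dhx dwx; rewrite mulrfctE => /is_derive_eq; apply.
  by rewrite /GRing.scale /w' /= (weight1E (S0 _ x01)) [h' x * _]mulrC.
have T0 : 0 <= p * `|r| * 2 by rewrite !mulr_ge0.
have wC (x : R) : 0 <= x <= 1 -> `|w x| <= K * B * (p * `|r| * 2 + 1).
  move=> x01; rewrite /w normrM.
  apply: (@le_trans _ _ (K * B)); first by rewrite ler_pM ?hK ?W0.
  by rewrite ler_peMr ?mulr_ge0// lerDr.
have w'C (x : R) : 0 <= x <= 1 -> `|w' x| <= K * B * (p * `|r| * 2 + 1).
  move=> x01; rewrite /w' mulrDr mulr1 (le_trans (ler_normD _ _))// lerD//.
    have /andP[i0 i2] := inv_affine_le2 r2 x01.
    have -> : K * B * (p * `|r| * 2) = K * (p * `|r| * 2 * B) by ring.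
    rewrite normrM; apply: ler_pM (hK _ x01) _ => //.
    rewrite normrM; apply: ler_pM _ (W0 _ x01) => //.
    rewrite (weight1E (S0 _ x01)) normrM normrN normrM (ger0_norm p0).
    by rewrite (gtr0_norm i0) ler_wpM2l ?mulr_ge0.
  by rewrite normrM ler_pM ?h'K ?W0.
rewrite -[RHS](stein_block inv V mw mw' dw wC w'C); apply: expect_eq => x Dx.
have := lt0r_neq0 (S0 _ (X01 Dx)); rewrite /w /w' (weight1E (S0 _ (X01 Dx))) -cardV.
move: (\sum_(l in V) _) => y S0y; field.
exact: S0y.
Qed.

(** The case h = 1. The left side is proportional to the derivative in r of the total tilted mass,
    so this is a differential equation for that mass. *)
Lemma expect_weight_ratio (r : R) : - 2^-1 < r -> (0 < beta)%N ->
  n%:R * E (fun x => X x * weight 1 r (X x) * weight p r (X x)) =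
  #|V|%:R / (1 + r) * E (fun x => weight p r (X x)).
Proof.
move=> r2 beta0.
have bw := bounded_mfun_weight r2.
have byw : bounded_mfun D (fun x => X x * weight 1 r (X x) * weight p r (X x)).
  apply: bounded_mfunM => //; apply: bounded_mfunM.
    exact: (bounded_mfun_block inv).
  apply: (bounded_mfun_comp_block inv V (measurable_weight 1 r)).
  by move=> x; exact: weight_le.
have r1 : 1 + r != 0 by apply: lt0r_neq0; lra.
have n1 (x : R) : 0 <= x <= 1 -> `|1 : R| <= 1 by rewrite normr1.
have n0 (x : R) : 0 <= x <= 1 -> `|0 : R| <= 1 by rewrite normr0 ler01.
have d1 (x : R) : 0 <= x <= 1 -> is_derive x 1 (fun=> 1 : R) (0 : R).
  by move=> _; exact: is_derive_cst.
have := @stein_weight r (fun=> 1) (fun=> 0) 1 r2 (measurable_cst _)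
  (measurable_cst _) d1 n1 n0.
rewrite (@expect_eq _ _ _ _ _ _ (fun x => (beta%:R * #|V|%:R) * weight p r (X x) -
   (beta%:R * (1 + r) * n%:R) * (X x * weight 1 r (X x) * weight p r (X x)))); last first.
  by move=> x Dx; ring.
rewrite expectB//; [|exact: bounded_mfunM|exact: bounded_mfunM].
rewrite !expectZ// => H.
have beta1 : beta%:R != 0 :> R by rewrite pnatr_eq0 -lt0n.
apply: (mulfI beta1); apply: (mulfI r1).
move/eqP: H; rewrite subr_eq0 => /eqP H.
rewrite mulrA (mulrA _ beta%:R) (mulrC (1 + r)) mulrA -H; field.
exact: r1.
Qed.

(** The mass g satisfies g' = - q / (1 + t) g with g(0) = 1; hence g(t) (1 + t)^q has zero
    derivative and equals 1. *)
Lemma expect_weight (r : R) : 0 <= r -> (0 < beta)%N -> (0 < n)%N ->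
  E (fun x => weight p r (X x)) =
  expR (- (beta%:R * #|V|%:R / 2) * ln (1 + r)).
Proof.
move=> r0 beta0 n0.
pose q : R := beta%:R * #|V|%:R / 2.
pose g t := E (fun x => weight p t (X x)).
have dg (t : R) : - 2^-1 < t -> is_derive t 1 g (- (q / (1 + t)) * g t).
  move=> t2.
  have -> : - (q / (1 + t)) * g t =
      E (fun x => - p * (X x * weight 1 t (X x) * weight p t (X x))).
    have bw := bounded_mfun_weight t2.
    rewrite expectZ//; last first.
      apply: bounded_mfunM => //; apply: bounded_mfunM.
        exact: (bounded_mfun_block inv).
      apply: (bounded_mfun_comp_block inv V (measurable_weight 1 t)).
      by move=> x; exact: weight_le.
    have ratio := expect_weight_ratio t2 beta0.
    have -> : forall Z, - p * Z = - (beta%:R / 2) * (n%:R * Z) by move=> Z; ring.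
    by rewrite ratio /q /g; ring.
  apply: (@is_derive_expect _ _ _ sigma D mD (fun t x => weight p t (X x))
    (fun t x => - p * (X x * weight 1 t (X x) * weight p t (X x)))
    (- 2^-1) (t + 1) t (p * (2 * expR (p * ln 2)))).
  - by rewrite t2/= ltrDl ltr01.
  - by move=> u /andP[u2 _]; exact: bounded_mfun_weight.
  - move=> u x /andP[u2 _] /X01 x01.
    have S0 : 0 < 1 + u * X x.
      by apply: lt_le_trans (affine_ge_half u2 x01); rewrite invr_gt0.
    have := is_derive_weight_r p S0 => /is_derive_eq; apply.
    by rewrite (weight1E S0); field; exact: lt0r_neq0.
  - move=> u x /andP[u2 _] /X01 x01.
    have S0 : 0 < 1 + u * X x.
      by apply: lt_le_trans (affine_ge_half u2 x01); rewrite invr_gt0.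
    have /andP[i0 i2] := inv_affine_le2 u2 x01.
    rewrite (weight1E S0) normrM normrN (ger0_norm p0) ler_wpM2l//.
    rewrite normrM; apply: ler_pM => //; last exact: weight_le.
    have /andP[X0 X1] := x01.
    rewrite normrM (ger0_norm X0) (gtr0_norm i0) -[leRHS]mul1r.
    by apply: ler_pM => //; exact: ltW.
pose G t := g t * expR (q * ln (1 + t)).
have dG (t : R) : - 2^-1 < t -> is_derive t 1 G 0.
  move=> t2; have dgt := dg t t2.
  have t1 : 0 < 1 + t by lra.
  have de : is_derive t 1 (fun t : R => expR (q * ln (1 + t)))
     (q / (1 + t) * expR (q * ln (1 + t))).
    have dln := is_derive1_ln t1.
    have d1 : is_derive t 1 (fun t : R => 1 + t) 1.
      by apply: is_derive_eq; rewrite /GRing.scale/=; ring.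
    have dl : is_derive t 1 (fun t : R => q * ln (1 + t)) (q / (1 + t)).
      by apply: is_derive_eq; rewrite /GRing.scale/= mulr1.
    have := @is_derive1_comp _ expR (fun t => q * ln (1 + t)) t _ _
      (is_derive_expR _) dl.
    by move=> /is_derive_eq; apply; rewrite mulrC.
  have := is_deriveM dgt de; rewrite mulrfctE => /is_derive_eq; apply.
  by rewrite /GRing.scale/=; ring.
have G0 : G 0 = 1.
  rewrite /G addr0 ln1 mulr0 expR0 mulr1 /g.
  under eq_Rintegral do rewrite weight0.
  rewrite Rintegral_cst// mul1r.
  exact: (congr1 fine (simplex_dom_full inv)).
have : G r = 1.
  have [->//|rn0] := eqVneq r 0.
  have rp : 0 < r by rewrite lt_neqAle eq_sym rn0.
  have dG' (t : R) : t \in `]0, r[ -> is_derive t 1 G 0.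
    by rewrite in_itv/= => /andP[t0 _]; apply: dG; lra.
  have cG : {within `[0, r], continuous G}.
    apply: derivable_within_continuous => t; rewrite in_itv/= => /andP[t0 _].
    have t2 : - 2^-1 < t by lra.
    by case: (dG t t2).
  have [c _] := MVT rp dG' cG.
  by rewrite mul0r => /eqP; rewrite subr_eq0 G0 => /eqP.
rewrite /G => Gr; rewrite mulNr expRN -[LHS]/(g r).
have q0 : expR (q * ln (1 + r)) != 0 by rewrite lt0r_neq0// expR_gt0.
by apply: (mulIf q0); rewrite Gr mulVf.
Qed.

(** Taking h = m - y in [stein_weight], with m = |V| / n and y = (1 + r) X / (1 + r X), expresses
    the tilted variance of y by a mean of order 1 / n. The map from y back to X is Lipschitz with
    constant 1 + r on [0, 1], and (y - y0)^2 <= 2 (m - y)^2 + 2 (m - y0)^2. *)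
Lemma block_concentration (r x0 : R) : 0 <= r -> (0 < beta)%N -> (0 < n)%N ->
  0 <= x0 <= 1 ->
  E (fun x => (X x - x0) ^+ 2 * weight p r (X x)) <=
  2 * (1 + r) ^+ 2 *
  (2 * (1 + r) / n%:R + (#|V|%:R / n%:R - (1 + r) * x0 / (1 + r * x0)) ^+ 2) *
  E (fun x => weight p r (X x)).
Proof.
move=> r0 beta0 n0 x001.
have r2 : - 2^-1 < r by lra.
have n1 : 0 < n%:R :> R by rewrite ltr0n.
pose m : R := #|V|%:R / n%:R.
pose h x : R := m - (1 + r) * (x * weight 1 r x).
pose h' x : R := - (1 + r) * weight 1 r x ^+ 2.
have S1 (x : R) : 0 <= x <= 1 -> 1 <= 1 + r * x.
  by move=> /andP[x_ge0 _]; rewrite lerDl mulr_ge0.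
have w1 (x : R) : 0 <= x <= 1 -> 0 <= weight 1 r x <= 1.
  move=> x01; rewrite weight_ge0/= weight1E ?(lt_le_trans ltr01 (S1 _ x01))//.
  by rewrite invf_le1 ?S1// (lt_le_trans ltr01 (S1 _ x01)).
have m0 : 0 <= m by rewrite divr_ge0.
have mh : measurable_fun setT h.
  apply: measurable_funB => //; apply: measurable_funM => //.
  by apply: measurable_funM => //; exact: measurable_weight.
have mh' : measurable_fun setT h'.
  apply: measurable_funM => //; apply: measurable_funX; exact: measurable_weight.
have dh (x : R) : 0 <= x <= 1 -> is_derive x 1 h (h' x).
  move=> x01; have S0 := lt_le_trans ltr01 (S1 _ x01).
  have dw1 := is_derive_weight_x 1 S0.
  have := is_deriveM (is_derive_id x 1) dw1; rewrite mulrfctE => dxw.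
  have dm : is_derive x 1 (fun x => (1 + r) * (x * weight 1 r x))
    ((1 + r) * (weight 1 r x ^+ 2)).
    apply: is_derive_eq.
    rewrite /GRing.scale/= !(weight1E S0); field; exact: lt0r_neq0.
  have := is_deriveB (is_derive_cst m x 1) dm => /is_derive_eq; apply.
  by rewrite /h' sub0r mulNr.
have hK (x : R) : 0 <= x <= 1 -> `|h x| <= m + (1 + r).
  move=> x01; have /andP[w10 w11] := w1 _ x01; have /andP[x_ge0 x1] := x01.
  rewrite /h (le_trans (ler_normB _ _))// (ger0_norm m0) lerD2l.
  rewrite ger0_norm ?mulr_ge0 ?addr_ge0//.
  by rewrite ler_piMr ?addr_ge0// -[leRHS]mul1r ler_pM.
have h'K (x : R) : 0 <= x <= 1 -> `|h' x| <= m + (1 + r).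
  move=> x01; have /andP[w10 w11] := w1 _ x01.
  rewrite /h' mulNr normrN ger0_norm ?mulr_ge0 ?addr_ge0 ?exprn_ge0//.
  rewrite (@le_trans _ _ (1 + r)) ?lerDr//.
  by rewrite ler_piMr ?addr_ge0// exprn_ile1.
have bw := bounded_mfun_weight r2.
have bh : bounded_mfun D (fun x => h (X x)) := bounded_mfun_comp_block inv V mh hK.
have bX : bounded_mfun D X := bounded_mfun_block inv V.
have b1 : bounded_mfun D (fun x => weight 1 r (X x)).
  apply: (bounded_mfun_comp_block inv V (measurable_weight 1 r)) => x; exact: weight_le.
have := stein_weight r2 mh mh' dh hK h'K.
rewrite (@expect_eq _ _ _ _ _ _ (fun x => (beta%:R * n%:R) * (h (X x) ^+ 2 * weight p r (X x)) -
   (2 * (1 + r)) * ((X x * (1 - X x)) * weight 1 r (X x) ^+ 2 * weight p r (X x)))); last first.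
  move=> x Dx; rewrite /h' /h /m; field; exact: lt0r_neq0.
have bh2 : bounded_mfun D (fun x => h (X x) ^+ 2 * weight p r (X x)).
  by apply: bounded_mfunM => //; exact: bounded_mfunX.
have bq : bounded_mfun D (fun x => (X x * (1 - X x)) * weight 1 r (X x) ^+ 2 *
    weight p r (X x)).
  apply: bounded_mfunM => //; apply: bounded_mfunM; last exact: bounded_mfunX.
  by apply: bounded_mfunM => //; exact: bounded_mfunB.
rewrite expectB//; [|exact: bounded_mfunM|exact: bounded_mfunM].
rewrite !expectZ// => /eqP; rewrite subr_eq0 => /eqP Eh2.
have Eq : E (fun x => (X x * (1 - X x)) * weight 1 r (X x) ^+ 2 *
    weight p r (X x)) <= E (fun x => weight p r (X x)).
  apply: expect_le => // x /X01 x01.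
  rewrite -[leRHS]mul1r ler_wpM2r ?weight_ge0//.
  have /andP[w10 w11] := w1 _ x01; have /andP[x_ge0 x1] := x01.
  apply: mulr_ile1; rewrite ?mulr_ge0 ?subr_ge0 ?exprn_ge0 ?exprn_ile1//.
  by apply: mulr_ile1; rewrite ?subr_ge0// lerBlDr lerDl.
have {}Eh2 : E (fun x => h (X x) ^+ 2 * weight p r (X x)) <=
    2 * (1 + r) / n%:R * E (fun x => weight p r (X x)).
  rewrite [leRHS]mulrAC ler_pdivlMr// [leLHS]mulrC.
  apply: (@le_trans _ _ (2 * (1 + r) * E (fun x => (X x * (1 - X x)) *
      weight 1 r (X x) ^+ 2 * weight p r (X x)))); last first.
    by rewrite ler_wpM2l// mulr_ge0// addr_ge0.
  (* The factor beta >= 1 is dropped. *)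
  rewrite -Eh2 -[leRHS]mulrA ler_peMl ?ler1n// mulr_ge0//.
  by apply: Rintegral_ge0 => x _; rewrite mulr_ge0 ?sqr_ge0 ?weight_ge0.
pose y0 := (1 + r) * x0 / (1 + r * x0).
apply: (@le_trans _ _ (E (fun x => 2 * (1 + r) ^+ 2 * (h (X x) ^+ 2 * weight p r (X x)) +
   2 * (1 + r) ^+ 2 * (m - y0) ^+ 2 * weight p r (X x)))).
  apply: expect_le => //.
  - by apply: bounded_mfunM => //; apply: bounded_mfunX; exact: bounded_mfunB.
  - by apply: bounded_mfunD; exact: bounded_mfunM.
  move=> x /X01 x01.
  rewrite mulrA -mulrDl ler_wpM2r ?weight_ge0//.
  have SX := lt_le_trans ltr01 (S1 _ x01).
  have S0 := lt_le_trans ltr01 (S1 _ x001).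
  move: (X x) x01 SX => z z01 Sz; rewrite /h (weight1E Sz).
  set y := (1 + r) * (z / (1 + r * z)).
  (* A difference of two values of a homography factors exactly; the last factor is at most (1 + r)
     * 1. *)
  have zy : z - x0 = (y - y0) * ((1 + r * z) * ((1 + r * x0) / (1 + r))).
    rewrite /y /y0; field.
    by rewrite (lt0r_neq0 Sz) (lt0r_neq0 S0) lt0r_neq0// ltr_wpDr.
  rewrite zy exprMn.
  apply: (@le_trans _ _ ((y - y0) ^+ 2 * (1 + r) ^+ 2)).
    rewrite ler_wpM2l ?sqr_ge0// ler_sqr ?nnegrE ?addr_ge0//; last first.
      by apply: mulr_ge0; [exact: ltW|rewrite divr_ge0 ?(ltW S0) ?addr_ge0].
    have /andP[z0 z1] := z01; have /andP[x00 x01] := x001.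
    rewrite -[leRHS]mulr1; apply: ler_pM; first exact: ltW.
    - by rewrite divr_ge0 ?(ltW S0) ?addr_ge0.
    - by rewrite lerD2l ler_piMr.
    - by rewrite ler_pdivrMr ?ltr_wpDr// mul1r lerD2l ler_piMr.
  rewrite [leRHS](_ : _ = (2 * ((m - y) ^+ 2 + (m - y0) ^+ 2)) * (1 + r) ^+ 2);
    last by ring.
  rewrite ler_wpM2r ?sqr_ge0//.
  have : 0 <= (m - y + (m - y0)) ^+ 2 by exact: sqr_ge0.
  by nra.
rewrite expectD//; [|exact: bounded_mfunM|exact: bounded_mfunM].
rewrite !expectZ// [leRHS]mulrAC [leRHS]mulrDr.
have -> (Z : R) : 2 * (1 + r) ^+ 2 * (m - y0) ^+ 2 * Z =
  2 * (1 + r) ^+ 2 * Z * (m - y0) ^+ 2 by ring.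
rewrite lerD2r -[leRHS]mulrA; apply: ler_wpM2l; first by rewrite mulr_ge0 ?sqr_ge0.
by rewrite [leRHS]mulrC.
Qed.

End weighted_block.

(** * Upper and lower bounds at fixed dimension *)

Section exponential_bounds.
Context {R : realType} d {S : measurableType d} (sigma : probability S R).
Variables (n beta : nat) (s : 'I_n -> S -> R).
Hypothesis inv : rot_invariant sigma beta s.
Hypothesis beta0 : (0 < beta)%N.
Hypothesis beta2 : (beta <= 2)%N.
Hypothesis n0 : (0 < n)%N.
Variable V : {set 'I_n}.
Variable r : R.
Hypothesis r0 : 0 <= r.

Local Notation D := (simplex_dom s).
Local Notation E f := (\int[sigma]_(x in D) f x)%R.
Local Notation X := (fun x => \sum_(l in V) s l x).
Local Notation p := (beta%:R * n%:R / 2 : R).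

Let mD : measurable D. Proof. exact: (measurable_simplex_dom inv). Qed.
Let bc (c : R) : bounded_mfun D (fun=> c). Proof. exact: bounded_mfun_cst. Qed.
Let X01 x : D x -> 0 <= X x <= 1. Proof. exact: (s_sum_itv inv). Qed.
Let s_ge0 i x : 0 <= s i x. Proof. by case: inv. Qed.
Let r2 : - 2^-1 < r. Proof. by apply: lt_le_trans r0; rewrite oppr_lt0 invr_gt0. Qed.
Let bw : bounded_mfun D (fun x => weight p r (X x)).
Proof. exact: (bounded_mfun_weight inv V r2). Qed.

Variables (K : S -> R) (b : R -> R).
Hypothesis bK : bounded_mfun D K.

(** Multiplying and dividing by the weight gives exp (n b) <= exp (n B) times the weight, whose mean
    is known exactly. *)
Lemma expect_upper (B : R) :
  (forall x, 0 <= x <= 1 -> b x + beta%:R / 2 * ln (1 + r * x) <= B) ->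
  (forall x, D x -> K x <= expR (n%:R * b (X x))) ->
  E K <= expR (n%:R * B - beta%:R * #|V|%:R / 2 * ln (1 + r)).
Proof.
move=> bB Kb; rewrite expRD -mulNr -(expect_weight inv) // -expectZ//.
apply: expect_le => //; first exact: bounded_mfunM.
move=> x Dx; rewrite (le_trans (Kb x Dx))// /weight -expRD ler_expR.
have := bB _ (X01 Dx); rewrite -(@ler_pM2l _ n%:R) ?ltr0n//.
by set u := ln _; set v := b _; lra.
Qed.

(** The weight depends on X, so the tilted law treats alike only coordinates on the same side of V:
    the moments of s i are compared inside the block of i. *)
Definition block_of (i : 'I_n) : {set 'I_n} := if i \in V then V else ~: V.

Lemma expect_fourth_moment (c : R) (i : 'I_n) :
  0 < c -> c <= #|block_of i :\ i|%:R ->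
  E (fun x => s i x ^+ 4 * weight p r (X x)) <=
    (8 / c) ^+ 4 * E (fun x => weight p r (X x)).
Proof.
move=> c0 ci.
have iW : i \in block_of i.
  by rewrite /block_of; case: ifPn => // iV; rewrite inE.
have WV j : j \in block_of i -> (j \in V) = (i \in V).
  by rewrite /block_of; case: ifPn => // iV; rewrite inE => /negbTE.
have S0 (x : R) : 0 <= x <= 1 -> 0 < 1 + r * x.
  by move=> /(affine_ge_half r2); apply: lt_le_trans; rewrite invr_gt0.
have dw (x : R) : 0 <= x <= 1 -> is_derive x 1 (weight p r)
    (- (p * r) * weight 1 r x * weight p r x).
  by move=> x01; rewrite (weight1E (S0 _ x01)); exact: (is_derive_weight_x p (S0 _ x01)).
have mw' : measurable_fun setT (fun x : R => - (p * r) * weight 1 r x * weight p r x).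
  apply: measurable_funM; last exact: measurable_weight.
  by apply: measurable_funM => //; exact: measurable_weight.
have p0 : 0 <= p by rewrite divr_ge0 ?mulr_ge0.
have w1 q (x : R) : 0 <= q -> 0 <= x <= 1 -> `|weight q r x| <= 1.
  move=> q0 /andP[x0 x1]; rewrite ger0_norm ?weight_ge0// -expR0 ler_expR.
  by rewrite mulNr oppr_le0 mulr_ge0// ln_ge0// lerDl mulr_ge0.
(* As r >= 0, the weights are at most 1 on [0, 1], so this bounds both the weight and its
   derivative. *)
pose C : R := 1 + p * r.
have wC (x : R) : 0 <= x <= 1 -> `|weight p r x| <= C.
  by move=> x01; apply: (le_trans (w1 _ _ p0 x01)); rewrite lerDl mulr_ge0.
have w'C (x : R) : 0 <= x <= 1 -> `|- (p * r) * weight 1 r x * weight p r x| <= C.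
  move=> x01; have pr0 : 0 <= p * r by rewrite mulr_ge0.
  rewrite -mulrA normrM normrN (ger0_norm pr0).
  apply: (@le_trans _ _ (p * r)); last by rewrite lerDr.
  by apply: ler_piMr => //; rewrite normrM mulr_ile1 ?w1.
have w0 (x : R) : 0 <= x <= 1 -> 0 <= weight p r x by move=> _; exact: weight_ge0.
have := block_fourth_moment inv (measurable_weight p r) mw' dw wC w'C beta2 w0 iW WV.
move=> h; rewrite expr_div_n [leRHS]mulrAC ler_pdivlMr ?exprn_gt0// [leLHS]mulrC.
apply: le_trans h; apply: ler_wpM2r.
  by apply: Rintegral_ge0 => x _; rewrite mulr_ge0 ?exprn_ge0 ?weight_ge0.
rewrite lerXn2r ?nnegrE ?mulr_ge0 ?(ltW c0)//.
by rewrite (le_trans ci)// ler_peMl// ler1n.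
Qed.

(** The tilted mass times one minus the tilted probability of the bad event: [block_concentration]
    bounds that of |X - x0| > eta, and a union bound with fourth moments that of some s i >
    kappa. *)
Lemma expect_lower (A x0 eta kappa c : R) :
  0 <= x0 <= 1 -> 0 < eta -> 0 < kappa -> 0 < c ->
  (forall i, c <= #|block_of i :\ i|%:R) ->
  (forall x, D x -> 0 <= K x) ->
  (forall x, D x -> (forall i, s i x <= kappa) -> `|X x - x0| <= eta ->
     expR (n%:R * A) * weight p r (X x) <= K x) ->
  expR (n%:R * A - beta%:R * #|V|%:R / 2 * ln (1 + r)) *
    (1 - 2 * (1 + r) ^+ 2 *
       (2 * (1 + r) / n%:R +
         (#|V|%:R / n%:R - (1 + r) * x0 / (1 + r * x0)) ^+ 2) / eta ^+ 2
     - n%:R * (8 / c) ^+ 4 / kappa ^+ 4) <= E K.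
Proof.
move=> x001 eta0 kappa0 c0 ci K0 KA.
set conc := _ * (_ + _).
(* By Markov, 1 - (X - x0)^2 / eta^2 - sum_i s_i^4 / kappa^4 is a lower bound of
   the indicator of the good event. *)
pose F x := expR (n%:R * A) * (weight p r (X x) -
  (eta ^+ 2)^-1 * ((X x - x0) ^+ 2 * weight p r (X x)) -
  (kappa ^+ 4)^-1 * \sum_i (s i x ^+ 4 * weight p r (X x))).
have bX : bounded_mfun D X := bounded_mfun_block inv V.
have b1 : bounded_mfun D (fun x => (X x - x0) ^+ 2 * weight p r (X x)).
  by apply: bounded_mfunM => //; apply: bounded_mfunX; exact: bounded_mfunB.
have b2 i : bounded_mfun D (fun x => s i x ^+ 4 * weight p r (X x)).
  apply: bounded_mfunM => //; apply: bounded_mfunX; exact: (bounded_mfun_s inv).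
have b3 : bounded_mfun D (fun x => \sum_i (s i x ^+ 4 * weight p r (X x))).
  by apply: bounded_mfun_sum.
have bF1 : bounded_mfun D (fun x => weight p r (X x) -
  (eta ^+ 2)^-1 * ((X x - x0) ^+ 2 * weight p r (X x))).
  by apply: bounded_mfunB => //; exact: bounded_mfunM.
have bF2 : bounded_mfun D (fun x => weight p r (X x) -
  (eta ^+ 2)^-1 * ((X x - x0) ^+ 2 * weight p r (X x)) -
  (kappa ^+ 4)^-1 * \sum_i (s i x ^+ 4 * weight p r (X x))).
  by apply: bounded_mfunB => //; exact: bounded_mfunM.
apply: (@le_trans _ _ (E F)); last first.
  apply: expect_le => //; first exact: bounded_mfunM.
  move=> x Dx; rewrite /F.
  have sum0 : 0 <= (kappa ^+ 4)^-1 * \sum_i (s i x ^+ 4 * weight p r (X x)).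
    apply: mulr_ge0; first by rewrite invr_ge0 exprn_ge0// ltW.
    by apply: sumr_ge0 => i _; rewrite mulr_ge0 ?exprn_ge0 ?weight_ge0.
  have dev0 : 0 <= (eta ^+ 2)^-1 * ((X x - x0) ^+ 2 * weight p r (X x)).
    apply: mulr_ge0; first by rewrite invr_ge0 exprn_ge0// ltW.
    by rewrite mulr_ge0 ?sqr_ge0 ?weight_ge0.
  have [good|bad] := pselect ((forall i, s i x <= kappa) /\ `|X x - x0| <= eta).
    case: good => g1 g2; apply: le_trans (KA _ Dx g1 g2).
    by rewrite ler_wpM2l ?expR_ge0// -addrA gerDl -opprD oppr_le0 addr_ge0.
  apply: le_trans (K0 _ Dx); rewrite mulr_ge0_le0 ?expR_ge0//.
  suff [h|h] : weight p r (X x) <= (eta ^+ 2)^-1 * ((X x - x0) ^+ 2 * weight p r (X x)) \/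
    weight p r (X x) <= (kappa ^+ 4)^-1 * \sum_i (s i x ^+ 4 * weight p r (X x)).
  - by lra.
  - by lra.
  have [far|near] := ltP eta `|X x - x0|.
    left; rewrite mulrA ler_peMl ?weight_ge0// [leRHS]mulrC ler_pdivlMr ?exprn_gt0// mul1r.
    by rewrite -[leRHS]real_normK ?num_real// lerXn2r ?nnegrE ?(ltW eta0)// ltW.
  have [i si] : exists i, kappa < s i x.
    apply: contrapT => /forallNP h; apply: bad; split=> // i.
    by rewrite leNgt; apply/negP; exact: h.
  right; rewrite [leRHS]mulrC ler_pdivlMr; last by rewrite exprn_gt0.
  have := weight_ge0 p r (X x); set W := weight _ _ _ => W0.
  rewrite (bigD1 i) //= [leLHS]mulrC ler_wpDr//.
    by apply: sumr_ge0 => j _; rewrite mulr_ge0 ?exprn_ge0.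
  rewrite ler_wpM2r// lerXn2r ?nnegrE ?(ltW kappa0)//.
  exact: ltW.
rewrite /F expectZ// expectB//; last exact: bounded_mfunM.
rewrite expectB//; last exact: bounded_mfunM.
rewrite !expectZ// expect_sum//.
rewrite expRD -mulNr -(expect_weight inv)// -mulrA.
rewrite ler_wpM2l ?expR_ge0//.
have h1 := block_concentration inv V r0 beta0 n0 x001; rewrite -/conc in h1.
have h2 : \sum_i E (fun x => s i x ^+ 4 * weight p r (X x)) <=
    n%:R * ((8 / c) ^+ 4 * E (fun x => weight p r (X x))).
  set Y := (8 / c) ^+ 4 * _; have -> : n%:R * Y = \sum_(i < n) Y.
    by rewrite sumr_const card_ord mulr_natl.
  by apply: ler_sum => i _; apply: expect_fourth_moment (ci i).
have eta2 : 0 <= (eta ^+ 2)^-1 by rewrite invr_ge0 sqr_ge0.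
have kappa4 : 0 <= (kappa ^+ 4)^-1 by rewrite invr_ge0 exprn_ge0// ltW.
have {}h1 := ler_wpM2l eta2 h1.
have {}h2 := ler_wpM2l kappa4 h2.
move: h1 h2; set W := E (fun x => weight p r (X x)).
move=> h1 h2.
rewrite (_ : W * _ = W - (eta ^+ 2)^-1 * (conc * W) -
  (kappa ^+ 4)^-1 * (n%:R * ((8 / c) ^+ 4 * W))); last by ring.
by apply: lerB => //; apply: lerB.
Qed.

End exponential_bounds.

(** * From bounds at fixed dimension to the limit of the free energy *)

Section annealed_limit.
Context {R : realType}.
Implicit Types (b : R -> R).

Lemma cvg_invn : (N%:R^-1 : R) @[N --> \oo] --> (0 : R).
Proof.
apply/gtr0_cvgV0; last exact: cvgr_idn.
by exists 1%N => // N N0 /=; rewrite ltr0n.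
Qed.

Variables (beta : nat) (d : nat -> measure_display).
Variables (S : forall N, measurableType (d N)) (sigma : forall N, probability (S N) R).
Variables (n_ : nat -> nat) (s : forall N, 'I_(n_ N) -> S N -> R).
Variables (V : forall N, {set 'I_(n_ N)}) (K : forall N, S N -> R).
Variables (b : R -> R) (r x0 B bmax m c : R).
Arguments s : clear implicits.
Arguments K : clear implicits.
Hypothesis beta0 : (0 < beta)%N.
Hypothesis beta2 : (beta <= 2)%N.
(** In the Wishart models the dimension is [L N + M N], equal to N by a proof and not by
    computation; keeping [n_] avoids transporting the index types. *)
Hypothesis n_E : forall N, n_ N = N.
Hypothesis inv : forall N, (0 < N)%N -> rot_invariant (sigma N) beta (s N).
Hypothesis bK : forall N, (0 < N)%N -> bounded_mfun (simplex_dom (s N)) (K N).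
Hypothesis K_ge0 : forall N x, 0 <= K N x.
Local Notation X := (fun N x => \sum_(l in V N) s N l x).
Hypothesis K_upper : forall N x, (0 < N)%N -> simplex_dom (s N) x ->
  K N x <= expR (N%:R * b (X N x)).
Hypothesis K_lower : forall delta : R, 0 < delta -> exists2 kappa : R, 0 < kappa &
  forall N x, (0 < N)%N -> simplex_dom (s N) x ->
    (forall i, s N i x <= kappa / Num.sqrt N%:R) ->
    expR ((1 - delta) * (N%:R * b (X N x))) <= K N x.
Hypothesis r0 : 0 <= r.
Hypothesis x001 : 0 <= x0 <= 1.
Hypothesis b_le : forall x, 0 <= x <= 1 -> b x <= bmax.
Hypothesis bB : forall x, 0 <= x <= 1 -> b x + beta%:R / 2 * ln (1 + r * x) <= B.
Hypothesis b_near : forall eps : R, 0 < eps -> exists2 eta : R, 0 < eta &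
  forall x, 0 <= x <= 1 -> `|x - x0| <= eta ->
    B - eps <= b x + beta%:R / 2 * ln (1 + r * x).
Hypothesis m_def : m = (1 + r) * x0 / (1 + r * x0).
Hypothesis cvg_m : (#|V N|%:R / N%:R : R) @[N --> \oo] --> m.
Hypothesis c0 : 0 < c.
Hypothesis block_large : \forall N \near \oo, forall i,
  c * N%:R <= #|block_of (V N) i :\ i|%:R.

Local Notation EK N := (\int[sigma N]_(x in simplex_dom (s N)) K N x)%R.
Local Notation L := (B - beta%:R / 2 * m * ln (1 + r)).

Let upper N : (0 < N)%N ->
  EK N <= expR (N%:R * (B - beta%:R / 2 * (#|V N|%:R / N%:R) * ln (1 + r))).
Proof.
move=> N0; have n0 : (0 < n_ N)%N by rewrite n_E.
have Nr : N%:R != 0 :> R by rewrite pnatr_eq0 -lt0n.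
have nR : (n_ N)%:R = N%:R :> R by rewrite n_E.
have := expect_upper (inv N0) beta0 n0 r0 (bK N0) bB.
rewrite nR => /(_ (V N) (fun x => K_upper N0)) /le_trans; apply.
rewrite ler_expR le_eqVlt; apply/orP; left; apply/eqP.
by move: (ln _) => u; field.
Qed.

(** The factor 1/2 is what is left of the tilted mass once the error in [expect_lower] has fallen
    below 1/2. *)
Let lower (eps : R) : 0 < eps -> \forall N \near \oo,
  2^-1 * expR (N%:R * (B - eps - beta%:R / 2 * (#|V N|%:R / N%:R) * ln (1 + r)))
    <= EK N.
Proof.
move=> eps0.
have bm1 : 0 < `|bmax| + 1 by rewrite ltr_wpDl.
(* Makes delta * b(x) <= eps / 2, the other half of eps being spent on [b_near]; the added 1 keeps
   the denominator positive. *)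
pose delta := eps / 2 / (`|bmax| + 1).
have delta0 : 0 < delta by rewrite !divr_gt0.
have [kappa kappa0 Klo] := K_lower delta0.
have [eta eta0 beta_near] := b_near (divr_gt0 eps0 (ltr0Sn R 1)).
(* The last term is N (8 / (c N))^4 / (kappa / sqrt N)^4, which is of order 1 / N. *)
pose err N : R := 2 * (1 + r) ^+ 2 *
       (2 * (1 + r) * N%:R^-1 + (#|V N|%:R / N%:R - m) ^+ 2) / eta ^+ 2
     + (8 / c) ^+ 4 / kappa ^+ 4 * N%:R^-1.
have err0 : err N @[N --> \oo] --> 0.
  have -> : 0 = 2 * (1 + r) ^+ 2 * (2 * (1 + r) * 0 + (m - m) ^+ 2) / eta ^+ 2
     + (8 / c) ^+ 4 / kappa ^+ 4 * 0 :> R.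
    by rewrite subrr expr0n /= !(mulr0, mul0r, addr0).
  apply: cvgD; last by apply: cvgM; [exact: cvg_cst|exact: cvg_invn].
  apply: cvgM; last exact: cvg_cst.
  apply: cvgM; first exact: cvg_cst.
  apply: cvgD; first by apply: cvgM; [exact: cvg_cst|exact: cvg_invn].
  rewrite expr2; under eq_fun do rewrite expr2.
  by apply: cvgM; apply: cvgB => //; exact: cvg_cst.
have errlt : \forall N \near \oo, err N < 2^-1.
  by apply: (cvgr_lt _ err0); rewrite invr_gt0.
near=> N.
have N0 : (0 < N)%N by near: N; exists 1%N.
have Nr0 : 0 < N%:R :> R by rewrite ltr0n.
have Nr : N%:R != 0 :> R by rewrite lt0r_neq0.
have n0 : (0 < n_ N)%N by rewrite n_E.
have errN : err N <= 2^-1.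
  by apply: ltW; near: N.
have ci : forall i, c * N%:R <= #|block_of (V N) i :\ i|%:R by near: N.
have cN0 : 0 < c * N%:R by rewrite mulr_gt0.
have nR : (n_ N)%:R = N%:R :> R by rewrite n_E.
have sq0 : 0 < kappa / Num.sqrt N%:R by rewrite divr_gt0// sqrtr_gt0.
have KA x : simplex_dom (s N) x -> (forall i, s N i x <= kappa / Num.sqrt N%:R) ->
    `|X N x - x0| <= eta ->
    expR ((n_ N)%:R * (B - eps)) * weight (beta%:R * (n_ N)%:R / 2) r (X N x) <= K N x.
  move=> Dx sx Xx; apply: le_trans (Klo _ _ N0 Dx sx).
  have X01 := s_sum_itv (inv N0) (V N) Dx.
  rewrite nR /weight -expRD ler_expR.
  have := beta_near _ X01 Xx; have := b_le X01.
  move: (ln _) (b _) => u v vb uv.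
  have dv : delta * v <= eps / 2.
    apply: (@le_trans _ _ (delta * (`|bmax| + 1))).
      rewrite ler_wpM2l ?(ltW delta0)// (le_trans vb)// (le_trans (ler_norm _))//.
      by rewrite lerDl.
    by rewrite /delta mulfVK ?lt0r_neq0.
  rewrite mulrCA (_ : _ + _ = N%:R * (B - eps - beta%:R / 2 * u)); last by field.
  rewrite ler_pM2l//; lra.
have := expect_lower (inv N0) beta0 beta2 n0 r0 (bK N0) x001 eta0 sq0 cN0 ci
  (fun x _ => K_ge0 x) KA.
apply: le_trans; rewrite nR -m_def mulrC.
apply: ler_pM; [exact: expR_ge0|by []| |].
  rewrite ler_expR le_eqVlt; apply/orP; left; apply/eqP.
  by move: (ln _) => u; field.
rewrite -addrA -opprD lerBrDr addrC -lerBrDr (_ : 1 - 2^-1 = 2^-1); last by field.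
apply: le_trans errN; rewrite /err lerD2l.
have sN : Num.sqrt N%:R ^+ 4 = N%:R ^+ 2 :> R.
  by rewrite (exprM _ 2 2) sqr_sqrtr.
rewrite !expr_div_n sN exprMn le_eqVlt; apply/orP; left; apply/eqP.
by field; rewrite Nr !lt0r_neq0.
Unshelve. all: end_near. Qed.

Lemma annealed_limit (Z : nat -> \bar R) :
  (forall N, (0 < N)%N -> Z N = (EK N)%:E) ->
  ((N%:R^-1)%:E * lne (Z N))%E @[N --> \oo] --> L%:E.
Proof.
move=> ZE.
pose f N : R := N%:R^-1 * ln (EK N).
have EK0 : \forall N \near \oo, 0 < EK N.
  have := lower ltr01; apply: filterS => N; apply: lt_le_trans.
  by rewrite mulr_gt0 ?invr_gt0 ?expR_gt0.
suff fL : f N @[N --> \oo] --> L.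
  have ZF : \forall N \near \oo, ((N%:R^-1)%:E * lne (Z N))%E = (f N)%:E.
    near=> N; have N0 : (0 < N)%N by near: N; exists 1%N.
    by rewrite ZE// lne_EFin//; near: N.
  apply: cvg_EFin; first by apply: filterS ZF => N ->.
  apply: cvg_trans fL; apply: near_eq_cvg.
  by apply: filterS ZF => N /= ->.
apply/cvgrPdist_le => eps eps0.
(* One third for the convergence of |V| / N, one for ln 2 / N, one for the loss in [lower]. *)
have e3 : 0 < eps / 3 by rewrite divr_gt0.
pose g N : R := beta%:R / 2 * (#|V N|%:R / N%:R) * ln (1 + r).
have gL : g N @[N --> \oo] --> beta%:R / 2 * m * ln (1 + r).
  apply: cvgM; last exact: cvg_cst.
  by apply: cvgM => //; exact: cvg_cst.
have lnN : ln 2 * N%:R^-1 @[N --> \oo] --> (0 : R).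
  by rewrite -[X in _ --> X](mulr0 (ln 2)); apply: cvgM; [exact: cvg_cst|exact: cvg_invn].
have lnNlt : \forall N \near \oo, ln 2 * N%:R^-1 < eps / 3.
  exact: (cvgr_lt _ lnN).
near=> N.
have N0 : (0 < N)%N by near: N; exists 1%N.
have Nr0 : 0 < N%:R :> R by rewrite ltr0n.
have EKN : 0 < EK N by near: N.
have gN : `|beta%:R / 2 * m * ln (1 + r) - g N| <= eps / 3.
  by near: N; move/cvgrPdist_le : gL; exact.
have lN : ln 2 * N%:R^-1 <= eps / 3.
  by apply: ltW; near: N.
have fup : f N <= B - g N.
  rewrite /f [leLHS]mulrC ler_pdivrMr// [leRHS]mulrC -ler_expR lnK ?posrE//.
  exact: upper.
have flo : B - eps / 3 - g N - ln 2 * N%:R^-1 <= f N.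
  rewrite /f [leRHS]mulrC ler_pdivlMr// mulrBl divfK ?lt0r_neq0//.
  rewrite [X in X - _]mulrC -ler_expR lnK ?posrE// expRD expRN lnK ?posrE// [leLHS]mulrC.
  by near: N; exact: (lower e3).
move: gN; rewrite !ler_norml => /andP[g1 g2]; apply/andP; split; lra.
Unshelve. all: end_near. Qed.

End annealed_limit.

(** * The Wishart variational problem *)

Section wishart_variational.
Context {R : realType}.
Variables (beta : nat) (alpha theta : R).
Hypothesis beta0 : (0 < beta)%N.
Hypothesis alpha1 : 1 < alpha.

Local Notation bt := beta%:R.
Local Notation t := (2 * theta ^+ 2 / bt).
Local Notation m := (alpha / (1 + alpha)).
Local Notation b := (fun x : R => t * (x * (1 - x))).

Let bt0 : 0 < bt :> R. Proof. by rewrite ltr0n. Qed.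
Let btN0 : bt != 0 :> R. Proof. exact: lt0r_neq0. Qed.
Let t0 : 0 <= t.
Proof. by apply: divr_ge0; [apply: mulr_ge0 => //; exact: sqr_ge0|exact: ltW]. Qed.
Let a1 : 0 < 1 + alpha.
Proof. by apply: addr_gt0 => //; exact: lt_trans alpha1. Qed.
Let m_half : 2^-1 < m.
Proof. by have h := alpha1; rewrite ltr_pdivlMr// mulrC ltr_pdivrMr//; lra. Qed.
Let m_lt1 : m < 1. Proof. by rewrite ltr_pdivrMr//; lra. Qed.
Let mE : 1 - m = (1 + alpha)^-1. Proof. by field; exact: lt0r_neq0. Qed.

(** The equation is the stationarity of the objective of F, multiplied by 2 x (1 - x). Since alpha >
    1 gives m > 1/2, it changes sign between 1/2 and m; the bound x0 <= m is what makes r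
    nonnegative below. *)
Let critical_point : exists2 x0 : R, 2^-1 <= x0 <= m &
  2 * t * (x0 * (1 - x0)) * (1 - 2 * x0) + bt * (m - x0) = 0.
Proof.
pose q (x : R) := 2 * t * (x * (1 - x)) * (1 - 2 * x) + bt * (m - x).
have cq : {within `[2^-1, m], continuous q}.
  by apply: derivable_within_continuous => x _; exact: ex_derive.
have half_m : 2^-1 <= m by exact: ltW.
have q1 : 0 <= q 2^-1.
  rewrite /q (_ : 1 - 2 * 2^-1 = 0); last by field.
  by rewrite mulr0 add0r mulr_ge0 ?subr_ge0// ltW.
have q2 : q m <= 0.
  rewrite /q subrr mulr0 addr0; apply: mulr_ge0_le0.
    have m0 : 0 <= m by apply: le_trans half_m; rewrite invr_ge0.
    apply: mulr_ge0; first exact: mulr_ge0.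
    by apply: mulr_ge0 => //; rewrite subr_ge0 ltW.
  by have := m_half; lra.
have [|x0] := @IVT _ q _ _ 0 half_m cq.
  by rewrite ge_min q2 orbT le_max q1.
by rewrite in_itv/= => x0I qx0; exists x0.
Qed.

(** The condition m = (1 + r) x0 / (1 + r x0) gives r / (1 + r x0) = (m - x0) / (x0 (1 - x0)), so
    the tilted objective and the objective of F have the same stationarity condition at x0. Both are
    concave, hence both are maximal there. *)
Lemma wishart_variational : exists x0 r B : R,
  [/\ 0 <= x0 <= 1, 0 <= r, m = (1 + r) * x0 / (1 + r * x0),
      (forall x, 0 <= x <= 1 -> b x + bt / 2 * ln (1 + r * x) <= B) &
      B = b x0 + bt / 2 * ln (1 + r * x0)] /\
      F_wishart beta alpha theta = (B - bt / 2 * m * ln (1 + r))%:E.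
Proof.
have [x0 /andP[x0h x0m] crit] := critical_point.
have x0_gt0 : 0 < x0 by apply: lt_le_trans x0h; rewrite invr_gt0.
have x0_lt1 : x0 < 1 by apply: le_lt_trans x0m _.
have l0 : 0 < 1 - m by rewrite subr_gt0.
have m0 : 0 < m by rewrite divr_gt0// (lt_trans _ alpha1).
have y0 : 0 < 1 - x0 by rewrite subr_gt0.
move: m l0 m0 x0m crit mE => mm l0 m0 x0m crit mmE.
have nx : x0 != 0 by exact: lt0r_neq0.
have ny : 1 - x0 != 0 by exact: lt0r_neq0.
have nl : 1 - mm != 0 by exact: lt0r_neq0.
have nm : mm != 0 by exact: lt0r_neq0.
(* 1 + r is such that 1 / (1 + r * x0) * (1 + r * x) is the affine function
   (1 - m) (1 - x) / (1 - x0) + m x / x0. *)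
pose r := mm * (1 - x0) / (x0 * (1 - mm)) - 1.
have r1E : 1 + r = mm * (1 - x0) / (x0 * (1 - mm)) by rewrite /r; ring.
have rxE : 1 + r * x0 = (1 - x0) / (1 - mm) by rewrite /r; field; rewrite nx nl.
have r0 : 0 <= r.
  rewrite subr_ge0 ler_pdivlMr ?mulr_gt0// mul1r; nra.
(* The critical equation divided by x0 (1 - x0): the slope of the logarithmic terms cancels that of
   b. *)
have slope : bt * (mm - x0) / (x0 * (1 - x0)) = - (2 * t * (1 - 2 * x0)).
  have -> : bt * (mm - x0) = - (2 * t * (x0 * (1 - x0)) * (1 - 2 * x0)) by lra.
  by field; rewrite nx ny btN0.
exists x0, r, (b x0 + bt / 2 * ln (1 + r * x0)); split; first split => //.
- by rewrite !ltW.
- by rewrite rxE r1E; field; rewrite nx ny nl.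
- move=> x /andP[x_ge0 x_le1].
  have S0 : 0 < 1 + r * x by rewrite ltr_wpDr ?mulr_ge0.
  have Sx0 : 0 < 1 + r * x0 by rewrite ltr_wpDr ?mulr_ge0 ?(ltW x0_gt0).
  have lnS : ln (1 + r * x) - ln (1 + r * x0) <= r * (x - x0) / (1 + r * x0).
    rewrite -ln_div ?posrE//.
    have -> : (1 + r * x) / (1 + r * x0) = 1 + r * (x - x0) / (1 + r * x0).
      by field; exact: lt0r_neq0.
    apply: le_ln1Dx; rewrite -subr_gt0 opprK.
    have -> : r * (x - x0) / (1 + r * x0) + 1 = (1 + r * x) / (1 + r * x0).
      by field; exact: lt0r_neq0.
    exact: divr_gt0.
  have sl : bt / 2 * (r * (x - x0) / (1 + r * x0)) = - (t * (1 - 2 * x0)) * (x - x0).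
    have -> : - (t * (1 - 2 * x0)) = bt * (mm - x0) / (x0 * (1 - x0)) / 2.
      by rewrite slope; field.
    by rewrite rxE /r; field; rewrite nx ny nl.
  have {}lnS : bt / 2 * (ln (1 + r * x) - ln (1 + r * x0)) <=
      - (t * (1 - 2 * x0)) * (x - x0).
    by rewrite -sl; apply: ler_wpM2l => //; apply: divr_ge0 => //; exact: ltW.
  (* The gap between b and its tangent at x0 is exactly t (x - x0)^2. *)
  have sq : 0 <= t * (x - x0) ^+ 2 by rewrite mulr_ge0 ?sqr_ge0.
  move: lnS sq; move: t (ln _) (ln _) (bt / 2) => tt u v c; nra.
have al0 : 0 < alpha by exact: lt_trans alpha1.
have aN0 : 1 + alpha != 0 by exact: lt0r_neq0.
have mmA : mm = alpha / (1 + alpha).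
  by rewrite -[LHS](subKr 1) mmE; field.
pose phi x := t * (x * (1 - x)) + bt / 2 * ((1 - mm) * ln (1 - x) + mm * ln x).
pose T (x : R) : \bar R := ((2 * theta ^+ 2 / bt * x * (1 - x))%:E
  + (bt / (2 * (1 + alpha)))%:E * lne (1 - x)%:E
  + (bt * alpha / (2 * (1 + alpha)))%:E * lne x%:E)%E.
have TE x : 0 < x < 1 -> T x = (phi x)%:E.
  move=> /andP[xp x1]; rewrite /T !lne_EFin ?subr_gt0// -!EFinM -!EFinD.
  congr EFin; rewrite /phi mmE mmA; move: t (ln _) (ln _) => tt u v.
  by field; rewrite aN0.
have phi_le x : 0 < x < 1 -> phi x <= phi x0.
  move=> /andP[xp x1].
  have ln_tangent (y z : R) : 0 < y -> 0 < z -> ln z - ln y <= (z - y) / y.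
    move=> yp zp; rewrite -ln_div ?posrE//.
    have -> : z / y = 1 + (z - y) / y by field; exact: lt0r_neq0.
    apply: le_ln1Dx; rewrite -subr_gt0 opprK.
    have -> : (z - y) / y + 1 = z / y by field; exact: lt0r_neq0.
    exact: divr_gt0.
  have g1 := ln_tangent _ _ x0_gt0 xp.
  have g2 : ln (1 - x) - ln (1 - x0) <= ((1 - x) - (1 - x0)) / (1 - x0).
    by apply: ln_tangent; rewrite ?subr_gt0.
  have {}g1 := ler_wpM2l (ltW m0) g1.
  have {}g2 := ler_wpM2l (ltW l0) g2.
  have g3 : bt / 2 * ((1 - mm) * (ln (1 - x) - ln (1 - x0)) + mm * (ln x - ln x0)) <=
      - (t * (1 - 2 * x0)) * (x - x0).
    have -> : - (t * (1 - 2 * x0)) * (x - x0) =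
      bt / 2 * ((1 - mm) * (((1 - x) - (1 - x0)) / (1 - x0)) + mm * ((x - x0) / x0)).
      have -> : - (t * (1 - 2 * x0)) = bt * (mm - x0) / (x0 * (1 - x0)) / 2.
        by rewrite slope; field.
      by field; rewrite nx ny.
    apply: ler_wpM2l; last exact: lerD.
    by apply: divr_ge0 => //; exact: ltW.
  have sq : 0 <= t * (x - x0) ^+ 2 by rewrite mulr_ge0 ?sqr_ge0.
  rewrite /phi; move: g3 sq.
  move: t (ln _) (ln _) (ln _) (ln _) (bt / 2) => tt u1 u2 v1 v2 c; nra.
have den0 : 0 < 2 * (1 + alpha) by exact: mulr_gt0.
have coef1 : 0 < bt / (2 * (1 + alpha)) by exact: divr_gt0.
have coef2 : 0 < bt * alpha / (2 * (1 + alpha)).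
  by apply: divr_gt0 => //; exact: mulr_gt0.
have x0_in : 0 < x0 < 1 by rewrite x0_gt0.
have supE : ereal_sup [set T x | x in `[0, 1]%classic] = (phi x0)%:E.
  apply/eqP; rewrite eq_le; apply/andP; split.
    apply: ge_ereal_sup => y [x /=]; rewrite in_itv/= => /andP[x_ge0 x_le1] <-.
    (* At both endpoints a logarithm with a positive coefficient is -oo, so they do not affect the
       supremum. *)
    have [xz|xz] := eqVneq x 0.
      rewrite /T xz [lne 0%:E]le0_lneNy// gt0_muleNy ?addeNy ?leNye//.
    have [xo|xo] := eqVneq x 1.
      rewrite /T xo subrr [lne 0%:E]le0_lneNy// gt0_muleNy ?addeNy ?addNye ?leNye//.
    rewrite TE ?lee_fin ?phi_le// lt_neqAle eq_sym xz x_ge0/=.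
      by rewrite lt_neqAle xo.
    by rewrite lt_neqAle xo.
  apply: ereal_sup_ubound; exists x0; last exact: TE.
  by rewrite /= in_itv/= !ltW.
rewrite /F_wishart supE -EFinB; congr EFin.
have -> : C_alpha alpha = (1 - mm) / 2 * ln (1 - mm) + mm / 2 * ln mm.
  by rewrite /C_alpha mmE mmA; congr (_ * _ + _ * _); field; rewrite aN0.
(* Expanding ln (1 + r x0) - m ln (1 + r) yields (1 - m) ln (1 - x0) + m ln x0 together with the
   terms in m alone, which make up [C_alpha]. *)
rewrite /phi rxE r1E !ln_div ?lnM ?posrE ?mulr_gt0//.
by move: t (ln _) (ln _) (ln _) (ln _) => tt u v u' v'; field.
Qed.

End wishart_variational.

(** * Products of functions of independent variables *)

Section independence.
Context {R : realType} d d' {T : measurableType d} {T' : measurableType d'}.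
Variable P : probability T R.
Import HBNNSimple.

(** The passage from indicators to simple functions, then to nonnegative functions by monotone
    convergence. *)
Lemma expect_mul_comp (Y : T -> R) (X : T -> T') (c : R) (f : T' -> R) :
  measurable_fun setT Y -> (forall w, 0 <= Y w) ->
  measurable_fun setT X -> 0 <= c ->
  (forall B, measurable B ->
    \int[P]_w (Y w * \1_B (X w))%:E = c%:E * \int[P]_w (\1_B (X w))%:E)%E ->
  measurable_fun setT f -> (forall x, 0 <= f x) ->
  (\int[P]_w (Y w * f (X w))%:E = c%:E * \int[P]_w (f (X w))%:E)%E.
Proof.
move=> mY Y0 mX c0 YB mf f0.
have mYg (g : T' -> R) : measurable_fun setT g ->
    measurable_fun setT (fun w => (Y w * g (X w))%:E).
  move=> mg; apply/measurable_EFinP/measurable_funM => //.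
  exact: measurableT_comp.
have simple (g : {nnsfun T' >-> R}) :
    (\int[P]_w (Y w * g (X w))%:E = c%:E * \int[P]_w (g (X w))%:E)%E.
  pose r := finmap.enum_fset (fset_set (range g)).
  have r0 y : y \in r -> 0 <= y.
    rewrite /r => /[!in_fset_set]//; rewrite inE => -[x _ <-].
    exact: fun_ge0.
  pose I y : T' -> R := \1_(g @^-1` [set y]).
  (* On the range of g the maximum is y itself; it makes the coefficients nonnegative for every y,
     as termwise integration requires. *)
  have gE x : g x = \sum_(y <- r) Num.max 0 y * I y x.
    rewrite fimfunE fsbig_finite//; apply: eq_big_seq => y yr.
    by rewrite max_r// r0.
  have y0 y : 0 <= Num.max 0 y :> R by rewrite le_max lexx.
  have mI y : measurable_fun setT (I y) by exact: measurable_indic.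
  have I0 y x : 0 <= I y x by rewrite /I indicE.
  have intYg : (\int[P]_w (Y w * g (X w))%:E = \sum_(y <- r) (Num.max 0 y)%:E *
      \int[P]_w (Y w * I y (X w))%:E)%E.
    transitivity (\int[P]_w \sum_(y <- r) ((Num.max 0 y)%:E * (Y w * I y (X w))%:E))%E.
      apply: eq_integral => w _; rewrite gE mulr_sumr -sumEFin.
      by apply: eq_bigr => y _; rewrite mulrCA EFinM.
    rewrite ge0_integral_sum//; last 2 first.
    - by move=> y; apply: measurable_funeM; exact: mYg.
    - by move=> y w _; rewrite mule_ge0// lee_fin ?mulr_ge0.
    apply: eq_bigr => y _; rewrite ge0_integralZl_EFin//; last exact: mYg.
    by move=> w _; rewrite lee_fin mulr_ge0.
  have mIX y : measurable_fun setT (fun w => (I y (X w))%:E).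
    by apply/measurable_EFinP; exact: measurableT_comp.
  have intg : (\int[P]_w (g (X w))%:E = \sum_(y <- r) (Num.max 0 y)%:E *
      \int[P]_w (I y (X w))%:E)%E.
    transitivity (\int[P]_w \sum_(y <- r) ((Num.max 0 y)%:E * (I y (X w))%:E))%E.
      by apply: eq_integral => w _; rewrite gE -sumEFin.
    rewrite ge0_integral_sum//; last 2 first.
    - by move=> y; exact: measurable_funeM.
    - by move=> y w _; rewrite mule_ge0// lee_fin.
    by apply: eq_bigr => y _; rewrite ge0_integralZl_EFin// => w _; rewrite lee_fin.
  rewrite intYg intg ge0_sume_distrr; last first.
    by move=> y _; rewrite mule_ge0// ?lee_fin// integral_ge0// => w _; rewrite lee_fin.
  by apply: eq_bigr => y _; rewrite YB// muleCA.
have mfE : measurable_fun setT (EFin \o f) by exact/measurable_EFinP.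
pose fn := nnsfun_approx measurableT mfE.
have fn_cvg x : (fn n x)%:E @[n --> \oo] --> (f x)%:E.
  by apply: (cvg_nnsfun_approx measurableT mfE) => // y _; rewrite lee_fin.
have nd_fn x : {homo (fun n => fn n x) : m n / (m <= n)%N >-> m <= n}.
  by move=> m n mn; exact/lefP/nd_nnsfun_approx.
have limY : (\int[P]_w (Y w * fn n (X w))%:E)%E @[n --> \oo] -->
    (\int[P]_w (Y w * f (X w))%:E)%E.
  rewrite [X in _ --> X](_ : _ =
      (\int[P]_w limn (fun n => (Y w * fn n (X w))%:E))%E); last first.
    apply: eq_integral => w _; apply/esym/cvg_lim => //.
    under eq_fun do rewrite EFinM.
    by rewrite EFinM; apply: cvgeZl.
  apply: cvg_monotone_convergence => //.
  - by move=> n; exact: mYg.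
  - by move=> n w _; rewrite lee_fin mulr_ge0.
  - by move=> w _ m n mn; rewrite lee_fin ler_wpM2l// nd_fn.
have limX : (c%:E * \int[P]_w (fn n (X w))%:E)%E @[n --> \oo] -->
    (c%:E * \int[P]_w (f (X w))%:E)%E.
  apply: cvgeZl => //.
  rewrite [X in _ --> X](_ : _ =
      (\int[P]_w limn (fun n => (fn n (X w))%:E))%E); last first.
    by apply: eq_integral => w _; apply/esym/cvg_lim => //; exact: fn_cvg.
  apply: cvg_monotone_convergence => //.
  - by move=> n; apply/measurable_EFinP; exact: measurableT_comp.
  - by move=> n w _; rewrite lee_fin.
  - by move=> w _ m n mn; rewrite lee_fin nd_fn.
rewrite -(cvg_lim _ limY)// -(cvg_lim _ limX)//.
by congr (limn _); apply/funext => n; exact: simple.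
Qed.

Lemma expect_prod_independent (I : finType) (D : {set I}) (X : I -> T -> T')
    (f : I -> T' -> R) (c : I -> R) :
  (forall i, i \in D -> measurable_fun setT (X i)) ->
  mutually_independent P D X ->
  (forall i, i \in D -> measurable_fun setT (f i)) ->
  (forall i x, 0 <= f i x) ->
  (forall i, i \in D -> (\int[P]_w (f i (X i w))%:E = (c i)%:E)%E) ->
  (\int[P]_w (\prod_(i in D) f i (X i w))%:E = (\prod_(i in D) c i)%:E)%E.
Proof.
move=> mX indep.
have indic_prod (J : {set I}) (B : I -> set T') w :
    \prod_(i in J) (\1_(B i) (X i w) : R) =
    \1_(\bigcap_(i in [set` J]) X i @^-1` B i) w.
  rewrite indicE; have [inJ|notJ] := pselect ((\bigcap_(i in [set` J]) X i @^-1` B i) w).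
    rewrite mem_set//= big1// => i iJ; rewrite indicE mem_set//.
    exact: inJ.
  rewrite memNset//=; move/existsNP : notJ => [i /not_implyP[iJ nB]].
  by rewrite (bigD1 i)//= indicE memNset ?mul0r.
suff main (K : seq I) : forall (f : I -> T' -> R) (c : I -> R),
  (forall i, i \in D -> measurable_fun setT (f i)) ->
  (forall i x, 0 <= f i x) ->
  (forall i, i \in D -> (\int[P]_w (f i (X i w))%:E = (c i)%:E)%E) ->
  (forall i, i \in D -> i \notin K -> exists2 B, measurable B & f i = \1_B) ->
  (\int[P]_w (\prod_(i in D) f i (X i w))%:E = (\prod_(i in D) c i)%:E)%E.
  by move=> mf f0 fc; apply: (main (enum I)) => // i _; rewrite mem_enum.
(* The functions outside K are indicators; they are replaced one at a time. *)
elim: K => [|k K ih] {}f {}c mf f0 fc fB.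
  (* All functions are now indicators, so the product formula is independence for the whole index
     set; outside D the chosen set is an arbitrary default. *)
  have /choice[B BP] : forall i, exists B, i \in D -> measurable B /\ f i = \1_B.
    move=> i; have [iD|] := boolP (i \in D); last by exists set0.
    by have [B mB fiB] := fB i iD isT; exists B.
  transitivity (P (\bigcap_(i in [set` D]) X i @^-1` B i)).
    rewrite -[X in P X]setIT -integral_indic//; last first.
      apply: fin_bigcap_measurable => // i iD.
      by rewrite -[X in measurable X]setTI; apply: mX => //; have [] := BP _ iD.
    apply: eq_integral => w _; rewrite -indic_prod; congr EFin.
    by apply: eq_bigr => i iD; have [_ ->] := BP _ iD.
  rewrite indep//; last by move=> i /BP[].
  rewrite -prodEFin; apply: eq_bigr => i iD; rewrite -fc//.
  have [mB ->] := BP _ iD.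
  rewrite -[X in P X]setIT -integral_indic//.
  by rewrite -[X in measurable X]setTI; exact: mX.
have [kD|kD] := boolP (k \in D); last first.
  apply: ih => // i iD iK; apply: fB => //; rewrite inE negb_or iK andbT.
  by apply: contraNneq kD => <-.
pose Y w := \prod_(i in D | i != k) f i (X i w).
pose C := \prod_(i in D | i != k) c i.
have c0 i : i \in D -> 0 <= c i.
  by move=> iD; rewrite -lee_fin -fc// integral_ge0// => w _; rewrite lee_fin.
have mXf i (g : T' -> R) : i \in D -> measurable_fun setT g ->
    measurable_fun setT (fun w => g (X i w)).
  by move=> iD mg; apply: measurableT_comp => //; exact: mX.
have mY : measurable_fun setT Y.
  rewrite (_ : Y = fun w => \prod_(i <- [seq i <- index_enum I | (i \in D) && (i != k)])
    f i (X i w)); last by apply/funext => w; rewrite big_filter.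
  apply: measurable_prod => i; rewrite mem_filter => /andP[/andP[iD _] _].
  by apply: mXf => //; exact: mf.
transitivity (\int[P]_w (Y w * f k (X k w))%:E)%E.
  by apply: eq_integral => w _; rewrite (bigD1 k)//= mulrC.
rewrite [in RHS](bigD1 k)//= mulrC EFinM -/C -fc//.
apply: expect_mul_comp; [exact: mY| |exact: mX| | |exact: mf|by []].
- by move=> w; apply: prodr_ge0.
- by apply: prodr_ge0 => i /andP[iD _]; exact: c0.
move=> B mB.
have PB : P (X k @^-1` B) \is a fin_num.
  by rewrite fin_num_measure// -[X in measurable X]setTI; exact: mX.
have indB : (\int[P]_w (\1_B (X k w))%:E = P (X k @^-1` B))%E.
  rewrite -[X in P X]setIT -integral_indic//.
  by rewrite -[X in measurable X]setTI; exact: mX.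
(* Replacing the k-th function by an indicator shortens K, so the induction hypothesis supplies the
   indicator case required by [expect_mul_comp]. *)
pose f' i := if i == k then \1_B else f i.
pose c' i := if i == k then fine (P (X k @^-1` B)) else c i.
have f'k : f' k = \1_B by rewrite /f' eqxx.
have c'k : c' k = fine (P (X k @^-1` B)) by rewrite /c' eqxx.
have f'i i : i != k -> f' i = f i by rewrite /f' => /negbTE ->.
have c'i i : i != k -> c' i = c i by rewrite /c' => /negbTE ->.
have prodf w : \prod_(i in D) f' i (X i w) = Y w * \1_B (X k w).
  rewrite (bigD1 k)//= f'k mulrC; congr (_ * _).
  by apply: eq_bigr => i /andP[_ ik]; rewrite f'i.
have prodc : \prod_(i in D) c' i = C * fine (P (X k @^-1` B)).
  rewrite (bigD1 k)//= c'k mulrC; congr (_ * _).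
  by apply: eq_bigr => i /andP[_ ik]; rewrite c'i.
transitivity (\int[P]_w (\prod_(i in D) f' i (X i w))%:E)%E.
  by apply: eq_integral => w _; rewrite prodf.
rewrite indB -(fineK PB) -EFinM -prodc; apply: ih.
- move=> i iD; have [->|ik] := eqVneq i k; last by rewrite f'i//; exact: mf.
  by rewrite f'k; exact: measurable_indic.
- move=> i x; have [->|ik] := eqVneq i k; last by rewrite f'i.
  by rewrite f'k indicE.
- move=> i iD; have [->|ik] := eqVneq i k; last by rewrite f'i// c'i//; exact: fc.
  by rewrite f'k c'k indB fineK.
- move=> i iD iK; have [->|ik] := eqVneq i k; first by exists B.
  by rewrite f'i//; apply: fB => //; rewrite inE negb_or ik.
Qed.

End independence.

(** * Plane rotations as matrices *)

Section plane_rotation.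
Context {K : comNzRingType} {n : nat}.
Variables (i j : 'I_n) (a b a' b' : K).

Definition plane_mx : 'M[K]_n := \matrix_(k, l)
  if k == i then a *+ (l == i) + b *+ (l == j)
  else if k == j then a' *+ (l == i) + b' *+ (l == j) else (k == l)%:R.

Lemma plane_mxE (g : 'I_n -> K) k : i != j ->
  \sum_l plane_mx k l * g l =
  if k == i then a * g i + b * g j else if k == j then a' * g i + b' * g j
  else g k.
Proof.
move=> ij; have pick (c : K) l0 : \sum_l (c *+ (l == l0)) * g l = c * g l0.
  rewrite (bigD1 l0)//= eqxx big1 ?addr0// => l /negbTE ->.
  by rewrite mul0r.
have [->|ki] := eqVneq k i.
  rewrite -!pick -big_split/=; apply: eq_bigr => l _.
  by rewrite mxE eqxx mulrDl.
have [->|kj] := eqVneq k j.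
  rewrite -!pick -big_split/=; apply: eq_bigr => l _.
  by rewrite mxE eq_sym (negbTE ij) eqxx mulrDl.
rewrite -[RHS]mul1r -(pick 1); apply: eq_bigr => l _.
by rewrite mxE (negbTE ki) (negbTE kj) eq_sym.
Qed.

(** The morphism f is the identity for orthogonal matrices and conjugation for unitary ones, so both
    cases share one computation. *)
Lemma plane_mx_gram (f : {rmorphism K -> K}) : i != j ->
  a * f a + b * f b = 1 -> a' * f a' + b' * f b' = 1 ->
  a * f a' + b * f b' = 0 -> a' * f a + b' * f b = 0 ->
  plane_mx *m (map_mx f plane_mx)^T = 1%:M.
Proof.
move=> ij n1 n2 o1 o2; apply/matrixP => k l; rewrite !mxE.
have ji : (j == i) = false by rewrite eq_sym (negbTE ij).
have step m : plane_mx k m * (map_mx f plane_mx)^T m l =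
    plane_mx k m * f (plane_mx l m) by congr (_ * _); rewrite [LHS]mxE [LHS]mxE.
rewrite (eq_bigr _ (fun m _ => step m)) (plane_mxE (fun m => f (plane_mx l m)) k ij).
have Ui : plane_mx i i = a by rewrite mxE !eqxx (negbTE ij) mulr1n mulr0n addr0.
have Uij : plane_mx i j = b by rewrite mxE !eqxx ji mulr1n mulr0n add0r.
have Uji : plane_mx j i = a' by rewrite mxE !eqxx ji (negbTE ij) mulr1n mulr0n addr0.
have Uj : plane_mx j j = b' by rewrite mxE !eqxx ji mulr1n mulr0n add0r.
have U0 k' m : k' != i -> k' != j -> plane_mx k' m = (k' == m)%:R.
  by rewrite mxE => /negbTE -> /negbTE ->.
have [->|ki] := eqVneq k i.
  have [->|li] := eqVneq l i; first by rewrite Ui Uij ?eqxx.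
  have [->|lj] := eqVneq l j; first by rewrite Uji Uj o1 ?ji ?(negbTE ij).
  by rewrite !U0// (negbTE li) (negbTE lj) rmorph0 !mulr0 addr0 ?[i == l]eq_sym ?(negbTE li).
have [->|kj] := eqVneq k j.
  have [->|li] := eqVneq l i; first by rewrite Ui Uij o2 ?ji ?(negbTE ij).
  have [->|lj] := eqVneq l j; first by rewrite Uji Uj ?eqxx.
  by rewrite !U0// (negbTE li) (negbTE lj) rmorph0 !mulr0 addr0 ?[j == l]eq_sym ?(negbTE lj).
have [->|li] := eqVneq l i.
  by rewrite mxE eqxx (negbTE ki) (negbTE kj) !mulr0n addr0 rmorph0.
have [->|lj] := eqVneq l j.
  by rewrite mxE eqxx ji (negbTE ki) (negbTE kj) !mulr0n addr0 rmorph0.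
by rewrite U0// rmorph_nat eq_sym.
Qed.

End plane_rotation.

(** * Rotation invariance of the uniform laws on the spheres *)

Section sphere_rot_invariant.
Local Open Scope complex_scope.
Local Open Scope sesquilinear_scope.
Context {R : realType} {n : nat}.

Lemma sphereR_rot_invariant (sigma : probability (n.-tuple R) R) :
  uniform_sphereR sigma ->
  rot_invariant sigma 1 (fun (i : 'I_n) (t : n.-tuple R) => tnth t i ^+ 2).
Proof.
move=> [full invU]; split.
- by move=> i; apply: measurable_funX; exact: measurable_tnth.
- by move=> i t; exact: sqr_ge0.
- rewrite -full; congr (sigma _); apply/seteqP.
  have E (t : n.-tuple R) : ((vecR t)^T *m vecR t) 0 0 = \sum_i tnth t i ^+ 2.
    by rewrite mxE; apply: eq_bigr => i _; rewrite !mxE expr2.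
  split=> t /= h; last by rewrite -E h mxE.
  by apply/matrixP => i k; rewrite !ord1 E h mxE.
move=> i j ij; exists (fun _ t => tnth t i * tnth t j); split.
- by move=> _; apply: measurable_funM; exact: measurable_tnth.
- by move=> t; rewrite big_ord1 exprMn.
move=> _ t; pose U : 'M[R]_n := plane_mx i j (cos t) (- sin t) (sin t) (cos t).
have phiE x k : tnth (tupR (U *m vecR x)) k =
    if k == i then cos t * tnth x i + - sin t * tnth x j
    else if k == j then sin t * tnth x i + cos t * tnth x j else tnth x k.
  rewrite tnth_mktuple mxE; under eq_bigr do rewrite [vecR _ _ _]mxE.
  exact: (plane_mxE _ _ _ _ (tnth x)).
exists (fun x => tupR (U *m vecR x)); split.
- apply/measurable_fun_tnthP => k; rewrite /comp.
  have -> : (fun x => tnth (tupR (U *m vecR x)) k) = fun x =>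
    if k == i then cos t * tnth x i + - sin t * tnth x j
    else if k == j then sin t * tnth x i + cos t * tnth x j else tnth x k.
    by apply/funext => x; rewrite phiE.
  have mt l := @measurable_tnth _ R n l.
  case: (k == i) => /=; first by apply: measurable_funD; apply: measurable_funM.
  by case: (k == j) => //=; apply: measurable_funD; apply: measurable_funM.
- move=> A mA; apply: invU => //.
  have := @plane_mx_gram R n i j (cos t) (- sin t) (sin t) (cos t) idfun ij.
  have cs := cos2Dsin2 t.
  rewrite map_mx_id//; apply => /=; rewrite -?cs; ring.
- move=> x; rewrite !phiE eqxx [j == i]eq_sym (negbTE ij) eqxx /trace_rot.
  congr (_, _, _); ring.
- by move=> x l li lj; rewrite phiE (negbTE li) (negbTE lj).
Qed.

Lemma sphereC_rot_invariant (sigma : probability (n.-tuple (R * R)) R) :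
  uniform_sphereC sigma ->
  rot_invariant sigma 2
    (fun (i : 'I_n) (t : n.-tuple (R * R)) => (tnth t i).1 ^+ 2 + (tnth t i).2 ^+ 2).
Proof.
move=> [full invU].
have m1 (i : 'I_n) : measurable_fun setT (fun t : n.-tuple (R * R) => (tnth t i).1).
  exact: (measurableT_comp measurable_fst (measurable_tnth i)).
have m2 (i : 'I_n) : measurable_fun setT (fun t : n.-tuple (R * R) => (tnth t i).2).
  exact: (measurableT_comp measurable_snd (measurable_tnth i)).
split.
- by move=> i; apply: measurable_funD; apply: measurable_funX.
- by move=> i t; rewrite addr_ge0 ?sqr_ge0.
- rewrite -full; congr (sigma _); apply/seteqP.
  have E (t : n.-tuple (R * R)) : ((vecC t)^t* *m vecC t) 0 0 =
      (\sum_i ((tnth t i).1 ^+ 2 + (tnth t i).2 ^+ 2))%:C.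
    rewrite mxE rmorph_sum; apply: eq_bigr => i _; rewrite !mxE /toC.
    case: (tnth t i) => x y /=; apply/eqP; rewrite eq_complex /=.
    by apply/andP; split; apply/eqP; ring.
  split=> t /= h.
    by apply/matrixP => i k; rewrite !ord1 E h mxE.
  by have := E t; rewrite h mxE => -[].
move=> i j ij.
(* The phase w = p + i q is 1 for k = 0 and i for k = 1, so Re(e_i conj(w e_j)) is the real, resp.
   imaginary, part of e_i conj(e_j). *)
pose p (k : 'I_2) : R := (k == 0)%:R; pose q (k : 'I_2) : R := (k != 0)%:R.
pose r (k : 'I_2) (t : n.-tuple (R * R)) : R :=
  p k * ((tnth t i).1 * (tnth t j).1 + (tnth t i).2 * (tnth t j).2) +
  q k * ((tnth t i).2 * (tnth t j).1 - (tnth t i).1 * (tnth t j).2).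
exists r; split.
- move=> k; apply: measurable_funD; apply: measurable_funM => //.
    by apply: measurable_funD; apply: measurable_funM.
  by apply: measurable_funB; apply: measurable_funM.
- by move=> t; rewrite /r !big_ord_recl big_ord0 /p /q /=; ring.
move=> k t.
pose w : R[i] := p k +i* q k.
pose U : 'M[R[i]]_n := plane_mx i j (cos t)%:C (- (sin t)%:C * w)
  ((sin t)%:C * w^*) (cos t)%:C.
pose z (x : n.-tuple (R * R)) l : R[i] := toC (tnth x l).
have phiE x l : tnth (tupC (U *m vecC x)) l =
    let v := if l == i then (cos t)%:C * z x i + - (sin t)%:C * w * z x j
      else if l == j then (sin t)%:C * w^* * z x i + (cos t)%:C * z x j else z x l in
    (complex.Re v, complex.Im v).
  rewrite tnth_mktuple mxE.
  have -> : \sum_m U l m * vecC x m 0 = \sum_m U l m * z x m.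
    by apply: eq_bigr => m _; rewrite [vecC _ _ _]mxE.
  by rewrite (plane_mxE _ _ _ _ (z x)).
have phii x : tnth (tupC (U *m vecC x)) i =
  (cos t * (tnth x i).1 - sin t * (p k * (tnth x j).1 - q k * (tnth x j).2),
   cos t * (tnth x i).2 - sin t * (p k * (tnth x j).2 + q k * (tnth x j).1)).
  rewrite phiE eqxx /z /toC /=; congr (_, _); ring.
have phij x : tnth (tupC (U *m vecC x)) j =
  (sin t * (p k * (tnth x i).1 + q k * (tnth x i).2) + cos t * (tnth x j).1,
   sin t * (p k * (tnth x i).2 - q k * (tnth x i).1) + cos t * (tnth x j).2).
  rewrite phiE [j == i]eq_sym (negbTE ij) eqxx /z /toC /=; congr (_, _); ring.
have phil x l : l != i -> l != j -> tnth (tupC (U *m vecC x)) l = tnth x l.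
  move=> li lj; rewrite phiE (negbTE li) (negbTE lj) /z /toC /=.
  by case: (tnth x l).
exists (fun x => tupC (U *m vecC x)); split.
- apply/measurable_fun_tnthP => l; rewrite /comp.
  have [->|li] := eqVneq l i.
    rewrite (funext phii); apply: measurable_fun_pair;
      apply: measurable_funB; apply: measurable_funM => //.
      by apply: measurable_funB; apply: measurable_funM.
    by apply: measurable_funD; apply: measurable_funM.
  have [->|lj] := eqVneq l j.
    rewrite (funext phij); apply: measurable_fun_pair;
      apply: measurable_funD; apply: measurable_funM => //.
      by apply: measurable_funD; apply: measurable_funM.
    by apply: measurable_funB; apply: measurable_funM.
  rewrite (_ : (fun x => _) = fun x => tnth x l); first exact: measurable_tnth.
  by apply/funext => x; exact: phil.
- move=> A mA; apply: invU => //; apply/unitarymxP.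
  have cs := cos2Dsin2 t.
  have := @plane_mx_gram _ n i j (cos t)%:C (- (sin t)%:C * w)
    ((sin t)%:C * w^*) (cos t)%:C Num.conj ij.
  rewrite map_trmx; apply; apply/eqP; rewrite eq_complex /=; apply/andP; split;
    apply/eqP; rewrite -?cs /p /q; case: (k == 0) => /=; ring.
- move=> x; rewrite /trace_rot /r !phii !phij /=.
  rewrite /p /q; case: (k == 0); congr (_, _, _); rewrite /=; ring.
- by move=> x l li lj; rewrite phil.
Qed.

End sphere_rot_invariant.

(** * Conditional expectation as a product of Laplace transforms *)

Section laplace_product.
Context {R : realType} d d' {T : measurableType d} {T' : measurableType d'}.
Variable P : probability T R.

(** The upper bounds make every factor finite, so the product is a real number, and bounds on the
    factors multiply. *)
Lemma laplace_product (I : finType) (J : {set I}) (a : I -> T -> T')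
    (lin : I -> T' -> R) (q : I -> R) :
  (forall i, i \in J -> measurable_fun setT (a i)) ->
  mutually_independent P J a ->
  (forall i, i \in J -> measurable_fun setT (lin i)) ->
  (forall i, i \in J ->
    (\int[P]_w (expR (lin i (a i w)))%:E <= (expR (q i))%:E)%E) ->
  exists2 K : R, (\int[P]_w (expR (\sum_(i in J) lin i (a i w)))%:E = K%:E)%E &
    [/\ 0 <= K, K <= expR (\sum_(i in J) q i) &
      forall delta : R, (forall i, i \in J -> ((expR ((1 - delta) * q i))%:E <=
          \int[P]_w (expR (lin i (a i w)))%:E)%E) ->
        expR ((1 - delta) * \sum_(i in J) q i) <= K].
Proof.
move=> ma indep mlin upper.
pose c i : R := fine (\int[P]_w (expR (lin i (a i w)))%:E).
have int_ge0 i : (0 <= \int[P]_w (expR (lin i (a i w)))%:E)%E.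
  by apply: integral_ge0 => w _; rewrite lee_fin expR_ge0.
have cE i : i \in J -> (\int[P]_w (expR (lin i (a i w)))%:E = (c i)%:E)%E.
  move=> iJ; rewrite fineK// ge0_fin_numE//.
  by apply: le_lt_trans (upper _ iJ) _; rewrite ltry.
have c_ge0 i : 0 <= c i by rewrite fine_ge0.
exists (\prod_(i in J) c i).
  rewrite -(@expect_prod_independent _ _ _ _ _ P _ J a (fun i => expR \o lin i))//.
  - by apply: eq_integral => w _; rewrite expR_sum.
  - by move=> i iJ; apply: measurableT_comp => //; exact: mlin.
  - by move=> i x; exact: expR_ge0.
split.
- exact: prodr_ge0.
- rewrite expR_sum; apply: ler_prod => i iJ.
  by rewrite c_ge0/= -lee_fin -cE// upper.
- move=> delta lower; rewrite mulr_sumr expR_sum; apply: ler_prod => i iJ.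
  by rewrite expR_ge0/= -lee_fin -cE// lower.
Qed.

End laplace_product.

Lemma measurable_sum_in (R : realType) d (S : measurableType d) (I : finType)
    (J : {set I}) (f : I -> S -> R) :
  (forall i, i \in J -> measurable_fun setT (f i)) ->
  measurable_fun setT (fun x => \sum_(i in J) f i x).
Proof.
move=> mf.
have -> : (fun x => \sum_(i in J) f i x) = fun x =>
    \sum_i (if i \in J then f i else cst 0) x.
  apply/funext => x; rewrite big_mkcond; apply: eq_bigr => i _.
  by case: (i \in J).
by apply: measurable_sum => i; have [/mf//|] := boolP (i \in J).
Qed.

(** * The limit for an abstract model with independent entries *)

Section model_limit.
Context {R : realType}.
Variables (beta : nat) (dT dS : nat -> measure_display) (d' : measure_display).
Variables (T : forall N, measurableType (dT N)) (S : forall N, measurableType (dS N)).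
Variables (P : forall N, probability (T N) R) (sigma : forall N, probability (S N) R).
Variables (T' : measurableType d').
Variables (I : nat -> finType) (J : forall N, {set I N}) (a : forall N, I N -> T N -> T').
Variables (lin : forall N, I N -> S N -> T' -> R) (q : forall N, I N -> S N -> R).
Variables (theta : R) (Q : forall N, T N -> S N -> R).
Variables (n_ : nat -> nat) (s : forall N, 'I_(n_ N) -> S N -> R).
Variables (V : forall N, {set 'I_(n_ N)}).
Variables (b : R -> R) (r x0 B bmax m c : R).
Arguments s : clear implicits.
Arguments a : clear implicits.
Arguments lin : clear implicits.
Arguments q : clear implicits.
Arguments Q : clear implicits.
Hypothesis beta0 : (0 < beta)%N.
Hypothesis beta2 : (beta <= 2)%N.
Hypothesis n_E : forall N, n_ N = N.
Hypothesis inv : forall N, (0 < N)%N -> rot_invariant (sigma N) beta (s N).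
Hypothesis ma : forall N i, i \in J N -> measurable_fun setT (a N i).
Hypothesis indep : forall N, mutually_independent (P N) (J N) (a N).
Hypothesis mlin : forall N i, i \in J N ->
  measurable_fun setT (fun z : T' * S N => lin N i z.2 z.1).
Hypothesis QE : forall N w e, (0 < N)%N ->
  theta * N%:R * Q N w e = \sum_(i in J N) lin N i e (a N i w).
Hypothesis qE : forall N e, (0 < N)%N -> simplex_dom (s N) e ->
  \sum_(i in J N) q N i e = N%:R * b (\sum_(l in V N) s N l e).
Hypothesis lap_upper : forall N i e, i \in J N ->
  (\int[P N]_w (expR (lin N i e (a N i w)))%:E <= (expR (q N i e))%:E)%E.
Hypothesis lap_lower : forall delta : R, 0 < delta -> exists2 kappa : R, 0 < kappa &
  forall N e, (0 < N)%N -> simplex_dom (s N) e ->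
    (forall i, s N i e <= kappa / Num.sqrt N%:R) -> forall i, i \in J N ->
    ((expR ((1 - delta) * q N i e))%:E <=
      \int[P N]_w (expR (lin N i e (a N i w)))%:E)%E.
Hypothesis r0 : 0 <= r.
Hypothesis x001 : 0 <= x0 <= 1.
Hypothesis b_le : forall x, 0 <= x <= 1 -> b x <= bmax.
Hypothesis bB : forall x, 0 <= x <= 1 -> b x + beta%:R / 2 * ln (1 + r * x) <= B.
Hypothesis b_near : forall eps : R, 0 < eps -> exists2 eta : R, 0 < eta &
  forall x, 0 <= x <= 1 -> `|x - x0| <= eta ->
    B - eps <= b x + beta%:R / 2 * ln (1 + r * x).
Hypothesis m_def : m = (1 + r) * x0 / (1 + r * x0).
Hypothesis cvg_m : (#|V N|%:R / N%:R : R) @[N --> \oo] --> m.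
Hypothesis c0 : 0 < c.
Hypothesis block_large : \forall N \near \oo, forall i,
  c * N%:R <= #|block_of (V N) i :\ i|%:R.

Let mlin1 N i e : i \in J N -> measurable_fun setT (lin N i e).
Proof.
move=> iJ.
exact: (measurableT_comp (f := fun z : T' * S N => lin N i z.2 z.1) (mlin iJ)
  (@pair2_measurable _ _ T' (S N) e)).
Qed.

(** For fixed e the exponent is a sum of one linear function per independent entry, so
    [laplace_product] compares the inner mean [K] with exp (N b(X)), and [annealed_limit]
    applies. *)
Lemma model_limit :
  (fun N => annealed_F (P N) (sigma N) N theta (Q N)) @ \oo -->
  (B - beta%:R / 2 * m * ln (1 + r))%:E.
Proof.
pose int N e := (\int[P N]_w (expR (\sum_(i in J N) lin N i e (a N i w)))%:E)%E.
pose K N e : R := fine (int N e).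
have lap N e := laplace_product (@ma N) (@indep N) (fun i => @mlin1 N i e)
  (fun i => @lap_upper N i e).
have KE N e : int N e = (K N e)%:E by have [k kE _] := lap N e; rewrite /K /int kE.
have K_ge0 N e : 0 <= K N e by have [k kE []] := lap N e; rewrite /K /int kE.
have mexp N : measurable_fun setT (fun z : T N * S N =>
    (expR (\sum_(i in J N) lin N i z.2 (a N i z.1)))%:E).
  apply/measurable_EFinP; apply: measurableT_comp => //.
  apply: measurable_sum_in => i iJ.
  apply: (measurableT_comp (f := fun z : T' * S N => lin N i z.2 z.1) (mlin iJ)
    (g := fun z : T N * S N => (a N i z.1, z.2))).
  apply: measurable_fun_pair; last exact: measurable_snd.
  by apply: measurableT_comp; [exact: ma|exact: measurable_fst].
have mexp_ge0 N (z : T N * S N) :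
    (0 <= (expR (\sum_(i in J N) lin N i z.2 (a N i z.1)))%:E)%E.
  by rewrite lee_fin expR_ge0.
have mK N : measurable_fun setT (K N).
  apply: (@measurableT_comp _ _ _ _ _ _ fine _ (int N)); first exact: fine_measurable.
  exact: (@measurable_fun_fubini_tonelli_G _ _ _ _ _ (P N) _ (mexp N) (@mexp_ge0 N)).
have full N : (0 < N)%N -> sigma N (simplex_dom (s N)) = 1%E.
  by move=> N0; exact: (simplex_dom_full (inv N0)).
have K_upper N e : (0 < N)%N -> simplex_dom (s N) e ->
    K N e <= expR (N%:R * b (\sum_(l in V N) s N l e)).
  by move=> N0 De; rewrite -qE//; have [k kE []] := lap N e; rewrite /K /int kE.
have bK N : (0 < N)%N -> bounded_mfun (simplex_dom (s N)) (K N).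
  move=> N0; split=> //; exists (expR (N%:R * bmax)) => e De.
  rewrite ger0_norm// (le_trans (K_upper _ _ N0 De))// ler_expR ler_wpM2l//.
  exact/b_le/(s_sum_itv (inv N0)).
apply: (@annealed_limit _ beta dS S sigma n_ s V K b r x0 B bmax m c) => //.
- move=> delta /lap_lower[kappa kappa0 low]; exists kappa => // N e N0 De se.
  rewrite -qE//; have [k kE [_ _ klow]] := lap N e; rewrite /K /int kE/=.
  by apply: klow => i iJ; exact: low.
move=> N N0.
have mD : measurable (simplex_dom (s N)) by exact: (measurable_simplex_dom (inv N0)).
transitivity (\int[P N]_w \int[sigma N]_e
    (expR (\sum_(i in J N) lin N i e (a N i w)))%:E)%E.
  apply: eq_integral => w _; apply: eq_integral => e _.
  by rewrite QE.
(* The entries are integrated first; this exchange is why [mlin] asks for joint measurability. *)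
rewrite (@fubini_tonelli _ _ _ _ _ (P N) (sigma N) _ (mexp N) (@mexp_ge0 N)).
transitivity (\int[sigma N]_e (K N e)%:E)%E.
  by apply: eq_integral => e _; rewrite -KE.
have D0 : sigma N (~` simplex_dom (s N)) = 0%E.
  by rewrite probability_setC// full// subee.
rewrite (@ge0_negligible_integral _ _ _ (sigma N) setT (~` simplex_dom (s N)))//; last 3 first.
- exact: measurableC.
- exact/measurable_EFinP.
- by move=> e _; rewrite lee_fin.
rewrite setTD setCK fineK// integrable_fin_num//.
exact: (bounded_mfun_integrable _ mD (bK _ N0)).
Qed.

End model_limit.

(** * Laplace transforms of entries and expansion of quadratic forms *)

Section entry_laplace.
Context {R : realType} d {T : measurableType d} (P : probability T R).

Lemma laplaceR_distribution (a : {mfun T >-> R}) (t : R) :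
  laplaceR (distribution P a) t = (\int[P]_w (expR (t * a w))%:E)%E.
Proof.
rewrite /laplaceR ge0_integral_distribution//.
by apply/measurable_EFinP; apply: measurableT_comp.
Qed.

Lemma laplaceC_distribution (a : {mfun T >-> (R * R)%type}) (t : R * R) :
  laplaceC (distribution P a) t =
  (\int[P]_w (expR ((a w).1 * t.1 + (a w).2 * t.2))%:E)%E.
Proof.
rewrite /laplaceC ge0_integral_distribution//.
apply/measurable_EFinP; apply: measurableT_comp => //.
apply: measurable_funD; apply: measurable_funM => //.
Qed.

Lemma qR_distribution (v : R) (a : {mfun T >-> R}) (t : R) :
  real_entry P v a -> qR (distribution P a) t = t ^+ 2 / 2 * v.
Proof.
move=> [_]; rewrite unlock => av; rewrite /qR ge0_integral_distribution//.
- by rewrite /comp av.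
- by apply/measurable_EFinP; exact: measurable_funX.
- by move=> x; rewrite lee_fin sqr_ge0.
Qed.

End entry_laplace.

Section model_arithmetic.
Local Open Scope complex_scope.
Local Open Scope sesquilinear_scope.
Context {R : realType}.

(** The factor N is absorbed by the two thresholds kappa / sqrt N, leaving 2 theta kappa:
    delocalization keeps the Laplace arguments in a fixed ball. *)
Lemma sqrt_scale_bound (theta kappa eps x y u : R) (N : nat) :
  0 <= theta -> 0 < kappa -> (0 < N)%N ->
  0 <= x <= kappa / Num.sqrt N%:R -> 0 <= y <= kappa / Num.sqrt N%:R ->
  u <= 4 * theta ^+ 2 * N%:R * (x * y) -> 2 * theta * kappa <= eps ->
  Num.sqrt u <= eps.
Proof.
move=> theta0 kappa0 N0 /andP[x0 xk] /andP[y0 yk] uxy; apply: le_trans.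
have k0 : 0 <= 2 * theta * kappa by rewrite !mulr_ge0// ltW.
have N1 : 0 < N%:R :> R by rewrite ltr0n.
rewrite -[leRHS]ger0_norm// -sqrtr_sqr ler_sqrt ?sqr_ge0//.
apply: (le_trans uxy).
apply: (@le_trans _ _ (4 * theta ^+ 2 * N%:R *
    (kappa / Num.sqrt N%:R * (kappa / Num.sqrt N%:R)))).
  by apply: ler_wpM2l; [rewrite !mulr_ge0 ?sqr_ge0|exact: ler_pM].
rewrite -expr2 expr_div_n sqr_sqrtr ?ler0n// le_eqVlt; apply/orP; left; apply/eqP.
by field; exact: lt0r_neq0.
Qed.

Lemma qformRE n (X : 'M[R]_n) (t : n.-tuple R) :
  qformR X t = \sum_i \sum_j tnth t i * X i j * tnth t j.
Proof.
rewrite /qformR mxE exchange_big/=; apply: eq_bigr => j _.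
by rewrite !mxE mulr_suml; apply: eq_bigr => i _; rewrite !mxE.
Qed.

Lemma qformCE n (X : 'M[R[i]]_n) (t : n.-tuple (R * R)) :
  qformC X t =
  \sum_i \sum_j complex.Re ((toC (tnth t i))^* * X i j * toC (tnth t j)).
Proof.
rewrite /qformC mxE raddf_sum exchange_big/=; apply: eq_bigr => j _.
rewrite !mxE mulr_suml raddf_sum; apply: eq_bigr => i _; rewrite !mxE.
by [].
Qed.

Lemma sum_upper N (F : 'I_N -> 'I_N -> R) :
  \sum_i \sum_j F i j =
  \sum_(p in upper N) (if p.1 == p.2 then F p.1 p.1 else F p.1 p.2 + F p.2 p.1).
Proof.
rewrite pair_bigA/= (bigID (fun p : 'I_N * 'I_N => (p.1 <= p.2)%N))/=.
have -> : \sum_(p : 'I_N * 'I_N | ~~ (p.1 <= p.2)%N) F p.1 p.2 =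
    \sum_(p : 'I_N * 'I_N | (p.1 <= p.2)%N && (p.1 != p.2)) F p.2 p.1.
  rewrite (reindex_inj (h := fun p : 'I_N * 'I_N => (p.2, p.1)))/=; last first.
    by move=> [? ?] [? ?] [-> ->].
  by apply: eq_bigl => -[i j] /=; rewrite -ltnNge ltn_neqAle andbC.
rewrite [in RHS](eq_bigl (fun p : 'I_N * 'I_N => (p.1 <= p.2)%N)); last first.
  by move=> p; rewrite inE.
rewrite [X in _ + X]big_mkcondr -big_split/=; apply: eq_bigr => -[i j] _ /=.
by have [->|] := eqVneq i j; rewrite ?addr0.
Qed.

End model_arithmetic.

(** * The real Wigner model *)

Section wigner_limit.
Context {R : realType} (d : nat -> measure_display).
Context (T : forall N, measurableType (d N)).
Variables (P : forall N, probability (T N) R) (theta : R).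
Hypothesis theta0 : 0 <= theta.

Lemma cvg_card_setT : (#|[set: 'I_N]%SET|%:R / N%:R : R) @[N --> \oo] --> (1 : R).
Proof.
have cst1 : (fun _ : nat => 1 : R) @ \oo --> (1 : R) by exact: cvg_cst.
apply: cvg_trans cst1; apply: near_eq_cvg.
near=> N; rewrite cardsT card_ord divff// pnatr_eq0 -lt0n.
by near: N; exists 1%N.
Unshelve. all: end_near. Qed.

Lemma block_large_setT : \forall N \near \oo, forall i : 'I_N,
  2^-1 * N%:R <= #|block_of [set: 'I_N]%SET i :\ i|%:R :> R.
Proof.
near=> N; move=> i; rewrite /block_of inE.
(* From N = 2 on, N - 1 >= N / 2. *)
have N2 : (2 <= N)%N by near: N; exists 2%N.
have := cardsD1 i [set: 'I_N]%SET; rewrite inE cardsT card_ord add1n => NE.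
have : (2 : R) <= N%:R by rewrite ler_nat.
have NR : N%:R = #|[set: 'I_N]%SET :\ i|%:R + 1 :> R by rewrite natr1 -NE.
by move: NR; move: #|_|%:R (N%:R : R) => x y; lra.
Unshelve. all: end_near. Qed.

Lemma const_objective_near (c x0 : R) (beta : nat) : forall eps : R, 0 < eps ->
  exists2 eta : R, 0 < eta & forall x, 0 <= x <= 1 -> `|x - x0| <= eta ->
    c - eps <= c + beta%:R / 2 * ln (1 + 0 * x).
Proof.
move=> eps eps0; exists 1 => // x _ _.
by rewrite mul0r addr0 ln1 mulr0 addr0 gerBl ltW.
Qed.

(** With s_i = e_i^2, off-diagonal entries contribute 2 theta^2 N s_i s_j and diagonal ones, thanks
    to their variance 2, theta^2 N s_i^2. The sum is theta^2 N times the square of the total mass 1,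
    so b is constant, V is everything and r = 0. *)
Lemma wigner1_limit (a : forall N, 'I_N -> 'I_N -> {RV (P N) >-> R})
    (sigma : forall N, probability (N.-tuple R) R) :
  (forall N, wigner1_entries (a N)) ->
  (forall N, (0 < N)%N -> uniform_sphereR (sigma N)) ->
  laplace_hypothesis (wigner1_laws a) set0 ->
  (fun N => annealed_F (P N) (sigma N) N theta
     (fun w => qformR (wigner1_mx (fun i j => a N i j w)))) @ \oo
    --> (theta ^+ 2 / 1)%:E.
Proof.
move=> entries unif [[lapup _] laplow _].
pose coef N (p : 'I_N * 'I_N) : R := if p.1 == p.2 then 1 else 2.
pose tau N (p : 'I_N * 'I_N) (e : N.-tuple R) : R :=
  theta * Num.sqrt N%:R * coef N p * (tnth e p.1 * tnth e p.2).
pose v N (p : 'I_N * 'I_N) : R := if p.1 == p.2 then 2 else 1.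
pose q N p e : R := tau N p e ^+ 2 / 2 * v N p.
have qE N (p : 'I_N * 'I_N) e : (p.1 <= p.2)%N ->
    qR (distribution (P N) (a N p.1 p.2)) (tau N p e) = q N p e.
  have [_ off diag] := entries N.
  move=> ple; apply: qR_distribution; rewrite /v; have [<-|ne] := eqVneq p.1 p.2.
    exact: diag.
  by apply: off; rewrite ltn_neqAle ne.
have lawP N (p : 'I_N * 'I_N) : (p.1 <= p.2)%N ->
    wigner1_laws a (distribution (P N) (a N p.1 p.2)).
  by move=> ple; exists N, p.1, p.2.
have -> : theta ^+ 2 / 1 = theta ^+ 2 - 1%:R / 2 * 1 * ln (1 + 0) :> R.
  by rewrite addr0 ln1 mulr0 subr0 divr1.
apply: (@model_limit R 1 d _ _ T (fun N => N.-tuple R) P sigma R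
  (fun N => ('I_N * 'I_N)%type) (fun N => upper N) (fun N p => a N p.1 p.2)
  (fun N p e x => tau N p e * x) q theta _ id
  (fun N i e => tnth e i ^+ 2) (fun N => [set: 'I_N]%SET) (fun=> theta ^+ 2)
  0 1 (theta ^+ 2) (theta ^+ 2) 1 2^-1) => //.
- by move=> N N0; apply: sphereR_rot_invariant; exact: unif.
- by move=> N; have [] := entries N.
- move=> N p _; apply: measurable_funM => //; apply: measurable_funM => //.
  have mt l : measurable_fun setT (fun z : R * N.-tuple R => tnth z.2 l).
    exact: (measurableT_comp (measurable_tnth l) measurable_snd).
  exact: measurable_funM.
- move=> N w e N0; rewrite qformRE sum_upper mulr_sumr.
  have sN : Num.sqrt N%:R != 0 :> R by rewrite lt0r_neq0// sqrtr_gt0 ltr0n.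
  have NE : N%:R = Num.sqrt N%:R ^+ 2 :> R by rewrite sqr_sqrtr.
  apply: eq_bigr => -[i j]; rewrite inE /= => lij; rewrite !mxE /tau /coef /=.
  rewrite [in X in _ * X * _]NE; have [->|ne] := eqVneq i j.
    by rewrite leqnn; field.
  have -> : (j <= i)%N = false by apply/negbTE; rewrite -ltnNge ltn_neqAle ne.
  by rewrite lij; field.
- move=> N e N0 De.
  have sN : Num.sqrt N%:R ^+ 2 = N%:R :> R by rewrite sqr_sqrtr.
  transitivity (\sum_i \sum_j N%:R * theta ^+ 2 * (tnth e i ^+ 2 * tnth e j ^+ 2)).
    rewrite sum_upper; apply: eq_bigr => -[i j] _; rewrite /q /tau /v /coef /=.
    move: (Num.sqrt N%:R) sN => r <-.
    by have [->|_] := eqVneq i j; field.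
  have De' : \sum_i tnth e i ^+ 2 = 1 := De.
  under eq_bigr do rewrite -mulr_sumr -mulr_sumr De' mulr1.
  by rewrite -mulr_sumr De' mulr1.
- move=> N p e; rewrite inE => ple.
  by have := lapup _ (lawP N p ple) (tau N p e); rewrite laplaceR_distribution qE.
- move=> delta /laplow[eps eps0 [low _]].
  (* Ensures 2 theta kappa <= eps, with the 1 covering theta = 0. *)
  exists (eps / (2 * theta + 1)); first by rewrite divr_gt0// ltr_wpDl// mulr_ge0.
  move=> N e N0 De se p; rewrite inE => ple.
  have := low _ (lawP N p ple) (tau N p e); rewrite laplaceR_distribution qE//.
  apply; rewrite -sqrtr_sqr.
  have m2 : 0 < 2 * theta + 1 by rewrite ltr_wpDl// mulr_ge0.
  apply: (sqrt_scale_bound theta0 _ N0 (x := tnth e p.1 ^+ 2) (y := tnth e p.2 ^+ 2)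
    (kappa := eps / (2 * theta + 1))); rewrite ?sqr_ge0 ?se ?divr_gt0//.
    have c4 : coef N p ^+ 2 <= 4.
      by rewrite /coef; case: ifP => _; rewrite ?expr1n ?ler1n// expr2 -natrM.
    rewrite /tau !exprMn sqr_sqrtr//; set z := _ ^+ 2 * _ ^+ 2.
    have -> : theta ^+ 2 * N%:R * coef N p ^+ 2 * z =
      coef N p ^+ 2 * (theta ^+ 2 * N%:R * z) by ring.
    rewrite [leRHS](_ : _ = 4 * (theta ^+ 2 * N%:R * z)); last by ring.
    apply: ler_wpM2r c4; apply: mulr_ge0; last by apply: mulr_ge0; exact: sqr_ge0.
    by apply: mulr_ge0 => //; exact: sqr_ge0.
  by rewrite mulrA ler_pdivrMr// mulrC ler_wpM2l ?(ltW eps0)// lerDl.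
- by rewrite ler01 lexx.
- by move=> x _; rewrite mul0r addr0 ln1 mulr0 addr0.
- by move=> eps eps0; apply: (const_objective_near (theta ^+ 2) 1 1 eps0).
- by rewrite mul0r addr0 mulr1 divr1.
- exact: cvg_card_setT.
- exact: block_large_setT.
Qed.

End wigner_limit.

(** * The complex Wigner model *)

Section wigner2_limit.
Local Open Scope complex_scope.
Local Open Scope sesquilinear_scope.
Context {R : realType} (d : nat -> measure_display).
Context (T : forall N, measurableType (d N)).
Variables (P : forall N, probability (T N) R) (theta : R).
Hypothesis theta0 : 0 <= theta.

Lemma qC_E (t : R * R) : qC t = (t.1 ^+ 2 + t.2 ^+ 2) / 4.
Proof. by rewrite /qC /modC sqr_sqrtr// addr_ge0 ?sqr_ge0. Qed.

Lemma wigner2_limit (a : forall N, 'I_N -> 'I_N -> {RV (P N) >-> (R * R)%type})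
    (sigma : forall N, probability (N.-tuple (R * R)) R) :
  (forall N, wigner2_entries (a N)) ->
  (forall N, (0 < N)%N -> uniform_sphereC (sigma N)) ->
  laplace_hypothesis (wigner2_diag_laws a) (wigner2_offdiag_laws a) ->
  (fun N => annealed_F (P N) (sigma N) N theta
     (fun w => qformC (wigner2_mx (fun i j => a N i j w)))) @ \oo
    --> (theta ^+ 2 / 2)%:E.
Proof.
move=> entries unif [[lapR lapC] laplow _].
pose s N (i : 'I_N) (e : N.-tuple (R * R)) : R :=
  (tnth e i).1 ^+ 2 + (tnth e i).2 ^+ 2.
(* Off the diagonal, two conjugate terms add up to 2 Re(a conj(e_i conj(e_j))), so the Laplace
   argument is 2 theta sqrt N e_i conj(e_j). On the diagonal its second component is 0, which
   reduces to the law of the real part. *)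
pose tau N (p : 'I_N * 'I_N) (e : N.-tuple (R * R)) : R * R :=
  if p.1 == p.2 then (theta * Num.sqrt N%:R * s N p.1 e, 0) else
  (2 * theta * Num.sqrt N%:R * ((tnth e p.1).1 * (tnth e p.2).1 +
     (tnth e p.1).2 * (tnth e p.2).2),
   2 * theta * Num.sqrt N%:R * ((tnth e p.1).2 * (tnth e p.2).1 -
     (tnth e p.1).1 * (tnth e p.2).2)).
pose lin N p e (x : R * R) : R := x.1 * (tau N p e).1 + x.2 * (tau N p e).2.
pose q N (p : 'I_N * 'I_N) e : R := if p.1 == p.2 then (tau N p e).1 ^+ 2 / 2
  else ((tau N p e).1 ^+ 2 + (tau N p e).2 ^+ 2) / 4.
have s0 N i e : 0 <= s N i e by rewrite addr_ge0 ?sqr_ge0.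
have diagE N i e : laplaceR (distribution (P N) (fst \o a N i i)) (tau N (i, i) e).1 =
    (\int[P N]_w (expR (lin N (i, i) e (a N i i w)))%:E)%E.
  rewrite laplaceR_distribution; apply: eq_integral => w _; congr (expR _)%:E.
  by rewrite /lin /tau /= eqxx /= mulr0 addr0 mulrC.
have qdiag N i e : qR (distribution (P N) (fst \o a N i i)) (tau N (i, i) e).1 =
    q N (i, i) e.
  have [_ _ _ diag] := entries N.
  rewrite (qR_distribution (v := 1)); last exact: diag.
  by rewrite /q /= eqxx mulr1.
have offE N p e : laplaceC (distribution (P N) (a N p.1 p.2)) (tau N p e) =
    (\int[P N]_w (expR (lin N p e (a N p.1 p.2 w)))%:E)%E.
  by rewrite laplaceC_distribution.
have qoff N p e : p.1 != p.2 -> qC (tau N p e) = q N p e.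
  by move=> ne; rewrite qC_E /q (negbTE ne).
have -> : theta ^+ 2 / 2 = theta ^+ 2 / 2 - 2%:R / 2 * 1 * ln (1 + 0) :> R.
  by rewrite addr0 ln1 mulr0 subr0.
apply: (@model_limit R 2 d _ _ T (fun N => N.-tuple (R * R)) P sigma (R * R)%type
  (fun N => ('I_N * 'I_N)%type) (fun N => upper N) (fun N p => a N p.1 p.2)
  lin q theta _ id s (fun N => [set: 'I_N]%SET) (fun=> theta ^+ 2 / 2)
  0 1 (theta ^+ 2 / 2) (theta ^+ 2 / 2) 1 2^-1) => //.
- by move=> N N0; apply: sphereC_rot_invariant; exact: unif.
- by move=> N; have [] := entries N.
- move=> N p _.
  have mt1 l : measurable_fun setT (fun z : (R * R) * N.-tuple (R * R) => (tnth z.2 l).1).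
    apply: (measurableT_comp measurable_fst).
    exact: (measurableT_comp (measurable_tnth l) measurable_snd).
  have mt2 l : measurable_fun setT (fun z : (R * R) * N.-tuple (R * R) => (tnth z.2 l).2).
    apply: (measurableT_comp measurable_snd).
    exact: (measurableT_comp (measurable_tnth l) measurable_snd).
  have m1 : measurable_fun setT (fun z : (R * R) * N.-tuple (R * R) => z.1.1).
    exact: (measurableT_comp measurable_fst measurable_fst).
  have m2 : measurable_fun setT (fun z : (R * R) * N.-tuple (R * R) => z.1.2).
    exact: (measurableT_comp measurable_snd measurable_fst).
  rewrite /lin /tau; case: (p.1 == p.2) => /=.
    apply: measurable_funD; apply: measurable_funM => //.
    apply: measurable_funM => //.
    by apply: measurable_funD; exact: measurable_funX.
  apply: measurable_funD; apply: measurable_funM => //; apply: measurable_funM => //.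
    by apply: measurable_funD; apply: measurable_funM.
  by apply: measurable_funB; apply: measurable_funM.
- move=> N w e N0; rewrite qformCE sum_upper mulr_sumr.
  have sN : Num.sqrt N%:R != 0 :> R by rewrite lt0r_neq0// sqrtr_gt0 ltr0n.
  have NE : N%:R = Num.sqrt N%:R ^+ 2 :> R by rewrite sqr_sqrtr.
  apply: eq_bigr => -[i j]; rewrite inE /= => lij; rewrite !mxE /lin /tau /s /=.
  rewrite [in X in _ * X * _]NE; have [->|ne] := eqVneq i j.
    rewrite leqnn -fmorphV /toC /= ; move: (Num.sqrt N%:R) sN => r rN0.
    by case: (tnth e j) => x y /=; field.
  have -> : (j <= i)%N = false by apply/negbTE; rewrite -ltnNge ltn_neqAle ne.
  rewrite lij -!fmorphV /toC /=; move: (Num.sqrt N%:R) sN => r rN0.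
  by case: (tnth e i) => x y; case: (tnth e j) => x' y' /=; field.
- move=> N e N0 De.
  have sN : Num.sqrt N%:R ^+ 2 = N%:R :> R by rewrite sqr_sqrtr.
  transitivity (\sum_i \sum_j N%:R * (theta ^+ 2 / 2) * (s N i e * s N j e)).
    rewrite sum_upper; apply: eq_bigr => -[i j] _; rewrite /q /tau /s /=.
    move: (Num.sqrt N%:R) sN => r <-.
    by have [->|_] := eqVneq i j => /=; field.
  have De' : \sum_i s N i e = 1 := De.
  under eq_bigr do rewrite -mulr_sumr -mulr_sumr De' mulr1.
  by rewrite -mulr_sumr De' mulr1.
- move=> N [i j] e; rewrite inE /= => lij; have [<-|ne] := eqVneq i j.
    by rewrite -diagE -qdiag; apply: lapR; exists N, i.
  rewrite -(offE N (i, j)) -qoff//; apply: lapC; exists N, i, j; split=> //.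
  by rewrite ltn_neqAle ne.
- move=> delta /laplow[eps eps0 [lowR lowC]].
  exists (eps / (2 * theta + 1)); first by rewrite divr_gt0// ltr_wpDl// mulr_ge0.
  move=> N e N0 De se [i j]; rewrite inE /= => lij.
  have m2 : 0 < 2 * theta + 1 by rewrite ltr_wpDl// mulr_ge0.
  have sbound u : u <= 4 * theta ^+ 2 * N%:R * (s N i e * s N j e) -> Num.sqrt u <= eps.
    move=> ule; apply: (sqrt_scale_bound theta0 _ N0 (x := s N i e) (y := s N j e)
    (kappa := eps / (2 * theta + 1))); rewrite ?s0 ?se ?divr_gt0//.
    by rewrite mulrA ler_pdivrMr// mulrC ler_wpM2l ?(ltW eps0)// lerDl.
  have [ij|ne] := eqVneq i j.
    rewrite -{j}ij in sbound lij *.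
    rewrite -diagE -qdiag; apply: lowR; first by exists N, i.
    rewrite -sqrtr_sqr; apply: sbound.
    rewrite /tau /= eqxx /= !exprMn sqr_sqrtr// -expr2.
    by rewrite -[4 * _ * _]mulrA -[leRHS]mulrA ler_peMl ?mulr_ge0 ?sqr_ge0// ler1n.
  rewrite -(offE N (i, j)) -qoff//; apply: lowC.
    by exists N, i, j; split=> //; rewrite ltn_neqAle ne.
  apply: sbound; rewrite /tau /= (negbTE ne) /=.
  have NE : N%:R = Num.sqrt N%:R ^+ 2 :> R by rewrite sqr_sqrtr.
  rewrite [in leRHS]NE le_eqVlt; apply/orP; left; apply/eqP.
  by move: (Num.sqrt _) => r; rewrite /s; ring.
- by rewrite ler01 lexx.
- by move=> x _; rewrite mul0r addr0 ln1 mulr0 addr0.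
- by move=> eps eps0; apply: (const_objective_near (theta ^+ 2 / 2) 1 2 eps0).
- by rewrite mul0r addr0 mulr1 divr1.
- exact: cvg_card_setT.
- exact: block_large_setT.
Qed.

End wigner2_limit.

(** * Asymptotic proportions of the Wishart blocks *)

Section wishart_blocks.
Context {R : realType}.

Definition rblock L M : {set 'I_(L + M)} := [set rshift L j | j : 'I_M]%SET.

Lemma sum_rblock L M (f : 'I_(L + M) -> R) :
  \sum_(l in rblock L M) f l = \sum_j f (rshift L j).
Proof. by rewrite big_imset//= => i j _ _ /rshift_inj. Qed.

Lemma card_rblock L M : #|rblock L M| = M.
Proof. by rewrite card_imset ?card_ord//; exact: rshift_inj. Qed.

Lemma card_rblockC L M : #|~: rblock L M| = L.
Proof. by apply/eqP; rewrite -(eqn_add2l #|rblock L M|) cardsC card_rblock card_ord addnC. Qed.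

Lemma continuous_lower_near (h : R -> R) (x0 : R) : {for x0, continuous h} ->
  forall eps : R, 0 < eps -> exists2 eta : R, 0 < eta &
    forall x, `|x - x0| <= eta -> h x0 - eps <= h x.
Proof.
move=> /cvgrPdist_le ch eps /ch /nbhs_ballP[e /= e0 sub].
exists (e / 2); first by rewrite divr_gt0.
move=> x xe; have : ball x0 e x.
  by rewrite /ball/= distrC (le_lt_trans xe)// ltr_pdivrMr// ltr_pMr// ltr1n.
by move=> /sub; rewrite /= ler_distl => /andP[_]; rewrite lerBlDr.
Qed.

Lemma wishart_objective_near (t c r x0 : R) : 0 < 1 + r * x0 ->
  forall eps : R, 0 < eps -> exists2 eta : R, 0 < eta &
    forall x, 0 <= x <= 1 -> `|x - x0| <= eta ->
      t * (x0 * (1 - x0)) + c * ln (1 + r * x0) - eps <=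
      t * (x * (1 - x)) + c * ln (1 + r * x).
Proof.
move=> S0 eps eps0.
pose h x := t * (x * (1 - x)) + c * ln (1 + r * x).
have ch : {for x0, continuous h}.
  apply: differentiable_continuous; apply/derivable1_diffP.
  have dln := is_derive1_ln S0.
  have dS : is_derive x0 1 (fun x : R => 1 + r * x) r.
    by apply: is_derive_eq; rewrite /GRing.scale/=; ring.
  have dl := @is_derive1_comp _ (@ln R) (fun x : R => 1 + r * x) x0 _ _ dln dS.
  have dp : derivable (fun x : R => t * (x * (1 - x))) x0 1 by exact: ex_derive.
  have dcl : derivable (fun x : R => c * ln (1 + r * x)) x0 1.
    by apply: derivableM; [exact: derivable_cst|case: dl].
  exact: derivableD.
have [eta eta0 near] := continuous_lower_near ch eps0.
by exists eta => // x _; exact: near.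
Qed.

Variables (L M : nat -> nat) (alpha kappa : R).
Hypothesis LM : forall N, (L N + M N)%N = N.
Hypothesis L_le_M : forall N, (L N <= M N)%N.
Hypothesis alpha1 : 1 < alpha.
Hypothesis kappa0 : 0 < kappa.
Hypothesis ratio : \forall N \near \oo,
  `|(M N)%:R / (L N)%:R - alpha| <= N%:R `^ (- kappa).

Let cvg_powRN : (N%:R `^ (- kappa) : R) @[N --> \oo] --> (0 : R).
Proof.
have -> : (fun N => N%:R `^ (- kappa)) = (fun N => N%:R^-1 `^ kappa : R).
  by apply/funext => N; rewrite -mulN1r powRrM powR_inv1.
have /cvgrPdist_le pow0 := @powR_cvg0 R _ kappa0.
apply/cvgrPdist_le => eps eps0.
have /nbhs_ballP[e /= e0 sub] := pow0 _ eps0.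
have /cvgrPdist_lt/(_ _ e0) := @cvg_invn R.
move=> inve; near=> N.
have N0 : (0 < N)%N by near: N; exists 1%N.
apply: sub; last by rewrite /= invr_gt0 ltr0n.
by near: N.
Unshelve. all: end_near. Qed.

Let cvg_ratio : ((M N)%:R / (L N)%:R : R) @[N --> \oo] --> alpha.
Proof.
apply/cvgrPdist_le => eps eps0.
near=> N; rewrite distrC; apply: (@le_trans _ _ (N%:R `^ (- kappa))).
  by near: N.
rewrite -[leLHS]ger0_norm ?powR_ge0// -normrN -[X in `|X|]add0r.
by near: N; move/cvgrPdist_le : cvg_powRN; exact.
Unshelve. all: end_near. Qed.

Let L_gt0 : \forall N \near \oo, (0 < L N)%N.
Proof.
have gt1 : \forall N \near \oo, (1 : R) < (M N)%:R / (L N)%:R.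
  exact: (cvgr_gt _ cvg_ratio).
(* Division by 0 gives 0, so a ratio above 1 forces L to be nonzero. *)
apply: filterS gt1 => N; rewrite lt0n; apply: contraTneq => ->.
by rewrite invr0 mulr0 ltr10.
Qed.

Lemma cvg_rblock : (#|rblock (L N) (M N)|%:R / N%:R : R) @[N --> \oo] -->
  alpha / (1 + alpha).
Proof.
have a1 : 1 + alpha != 0 by rewrite lt0r_neq0// addr_gt0// (lt_trans _ alpha1).
have h : ((M N)%:R / (L N)%:R / (1 + (M N)%:R / (L N)%:R) : R) @[N --> \oo] -->
    alpha / (1 + alpha).
  apply: cvgM => //; apply: cvgV => //.
  by apply: cvgD => //; exact: cvg_cst.
apply: cvg_trans h; apply: near_eq_cvg; near=> N; rewrite card_rblock.
have L0 : (0 < L N)%N by near: N.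
have lN : (L N)%:R != 0 :> R by rewrite pnatr_eq0 -lt0n.
have NLM : N%:R = (L N)%:R + (M N)%:R :> R by rewrite -natrD LM.
have LMn : (L N)%:R + (M N)%:R != 0 :> R.
  by rewrite -natrD pnatr_eq0 -lt0n addn_gt0 L0.
rewrite NLM; field.
by rewrite lN LMn.
Unshelve. all: end_near. Qed.

(** As L <= M, both blocks have at least L elements, and (L - 1) / N tends to 1 - m > 0, where m =
    alpha / (1 + alpha); half of this limit is a valid constant. *)
Lemma block_large_rblock : \forall N \near \oo, forall i : 'I_(L N + M N),
  (1 - alpha / (1 + alpha)) / 2 * N%:R <=
    #|block_of (rblock (L N) (M N)) i :\ i|%:R :> R.
Proof.
set l := 1 - _.
have l0 : 0 < l.
  by rewrite subr_gt0 ltr_pdivrMr ?mul1r ?ltrDr// addr_gt0// (lt_trans _ alpha1).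
have lim : (1 - #|rblock (L N) (M N)|%:R / N%:R - N%:R^-1 : R) @[N --> \oo] --> l.
  rewrite -[X in _ --> X]subr0; apply: cvgB; last exact: cvg_invn.
  by apply: cvgB; [exact: cvg_cst|exact: cvg_rblock].
have gtl : \forall N \near \oo,
    l / 2 < 1 - #|rblock (L N) (M N)|%:R / N%:R - N%:R^-1.
  by apply: (cvgr_gt _ lim); rewrite ltr_pdivrMr// ltr_pMr// ltr1n.
near=> N => i.
have N0 : (0 < N)%N by near: N; exists 1%N.
have N0r : N%:R != 0 :> R by rewrite pnatr_eq0 -lt0n.
have NLM : N%:R = (L N)%:R + (M N)%:R :> R by rewrite -natrD LM.
have iB : i \in block_of (rblock (L N) (M N)) i.
  by rewrite /block_of; case: ifPn => // iV; rewrite inE.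
have LB : (L N <= #|block_of (rblock (L N) (M N)) i|)%N.
  by rewrite /block_of; case: ifP => _; rewrite ?card_rblockC ?card_rblock.
apply: (@le_trans _ _ ((L N)%:R - 1)).
  have : l / 2 < 1 - #|rblock (L N) (M N)|%:R / N%:R - N%:R^-1 by near: N.
  rewrite card_rblock -(@ltr_pM2r _ N%:R) ?ltr0n// => /ltW /le_trans; apply.
  rewrite 2!mulrBl mul1r divfK// mulVf// {1}NLM addrK//.
rewrite lerBlDr natr1 ler_nat; apply: leq_trans LB _.
by rewrite (cardsD1 i) iB.
Unshelve. all: end_near. Qed.

End wishart_blocks.

(** * The real and complex Wishart models *)

Section wishart_limit.
Local Open Scope complex_scope.
Local Open Scope sesquilinear_scope.
Context {R : realType} (d : nat -> measure_display).
Context (T : forall N, measurableType (d N)).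
Variables (P : forall N, probability (T N) R) (theta : R).
Hypothesis theta0 : 0 <= theta.
Variables (L M : nat -> nat) (alpha kappa : R).
Hypothesis LM : forall N, (L N + M N)%N = N.
Hypothesis L_le_M : forall N, (L N <= M N)%N.
Hypothesis alpha1 : 1 < alpha.
Hypothesis kappa0 : 0 < kappa.
Hypothesis ratio : \forall N \near \oo,
  `|(M N)%:R / (L N)%:R - alpha| <= N%:R `^ (- kappa).

Let LMr N : (L N + M N)%:R = N%:R :> R. Proof. by rewrite LM. Qed.

Let sum_lblock N (f : 'I_(L N + M N) -> R) : \sum_l f l = 1 ->
  (\sum_i f (lshift (M N) i)) * (\sum_j f (rshift (L N) j)) =
  (\sum_(l in rblock (L N) (M N)) f l) * (1 - \sum_(l in rblock (L N) (M N)) f l).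
Proof.
move=> f1; rewrite [LHS]mulrC !sum_rblock; congr (_ * _).
by rewrite -f1 big_split_ord/= addrK.
Qed.

(** Each entry of G occurs in both off-diagonal blocks, whence the 2 in [tau]. The exponents 2
    theta^2 N s_i s_j, with one index in each block, sum to 2 theta^2 N x (1 - x). *)
Lemma wishart1_limit (g : forall N, 'I_(L N) -> 'I_(M N) -> {RV (P N) >-> R})
    (sigma : forall N, probability ((L N + M N).-tuple R) R) :
  (forall N, wishart1_entries (g N)) ->
  (forall N, (0 < N)%N -> uniform_sphereR (sigma N)) ->
  laplace_hypothesis (wishart_laws g) set0 ->
  (fun N => annealed_F (P N) (sigma N) N theta
     (fun w => qformR (wishart1_mx (fun i j => g N i j w)))) @ \oo
    --> F_wishart 1 alpha theta.
Proof.
move=> entries unif [[lapup _] laplow _].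
have [x0 [r [B [[x001 r0 mE bB BE] ->]]]] :=
  wishart_variational theta (ltn0Sn 0) alpha1.
pose tau N (p : 'I_(L N) * 'I_(M N)) (e : (L N + M N).-tuple R) : R :=
  2 * theta * Num.sqrt N%:R *
  (tnth e (lshift (M N) p.1) * tnth e (rshift (L N) p.2)).
pose q N p e : R := tau N p e ^+ 2 / 2 * 1.
have qE N p e : qR (distribution (P N) (g N p.1 p.2)) (tau N p e) = q N p e.
  by have [_ ent] := entries N; apply: qR_distribution.
have lawP N p : wishart_laws g (distribution (P N) (g N p.1 p.2)).
  by exists N, p.1, p.2.
have t0 : 0 <= 2 * theta ^+ 2 / 1%:R by rewrite divr_ge0 ?mulr_ge0 ?sqr_ge0.
have S0 : 0 < 1 + r * x0.
  by rewrite ltr_wpDr// mulr_ge0//; have /andP[] := x001.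
apply: (@model_limit R 1 d _ _ T (fun N => (L N + M N).-tuple R) P sigma R
  (fun N => ('I_(L N) * 'I_(M N))%type) (fun N => [set: 'I_(L N) * 'I_(M N)]%SET)
  (fun N p => g N p.1 p.2) (fun N p e x => tau N p e * x) q theta _
  (fun N => (L N + M N)%N) (fun N i e => tnth e i ^+ 2)
  (fun N => rblock (L N) (M N)) (fun x => 2 * theta ^+ 2 / 1%:R * (x * (1 - x)))
  r x0 B (2 * theta ^+ 2 / 1%:R) (alpha / (1 + alpha))
  ((1 - alpha / (1 + alpha)) / 2)) => //.
- by move=> N N0; apply: sphereR_rot_invariant; exact: unif.
- by move=> N; have [] := entries N.
- move=> N p _; apply: measurable_funM => //; apply: measurable_funM => //.
  have mt l : measurable_fun setT (fun z : R * (L N + M N).-tuple R => tnth z.2 l).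
    exact: (measurableT_comp (measurable_tnth l) measurable_snd).
  exact: measurable_funM.
- move=> N w e N0; rewrite qformRE.
  have sN : Num.sqrt N%:R != 0 :> R by rewrite lt0r_neq0// sqrtr_gt0 ltr0n.
  have NE : N%:R = Num.sqrt N%:R ^+ 2 :> R by rewrite sqr_sqrtr.
  rewrite /wishart1_mx LMr.
  pose G i j : R := tnth e (lshift (M N) i) * (g N i j w / Num.sqrt N%:R) *
    tnth e (rshift (L N) j).
  transitivity (theta * N%:R * (\sum_i \sum_j G i j + \sum_i \sum_j G i j)).
    congr (_ * _); rewrite big_split_ord/=; congr (_ + _).
      apply: eq_bigr => i _; rewrite big_split_ord/= big1 ?add0r.
        by apply: eq_bigr => j _; rewrite block_mxEur !mxE /G [_^-1 * _]mulrC.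
      by move=> j _; rewrite block_mxEul mxE mulr0 mul0r.
    rewrite exchange_big big_split_ord/= [X in _ + X]big1 ?addr0; last first.
      move=> j _; apply: big1 => i _.
      by rewrite block_mxEdr mxE mulr0 mul0r.
    apply: eq_bigr => i _; apply: eq_bigr => j _.
    by rewrite block_mxEdl !mxE /G [_^-1 * _]mulrC; ring.
  rewrite pair_bigA/= -mulr2n -[_ *+ 2]mulr_natl mulrA mulr_sumr.
  rewrite [in RHS](eq_bigl predT); last by move=> p; rewrite inE.
  apply: eq_bigr => -[i j] _; rewrite /tau /G /= [in X in X * _ * _ = _]NE.
  by field.
- move=> N e N0 De.
  have sN : Num.sqrt N%:R ^+ 2 = N%:R :> R by rewrite sqr_sqrtr.
  rewrite -(@sum_lblock N (fun l => tnth e l ^+ 2))//.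
  rewrite (eq_bigl predT); last by move=> p; rewrite inE.
  rewrite big_distrlr/= pair_bigA/= !mulr_sumr.
  apply: eq_bigr => -[i j] _; rewrite /q /tau /=.
  by move: (Num.sqrt N%:R) sN => u <-; field.
- move=> N p e _.
  by have := lapup _ (lawP N p) (tau N p e); rewrite laplaceR_distribution qE.
- move=> delta /laplow[eps eps0 [low _]].
  exists (eps / (2 * theta + 1)); first by rewrite divr_gt0// ltr_wpDl// mulr_ge0.
  move=> N e N0 De se p _.
  have := low _ (lawP N p) (tau N p e); rewrite laplaceR_distribution qE//.
  apply; rewrite -sqrtr_sqr.
  have m2 : 0 < 2 * theta + 1 by rewrite ltr_wpDl// mulr_ge0.
  apply: (sqrt_scale_bound theta0 _ N0 (x := tnth e (lshift (M N) p.1) ^+ 2)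
    (y := tnth e (rshift (L N) p.2) ^+ 2)
    (kappa := eps / (2 * theta + 1))); rewrite ?sqr_ge0 ?se ?divr_gt0//.
    have NE : N%:R = Num.sqrt N%:R ^+ 2 :> R by rewrite sqr_sqrtr.
    rewrite /tau [in leRHS]NE le_eqVlt; apply/orP; left; apply/eqP.
    by move: (Num.sqrt _) => u; ring.
  by rewrite mulrA ler_pdivrMr// mulrC ler_wpM2l ?(ltW eps0)// lerDl.
- move=> x /andP[x_ge0 x1]; rewrite ler_piMr// mulr_ile1 ?subr_ge0//.
  by rewrite lerBlDr lerDl.
- by move=> eps eps0; rewrite BE; exact: wishart_objective_near.
- exact: (cvg_rblock LM alpha1 kappa0 ratio).
- by rewrite divr_gt0// subr_gt0 ltr_pdivrMr ?mul1r ?ltrDr// addr_gt0// (lt_trans _ alpha1).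
- exact: (block_large_rblock LM L_le_M alpha1 kappa0 ratio).
Qed.

(** Here |t|^2 / 4 replaces t^2 / 2, which halves the coefficient of x (1 - x) with respect to the
    real case. *)
Lemma wishart2_limit
    (g : forall N, 'I_(L N) -> 'I_(M N) -> {RV (P N) >-> (R * R)%type})
    (sigma : forall N, probability ((L N + M N).-tuple (R * R)) R) :
  (forall N, wishart2_entries (g N)) ->
  (forall N, (0 < N)%N -> uniform_sphereC (sigma N)) ->
  laplace_hypothesis set0 (wishart_laws g) ->
  (fun N => annealed_F (P N) (sigma N) N theta
     (fun w => qformC (wishart2_mx (fun i j => g N i j w)))) @ \oo
    --> F_wishart 2 alpha theta.
Proof.
move=> entries unif [[_ lapup] laplow _].
have [x0 [r [B [[x001 r0 mE bB BE] ->]]]] :=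
  wishart_variational theta (ltn0Sn 1) alpha1.
pose s N i (e : (L N + M N).-tuple (R * R)) : R :=
  (tnth e i).1 ^+ 2 + (tnth e i).2 ^+ 2.
pose tau N (p : 'I_(L N) * 'I_(M N)) (e : (L N + M N).-tuple (R * R)) : R * R :=
  let u := tnth e (lshift (M N) p.1) in let v := tnth e (rshift (L N) p.2) in
  (2 * theta * Num.sqrt N%:R * (u.1 * v.1 + u.2 * v.2),
   2 * theta * Num.sqrt N%:R * (u.2 * v.1 - u.1 * v.2)).
pose lin N p e (x : R * R) : R := x.1 * (tau N p e).1 + x.2 * (tau N p e).2.
pose q N p e : R := ((tau N p e).1 ^+ 2 + (tau N p e).2 ^+ 2) / 4.
have s0 N i e : 0 <= s N i e by rewrite addr_ge0 ?sqr_ge0.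
have lawP N p : wishart_laws g (distribution (P N) (g N p.1 p.2)).
  by exists N, p.1, p.2.
have t0 : 0 <= 2 * theta ^+ 2 / 2%:R by rewrite divr_ge0 ?mulr_ge0 ?sqr_ge0.
have S0 : 0 < 1 + r * x0.
  by rewrite ltr_wpDr// mulr_ge0//; have /andP[] := x001.
apply: (@model_limit R 2 d _ _ T (fun N => (L N + M N).-tuple (R * R)) P sigma
  (R * R)%type
  (fun N => ('I_(L N) * 'I_(M N))%type) (fun N => [set: 'I_(L N) * 'I_(M N)]%SET)
  (fun N p => g N p.1 p.2) lin q theta _
  (fun N => (L N + M N)%N) s
  (fun N => rblock (L N) (M N)) (fun x => 2 * theta ^+ 2 / 2%:R * (x * (1 - x)))
  r x0 B (2 * theta ^+ 2 / 2%:R) (alpha / (1 + alpha))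
  ((1 - alpha / (1 + alpha)) / 2)) => //.
- by move=> N N0; apply: sphereC_rot_invariant; exact: unif.
- by move=> N; have [] := entries N.
- move=> N p _.
  pose Z := ((R * R) * (L N + M N).-tuple (R * R))%type.
  have mt1 l : measurable_fun setT (fun z : Z => (tnth z.2 l).1).
    apply: (measurableT_comp measurable_fst).
    exact: (measurableT_comp (measurable_tnth l) measurable_snd).
  have mt2 l : measurable_fun setT (fun z : Z => (tnth z.2 l).2).
    apply: (measurableT_comp measurable_snd).
    exact: (measurableT_comp (measurable_tnth l) measurable_snd).
  have m1 : measurable_fun setT (fun z : Z => z.1.1).
    exact: (measurableT_comp measurable_fst measurable_fst).
  have m2 : measurable_fun setT (fun z : Z => z.1.2).
    exact: (measurableT_comp measurable_snd measurable_fst).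
  rewrite /lin /tau /=.
  apply: measurable_funD; apply: measurable_funM => //; apply: measurable_funM => //.
    by apply: measurable_funD; apply: measurable_funM.
  by apply: measurable_funB; apply: measurable_funM.
- move=> N w e N0; rewrite qformCE.
  have sN : Num.sqrt N%:R != 0 :> R by rewrite lt0r_neq0// sqrtr_gt0 ltr0n.
  have NE : N%:R = Num.sqrt N%:R ^+ 2 :> R by rewrite sqr_sqrtr.
  rewrite /wishart2_mx LMr.
  pose H i j : R := complex.Re ((toC (tnth e (lshift (M N) i)))^* *
     ((Num.sqrt N%:R)^-1%:C * toC (g N i j w)) * toC (tnth e (rshift (L N) j))).
  transitivity (theta * N%:R * (\sum_i \sum_j H i j + \sum_i \sum_j H i j)).
    congr (_ * _); rewrite big_split_ord/=; congr (_ + _).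
      apply: eq_bigr => i _; rewrite big_split_ord/= big1 ?add0r.
        by apply: eq_bigr => j _; rewrite block_mxEur !mxE /H.
      by move=> j _; rewrite block_mxEul mxE mulr0 mul0r.
    rewrite exchange_big big_split_ord/= [X in _ + X]big1 ?addr0; last first.
      move=> j _; apply: big1 => i _.
      by rewrite block_mxEdr mxE mulr0 mul0r.
    apply: eq_bigr => i _; apply: eq_bigr => j _.
    rewrite block_mxEdl !mxE /H /toC.
    case: (tnth e (lshift _ i)) => x y; case: (tnth e (rshift _ j)) => x' y'.
    by case: (g N i j w) => z z' /=; ring.
  rewrite pair_bigA/= -mulr2n -[_ *+ 2]mulr_natl mulrA mulr_sumr.
  rewrite [in RHS](eq_bigl predT); last by move=> p; rewrite inE.
  apply: eq_bigr => -[i j] _; rewrite /lin /tau /H /toC /= [in X in X * _ * _ = _]NE.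
  by field.
- move=> N e N0 De.
  have sN : Num.sqrt N%:R ^+ 2 = N%:R :> R by rewrite sqr_sqrtr.
  rewrite -(@sum_lblock N (fun l => s N l e))//.
  rewrite (eq_bigl predT); last by move=> p; rewrite inE.
  rewrite big_distrlr/= pair_bigA/= !mulr_sumr.
  apply: eq_bigr => -[i j] _; rewrite /q /tau /s /=.
  by move: (Num.sqrt N%:R) sN => u <-; field.
- move=> N p e _; have := lapup _ (lawP N p) (tau N p e).
  by rewrite laplaceC_distribution qC_E.
- move=> delta /laplow[eps eps0 [_ low]].
  exists (eps / (2 * theta + 1)); first by rewrite divr_gt0// ltr_wpDl// mulr_ge0.
  move=> N e N0 De se p _.
  have := low _ (lawP N p) (tau N p e); rewrite laplaceC_distribution qC_E.
  apply; rewrite /modC.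
  have m2 : 0 < 2 * theta + 1 by rewrite ltr_wpDl// mulr_ge0.
  apply: (sqrt_scale_bound theta0 _ N0 (x := s N (lshift (M N) p.1) e)
    (y := s N (rshift (L N) p.2) e)
    (kappa := eps / (2 * theta + 1))); rewrite ?s0 ?se ?divr_gt0//.
    have NE : N%:R = Num.sqrt N%:R ^+ 2 :> R by rewrite sqr_sqrtr.
    rewrite /tau [in leRHS]NE le_eqVlt; apply/orP; left; apply/eqP.
    by move: (Num.sqrt _) => u; rewrite /s /=; ring.
  by rewrite mulrA ler_pdivrMr// mulrC ler_wpM2l ?(ltW eps0)// lerDl.
- move=> x /andP[x_ge0 x1]; rewrite ler_piMr// mulr_ile1 ?subr_ge0//.
  by rewrite lerBlDr lerDl.
- by move=> eps eps0; rewrite BE; exact: wishart_objective_near.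
- exact: (cvg_rblock LM alpha1 kappa0 ratio).
- by rewrite divr_gt0// subr_gt0 ltr_pdivrMr ?mul1r ?ltrDr// addr_gt0// (lt_trans _ alpha1).
- exact: (block_large_rblock LM L_le_M alpha1 kappa0 ratio).
Qed.

End wishart_limit.

Unset Implicit Arguments.

Theorem theorem1p17 (R : realType) (d : nat -> measure_display)
    (T : forall N, measurableType (d N))
    (P : forall N, probability (T N) R) (theta : R) (theta0 : 0 <= theta) :
  [/\ (* beta = 1 *)
      forall (a : forall N, 'I_N -> 'I_N -> {RV (P N) >-> R})
             (sigma : forall N, probability (N.-tuple R) R),
        (forall N, wigner1_entries (a N)) ->
        (forall N, (0 < N)%N -> uniform_sphereR (sigma N)) ->
        laplace_hypothesis (wigner1_laws a) set0 ->
        concentration_hypothesis (wigner1_laws a) set0 ->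
        (fun N => annealed_F (P N) (sigma N) N theta
           (fun w => qformR (wigner1_mx (fun i j => a N i j w)))) @ \oo
          --> (theta ^+ 2 / 1)%:E,
      (* beta = 2 *)
      forall (a : forall N, 'I_N -> 'I_N -> {RV (P N) >-> (R * R)%type})
             (sigma : forall N, probability (N.-tuple (R * R)) R),
        (forall N, wigner2_entries (a N)) ->
        (forall N, (0 < N)%N -> uniform_sphereC (sigma N)) ->
        laplace_hypothesis (wigner2_diag_laws a) (wigner2_offdiag_laws a) ->
        concentration_hypothesis (wigner2_diag_laws a)
          (wigner2_offdiag_laws a) ->
        (fun N => annealed_F (P N) (sigma N) N theta
           (fun w => qformC (wigner2_mx (fun i j => a N i j w)))) @ \oo
          --> (theta ^+ 2 / 2)%:E &
      forall (L M : nat -> nat) (alpha kappa : R),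
        (forall N, (L N + M N)%N = N) -> (forall N, (L N <= M N)%N) ->
        1 < alpha -> 0 < kappa ->
        (\forall N \near \oo,
           `|(M N)%:R / (L N)%:R - alpha| <= N%:R `^ (- kappa)) ->
      (* beta = w_1 *)
      (forall (g : forall N, 'I_(L N) -> 'I_(M N) -> {RV (P N) >-> R})
              (sigma : forall N, probability ((L N + M N).-tuple R) R),
        (forall N, wishart1_entries (g N)) ->
        (forall N, (0 < N)%N -> uniform_sphereR (sigma N)) ->
        laplace_hypothesis (wishart_laws g) set0 ->
        concentration_hypothesis (wishart_laws g) set0 ->
        (fun N => annealed_F (P N) (sigma N) N theta
           (fun w => qformR (wishart1_mx (fun i j => g N i j w)))) @ \oo
          --> F_wishart 1 alpha theta) /\
      (* beta = w_2 *)
      (forall (g : forall N, 'I_(L N) -> 'I_(M N) -> {RV (P N) >-> (R * R)%type})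
              (sigma : forall N, probability ((L N + M N).-tuple (R * R)) R),
        (forall N, wishart2_entries (g N)) ->
        (forall N, (0 < N)%N -> uniform_sphereC (sigma N)) ->
        laplace_hypothesis set0 (wishart_laws g) ->
        concentration_hypothesis set0 (wishart_laws g) ->
        (fun N => annealed_F (P N) (sigma N) N theta
           (fun w => qformC (wishart2_mx (fun i j => g N i j w)))) @ \oo
          --> F_wishart 2 alpha theta)].
Proof.
split=> [a sigma ent unif lap _|a sigma ent unif lap _|
    L M alpha kappa LM L_le_M alpha1 kappa0 ratio].
- exact: wigner1_limit.
- exact: wigner2_limit.
split=> g sigma ent unif lap _.
- exact: (wishart1_limit theta0 LM L_le_M alpha1 kappa0 ratio ent unif lap).
- exact: (wishart2_limit theta0 LM L_le_M alpha1 kappa0 ratio ent unif lap).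
Qed.
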